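(* Let $K$ be a compact subset of $\mathbb{C}\setminus\{0\}$ with $\mathrm{cap}_{0,\infty}(K)=1$. Let $s_1\ge 0$ and $s_2\ge 0$ with $s_1+s_2=1$ satisfy $$s_1\lim_{z\to 0}[g_K(z,0)+\log|z|]+s_2\,g_K(0,\infty)=0,\qquad s_1\,g_K(\infty,0)+s_2\lim_{z\to\infty}[g_K(z,\infty)-\log|z|]=0,$$ and put $\nu_K:=s_1\nu_K^0+s_2\nu_K^\infty$. If $\{p_n\}$ is a sequence of polynomials in $\mathbb{Z}[z]$ with simple zeros and with $p_n(0)\neq 0$ such that $\mathrm{h}_K(p_n)\to 0$ and $\deg p_n\to\infty$ as $n\to\infty$, then $$\nu_n:=\frac{1}{\deg p_n}\sum_{p_n(x)=0}\delta_x\ \longrightarrow\ \nu_K\quad\text{as } n\to\infty$$ in the weak* topology, i.e. $\lim_{n\to\infty}\int_{\mathbb{C}} f\,d\nu_n=\int_{\mathbb{C}} f\,d\nu_K$ for every bounded continuous function $f$ on $\mathbb{C}$.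
   Context: Potential theory. For a compactly supported probability measure $\nu$ on $\mathbb{C}$ put $U^\nu(z)=\int\log\frac{1}{|z-w|}\,d\nu(w)$ and $I(\nu)=\int U^\nu\,d\nu$. For $K\subset\mathbb{C}$ compact and non-polar, $\nu_K^\infty$ is the equilibrium measure of $K$, the unique Borel probability measure on $K$ minimizing $I$. The Green's function of $K$ with pole at $\infty$ is $g_K(z,\infty):=I(\nu_K^\infty)-U^{\nu_K^\infty}(z)$ for $z\in\mathbb{C}$. For $K$ a non-polar compact subset of $\mathbb{C}\setminus\{0\}$, let $1/K=\{1/z:z\in K\}$. The Green's function with pole at $0$ is $g_K(z,0):=g_{1/K}(1/z,\infty)$, with $g_K(\infty,0):=g_{1/K}(0,\infty)$. The harmonic measure $\nu_K^0$ of $K$ with respect to $0$ is the push-forward of $\nu_{1/K}^\infty$ under $z\mapsto 1/z$. Capacity with respect to $0$ and $\infty$. For a real symmetric $2\times 2$ matrix $\Gamma=(\gamma_{ij})$ with non-negative off-diagonal entries, its value is $$\mathrm{val}(\Gamma):=\max_{s_1,s_2\ge 0,\ s_1+s_2=1}\ \min\{\gamma_{11}s_1+\gamma_{12}s_2,\ \gamma_{21}s_1+\gamma_{22}s_2\}.$$ For a non-polar compact $K\subset\mathbb{C}\setminus\{0\}$ let $$\Gamma(K)=\begin{bmatrix}\lim_{z\to0}[g_K(z,0)+\log|z|] & g_K(0,\infty)\\ g_K(\infty,0)&\lim_{z\to\infty}[g_K(z,\infty)-\log|z|]\end{bmatrix},$$ $\gamma_{0,\infty}(K):=\mathrm{val}(\Gamma(K))$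 and $\mathrm{cap}_{0,\infty}(K):=e^{-\gamma_{0,\infty}(K)}$. (The condition $\mathrm{cap}_{0,\infty}(K)=1$ is understood to include that $K$ is non-polar.) Height. For $p(z)=a_dz^d+\dots+a_0$ of degree $d\geq 1$ with $a_0a_d\ne0$, $$\mathrm{h}_K(p):=\frac1d\Big(\log|a_0a_d|+\sum_{p(x)=0}[g_K(x,0)+g_K(x,\infty)]\Big).$$ *)

(* Defs.v *)
From HB Require Import structures.
From mathcomp Require Import all_boot all_order all_algebra.
From mathcomp Require Import all_classical all_reals all_analysis.
From mathcomp Require Import complex.

Set Implicit Arguments.
Unset Strict Implicit.
Unset Printing Implicit Defensive.

Import Order.TTheory GRing.Theory Num.Theory numFieldNormedType.Exports.

Local Open Scope classical_set_scope.
Local Open Scope ring_scope.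

(* The complex plane is R[i], with the topology of its norm and the Borel
   sigma-algebra. The norm `|z| on R[i] takes values in R[i]; [modulus z] is
   the same quantity as an element of R. *)
HB.instance Definition _ (R : realType) := NormedModule.copy R[i] R[i]^o.

HB.instance Definition _ (R : realType) :=
  Measurable.copy R[i] (g_sigma_algebraType (@open R[i])).

Notation modulus := Normc.normc.

Section complex_plane.
Context (R : realType).

Lemma open_measurableC (U : set R[i]) : open U -> measurable U.
Proof. by move=> oU; exact: sub_sigma_algebra. Qed.

Lemma measurable_invC : measurable_fun [set: R[i]] (@GRing.inv R[i]).
Proof.
apply: (@measurability _ _ R[i] R[i] _ _ (@open R[i])) => //.
move=> _ [B oB <-]; rewrite setTI.
have closed0 : closed [set (0 : R[i])].
  apply: accessible_closed_set1; apply: hausdorff_accessible.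
  exact: norm_hausdorff.
have mset1 : measurable [set (0 : R[i])].
  rewrite -[X in measurable X]setCK; apply: measurableC.
  by apply: open_measurableC; exact: closed_openC.
have oB' : open (GRing.inv @^-1` B `\ (0 : R[i])).
  rewrite openE => x /= [Bx /eqP x0]; apply: filterI.
    exact: (inv_continuous x0 (open_nbhs_nbhs (conj oB Bx))).
  apply: open_nbhs_nbhs; split; last exact/eqP.
  exact: closed_openC.
have [B0|B0] := pselect (B 0).
  rewrite [X in measurable X](_ : _ = (GRing.inv @^-1` B `\ (0 : R[i])) `|` [set 0]).
    by apply: measurableU => //; exact: open_measurableC.
  apply/seteqP; split=> x /=; last by case=> [[]//|->]; rewrite invr0.
  by move=> Bx; have [->|/eqP x0] := eqVneq x 0; [right|left].
rewrite [X in measurable X](_ : _ = GRing.inv @^-1` B `\ (0 : R[i])).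
  exact: open_measurableC.
apply/seteqP; split=> x /=; last by case.
by move=> Bx; split=> // x0; apply: B0; rewrite -invr0 -x0.
Qed.

HB.instance Definition _ :=
  isMeasurableFun.Build _ _ R[i] R[i] (@GRing.inv R[i]) measurable_invC.

(* Neighbourhoods of the point at infinity. *)
Definition cinfty : set_system R[i] :=
  [set A | exists M : R, forall z, M < modulus z -> A z].

Lemma cinfty_proper : ProperFilter cinfty.
Proof.
apply: Build_ProperFilter_ex.
  move=> A [M AM]; exists (Num.max 0 (M + 1))%:C%C; apply: AM.
  by rewrite /= expr0n/= addr0 sqrtr_sqr ger0_norm ?le_max ?lexx// lt_max
     ltrDl ltr01 orbT.
split.
- by exists 0.
- move=> A B [M AM] [N BN]; exists (Num.max M N) => z.
  by rewrite gt_max => /andP[/AM ? /BN].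
- by move=> A B AB [M AM]; exists M => z /AM /AB.
Qed.

End complex_plane.

#[global] Existing Instance cinfty_proper.

Section potential_theory.
Context (R : realType).
Implicit Types (nu : probability R[i] R) (K : set R[i]) (z w : R[i]).

(* lne 0 = -oo, so that log (1 / |z - w|) = +oo when z = w. *)
Definition potential nu z : \bar R :=
  (\int[nu]_w - lne (modulus (z - w))%:E)%E.

Definition energy nu : \bar R := (\int[nu]_z potential nu z)%E.

Definition nonpolar K :=
  exists nu : probability R[i] R, nu K = 1%E /\ (energy nu < +oo)%E.

(* The library's [get] picks an element of the given set: for K compact and
   non-polar that set is a singleton. *)
Definition equilibrium_measure K : probability R[i] R :=
  get [set nu : probability R[i] R | nu K = 1%E /\
    forall mu : probability R[i] R, mu K = 1%E -> (energy nu <= energy mu)%E].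

Definition recip K : set R[i] := [set z^-1 | z in K].

(* For K compact and non-polar the difference below is finite everywhere, as
   -oo < U <= I < +oo for the equilibrium measure (Frostman), so that [fine]
   loses nothing. *)
Definition green_infty K z : R :=
  fine (energy (equilibrium_measure K) - potential (equilibrium_measure K) z)%E.

(* Only meaningful for z != 0. *)
Definition green_zero K z : R := green_infty (recip K) z^-1.

Definition green_zero_at_infty K : R := green_infty (recip K) 0.

Definition harmonic_zero K : probability R[i] R :=
  distribution (equilibrium_measure (recip K)) (@GRing.inv R[i]).

Definition robin_zero K : R :=
  lim ((green_zero K z + ln (modulus z)) @[z --> (0 : R[i])^']).

Definition robin_infty K : R :=
  lim ((green_infty K z - ln (modulus z)) @[z --> @cinfty R]).

(* The supremum is a maximum, by compactness. *)
Definition game_value (G : 'M[R]_2) : R :=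
  sup [set v | exists s1 s2 : R, [/\ 0 <= s1, 0 <= s2, s1 + s2 = 1 &
    v = Num.min (G 0 0 * s1 + G 0 1 * s2) (G 1 0 * s1 + G 1 1 * s2)]].

Definition green_matrix K : 'M[R]_2 :=
  \matrix_(i, j)
    if i == 0 then if j == 0 then robin_zero K else green_infty K 0
    else if j == 0 then green_zero_at_infty K else robin_infty K.

Definition cap_zero_infty K : R := expR (- game_value (green_matrix K)).

Definition polyC_of (p : {poly int}) : {poly R[i]} := map_poly intr p.

(* The complex zeros of p <> 0, listed with multiplicity. *)
Definition zeros (p : {poly int}) : seq R[i] :=
  sval (closed_field_poly_normal (polyC_of p)).

Definition degree (p : {poly int}) : nat := (size p).-1.

Definition height K (p : {poly int}) : R :=
  (degree p)%:R^-1 * (ln (`|p`_0 * lead_coef p|%:~R) +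
    \sum_(x <- zeros p) (green_zero K x + green_infty K x)).

Definition simple_zeros (p : {poly int}) :=
  forall x : R[i], root (polyC_of p) x -> mup x (polyC_of p) = 1%N.

Definition zeros_measure (p : {poly int}) : {measure set R[i] -> \bar R} :=
  mscale ((degree p)%:R^-1)%:nng
    (msum (fun k => \d_((zeros p)`_k)) (size (zeros p))).

Definition mixed_measure (s1 s2 : {nonneg R}) K :
    {measure set R[i] -> \bar R} :=
  measure_add (mscale s1 (harmonic_zero K))
              (mscale s2 (equilibrium_measure K)).

End potential_theory.

(* Main.v *)
(* Expanding [- ln |z - w|], corrected by the height on the sphere, as a power series in
   the Gram kernel [chord z w] makes energies sums of squares of moments. Since the
   discriminant is a nonzero integer and all terms of the height are nonnegative, every
   weak limit [mu] of the zero counting measures lives on an annulus, has nonpositive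
   logarithmic energy, satisfies [int ln |z| dmu = 0] and annihilates both Green
   functions of [K]; so its mutual energies with the two harmonic measures are the same as
   for a measure on [K]. The two equations for [s1] and [s2] then force the energy of
   [mu - s1 nu0 - s2 nuinf] to be nonpositive, so that all moments of this signed measure
   vanish, and moments determine a measure. Ultrafilter limits of the averages, realized
   as measures by a Riesz representation, replace the extraction of subsequences. *)

(* The logarithmic kernel is neither bounded nor of one sign, so its energies do not pass to weak
   limits. Adding [logh z + logh w] makes it nonnegative, and cutting its series after [M] terms
   makes it bounded and continuous: an energy is bounded for each fixed [M] first, and [M] grows
   afterwards. The cut also tames the diagonal, which then contributes a constant divided by the
   degree. The price is the terms [ell], which cancel in the end because the signed measure has
   total mass zero. Weak limits test continuous functions only, while a Green function may be
   discontinuous on [K]. The mutual energy of [mu] with an equilibrium measure is therefore computed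
   from two sides. From above, its potential is bounded everywhere: first on a compact set of full
   measure, then on the plane by the maximum principle. From below, the first variation of the
   energy at the minimizer is applied to [mu] restricted to [K]. That [mu] has finite energy is what
   makes it an admissible direction, and this takes the place of a lower bound off a polar set. *)
Require Import Defs.
From HB Require Import structures.
From mathcomp Require Import all_boot all_order all_algebra.
From mathcomp Require Import all_classical all_reals all_analysis.
From mathcomp Require Import measurable_realfun complex ring lra.
Import Order.TTheory GRing.Theory Num.Theory numFieldNormedType.Exports.
Local Open Scope classical_set_scope.
Local Open Scope ring_scope.

Set Implicit Arguments.
Unset Strict Implicit.
Unset Printing Implicit Defensive.

(** * The complex plane *)

Section complex_topology.
Context (R : realType).
Local Notation Re := (@complex.Re R).
Local Notation Im := (@complex.Im R).
Implicit Types (z w : R[i]) (K : set R[i]).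

Lemma modulus_norm z : `|z| = (modulus z)%:C%C.
Proof. by []. Qed.

Lemma modulus_ge0 z : 0 <= modulus z.
Proof. by case: z => a b; exact: sqrtr_ge0. Qed.

Lemma modulusB z w : modulus (z - w) = modulus (w - z).
Proof. by rewrite -normcN opprB. Qed.

Lemma modulus_gt0 z : (0 < modulus z) = (z != 0).
Proof.
rewrite lt_neqAle modulus_ge0 andbT eq_sym; congr (~~ _).
by apply/eqP/eqP => [/Normc.eq0_normc//|->]; rewrite Normc.normc0.
Qed.

Lemma modulusX z n : modulus (z ^+ n) = modulus z ^+ n.
Proof. by elim: n => [|n ih]; rewrite ?expr0 ?Normc.normc1// !exprS Normc.normcM ih. Qed.

Lemma modulus_triangle z w u : modulus (z - w) <= modulus (z - u) + modulus (u - w).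
Proof. by rewrite (_ : z - w = (z - u) + (u - w)) ?le_normcD//; ring. Qed.

Lemma ler_modulusB z w : modulus z - modulus w <= modulus (z - w).
Proof. by rewrite lerBlDr -{1}(subrK w z) le_normcD. Qed.

Lemma modulus_lip z w : `|modulus z - modulus w| <= modulus (z - w).
Proof.
by rewrite ler_norml ler_modulusB andbT lerNl opprB modulusB ler_modulusB.
Qed.

Lemma Re_le_modulus z : `|Re z| <= modulus z.
Proof.
by case: z => a b /=; rewrite -sqrtr_sqr ler_wsqrtr// lerDl sqr_ge0.
Qed.

Lemma Im_le_modulus z : `|Im z| <= modulus z.
Proof.
by case: z => a b /=; rewrite -sqrtr_sqr ler_wsqrtr// lerDr sqr_ge0.
Qed.

Lemma modulus_le_ReIm z : modulus z <= `|Re z| + `|Im z|.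
Proof.
case: z => a b /=; rewrite -[leRHS]ger0_norm ?addr_ge0// -sqrtr_sqr.
rewrite ler_wsqrtr// -(real_normK (num_real a)) -(real_normK (num_real b)) sqrrD.
by rewrite lerD2r lerDl mulrn_wge0// mulr_ge0.
Qed.

(** Balls of [R[i]] have radii in [R[i]], where [0 < e] means that [e] is real and positive. Passing
    to real radii once here lets all later topology be written with [modulus]. *)
Lemma nbhs_modulusP z (P : set R[i]) :
  nbhs z P <-> exists2 e : R, 0 < e & forall w, modulus (z - w) < e -> P w.
Proof.
split.
  move=> /nbhs_ballP[[a b]]; rewrite /= ltcE /= => /andP[/eqP -> a0] zP.
  exists a => // w zw; apply: zP.
  by rewrite -ball_normE /ball_/= modulus_norm ltcE /= eqxx.
move=> [e e0 zP]; apply/nbhs_ballP; exists e%:C%C => /=.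
  by rewrite ltcE /= eqxx.
move=> w; rewrite -ball_normE /ball_/= modulus_norm ltcE /= eqxx /=.
exact: zP.
Qed.

Lemma open_modulusP K : open K <->
  forall z, K z -> exists2 e : R, 0 < e & forall w, modulus (z - w) < e -> K w.
Proof.
rewrite openE; split=> KK z /KK; first by move/nbhs_modulusP.
by move=> H; apply/nbhs_modulusP.
Qed.

Lemma continuous_modulusP (f : R[i] -> R) : continuous f <->
  forall z (e : R), 0 < e -> exists2 d : R, 0 < d &
    forall w, modulus (z - w) < d -> `|f z - f w| < e.
Proof.
split=> cf z.
  by move=> e e0; have /cvgrPdist_lt/(_ _ e0)/nbhs_modulusP := cf z.
by apply/(@cvgrPdist_lt _ _ _ (nbhs z)) => e e0; apply/nbhs_modulusP; exact: cf.
Qed.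

Lemma within_continuous_modulusP K (f : R[i] -> R) :
  {within K, continuous f} <->
  forall z (e : R), K z -> 0 < e -> exists2 d : R, 0 < d &
    forall w, K w -> modulus (z - w) < d -> `|f z - f w| < e.
Proof.
rewrite continuous_subspace_in; split=> cf z.
  move=> e Kz e0; have /cvgrPdist_lt/(_ _ e0) := cf z (mem_set Kz).
  rewrite /prop_near1 /= /nbhs/= -nbhs_subspace_in// /within/=.
  by move=> /nbhs_modulusP[d d0 dP]; exists d => // w Kw zw; exact: dP.
rewrite inE => Kz; apply/cvgrPdist_lt => e e0; have [d d0 dP] := cf z e Kz e0.
rewrite /prop_near1 /= /nbhs/= -nbhs_subspace_in// /within/=; apply/nbhs_modulusP; exists d => //.
by move=> w zw Kw; exact: dP.
Qed.

Lemma lipschitz_continuous (f : R[i] -> R) (k : R) :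
  (forall z w, `|f z - f w| <= k * modulus (z - w)) -> continuous f.
Proof.
move=> fk; apply/continuous_modulusP => z e e0.
have k1 : 0 < `|k| + 1 by rewrite ltr_wpDl.
exists (e / (`|k| + 1)); first by rewrite divr_gt0.
move=> w; rewrite ltr_pdivlMr// => zw; apply: le_lt_trans zw.
apply: le_trans (fk z w) _; rewrite mulrC ler_wpM2l ?modulus_ge0//.
by rewrite (le_trans (ler_norm _))// lerDl.
Qed.

Lemma continuous_modulus : continuous (fun z => modulus z).
Proof.
by apply: (@lipschitz_continuous _ 1) => z w; rewrite mul1r modulus_lip.
Qed.

Lemma continuous_Re : continuous (fun z => Re z).
Proof.
apply: (@lipschitz_continuous _ 1) => z w.
by rewrite mul1r; have := Re_le_modulus (z - w); case: z w => [a b] [c d].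
Qed.

Lemma continuous_Im : continuous (fun z => Im z).
Proof.
apply: (@lipschitz_continuous _ 1) => z w.
by rewrite mul1r; have := Im_le_modulus (z - w); case: z w => [a b] [c d].
Qed.

Lemma continuous_measurableC (f : R[i] -> R) :
  continuous f -> measurable_fun [set: R[i]] f.
Proof.
move=> cf; apply: (measurability _ (measurable_realfun.RGenOInfty.measurableE R)).
move=> _ [_ [a ->] <-]; rewrite setTI; apply: open_measurableC.
by move/continuousP : cf; apply; exact: interval_open.
Qed.

Lemma closed_measurableC K : closed K -> measurable K.
Proof.
move=> cK; rewrite -[K]setCK; apply: measurableC; apply: open_measurableC.
exact: closed_openC.
Qed.

Lemma compact_closedC K : compact K -> closed K.
Proof. by apply: compact_closed; exact: norm_hausdorff. Qed.

Lemma compact_measurableC K : compact K -> measurable K.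
Proof. by move=> /compact_closedC/closed_measurableC. Qed.

Lemma compact_modulus_le K : compact K ->
  exists2 M : R, 0 < M & forall z, K z -> modulus z <= M.
Proof.
move=> cK; have [K0|K0] := pselect (K !=set0); last first.
  by exists 1 => // z Kz; exfalso; apply: K0; exists z.
have [c _ cP] := compact_EVT_max K0 cK
  (continuous_subspaceT (continuous_modulus)).
exists (modulus c + 1); first by rewrite ltr_wpDl ?modulus_ge0.
by move=> z Kz; rewrite ler_wpDr// cP// inE.
Qed.

(** Heine-Borel, imported from a closed square of real pairs through the map sending [(a, b)] to
    [a + ib], whose image contains [K]. *)
Lemma bounded_closed_compactC K (M : R) :
  closed K -> (forall z, K z -> modulus z <= M) -> compact K.
Proof.
move=> cK KM; pose h (p : R * R) : R[i] := Complex p.1 p.2.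
pose Q := h @` (`[- M, M]%classic `*` `[- M, M]%classic).
apply: (@subclosed_compact _ K Q) => //.
  apply: continuous_compact; last first.
    by apply: compact_setX; exact: segment_compact.
  apply: continuous_subspaceT => -[a b]; apply/(@cvgrPdist_lt _ _ _ (nbhs (a, b))).
  case=> e e'; rewrite ltcE/= => /andP[/eqP -> e0].
  apply/(@nbhs_ballP _ (R * R)%type); exists (e / 2); first by rewrite /= divr_gt0.
  move=> [c d] [/= ac bd]; rewrite modulus_norm ltcE/= eqxx/=.
  have := modulus_le_ReIm (h (a, b) - h (c, d)) => /le_lt_trans; apply => /=.
  by rewrite [ltRHS]splitr ltrD.
move=> z Kz; exists (Re z, Im z); last by rewrite /h/=; case: (z).
have := KM _ Kz => zM.
split; rewrite /= in_itv /= -ler_norml (le_trans _ zM)//.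
  exact: Re_le_modulus.
exact: Im_le_modulus.
Qed.

Lemma closed_le_fun (f g : R[i] -> R) :
  continuous f -> continuous g -> closed [set z | f z <= g z].
Proof.
move=> cf cg; rewrite (_ : mkset _ = (fun z => g z - f z) @^-1` [set x | 0 <= x]).
  apply: closed_comp; last exact: closed_ge.
  by move=> z _; apply: (@cvgB _ _ _ (nbhs z)); [exact: cg|exact: cf].
by apply/seteqP; split=> z /=; rewrite subr_ge0.
Qed.

Lemma compact_nearest K z : compact K -> K !=set0 ->
  exists2 w, K w & forall w', K w' -> modulus (z - w) <= modulus (z - w').
Proof.
move=> cK K0.
have cf : continuous (fun w => modulus (z - w)).
  apply: (@lipschitz_continuous _ 1) => u v.
  rewrite mul1r (le_trans (modulus_lip _ _))// modulusB.
  by rewrite (_ : z - v - (z - u) = u - v)//; ring.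
have [c cK' cP] := compact_EVT_min K0 cK (continuous_subspaceT cf).
exists c; first by rewrite inE in cK'.
by move=> w Kw; apply: cP; rewrite inE.
Qed.

Lemma compact_net K (e : R) : compact K -> 0 < e ->
  exists s : seq R[i], forall z, K z -> exists2 c, c \in s & modulus (c - z) < e.
Proof.
move=> cK e0; pose B c := [set z : R[i] | modulus (c - z) < e].
have : cover_compact K by rewrite -compact_cover.
move=> /(_ _ setT B)[|z Kz|D _ KD].
- move=> c _; apply/open_modulusP => z /= cz.
  exists (e - modulus (c - z)); first by rewrite subr_gt0.
  move=> w; rewrite ltrBrDl; apply: le_lt_trans; exact: modulus_triangle.
- by exists z => //; rewrite /B /= subrr Normc.normc0.
- by exists (finmap.enum_fset D) => z /KD[c cD cz]; exists c.
Qed.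

Lemma seq_pos_lower_bound (T : eqType) (g : T -> R) (s : seq T) :
  (forall c, c \in s -> 0 < g c) ->
  exists2 d : R, 0 < d & forall c, c \in s -> d <= g c.
Proof.
elim: s => [|c s ih] H; first by exists 1.
have [d d0 dP] := ih (fun c' Hc' => H c' (mem_behead (s := c :: s) Hc')).
exists (Num.min d (g c)); first by rewrite lt_min d0 H// mem_head.
move=> c'; rewrite inE => /orP[/eqP ->|/dP H']; first by rewrite ge_min lexx orbT.
by rewrite ge_min H'.
Qed.

(** Continuity is required within [K] only, since the Riesz theorem is applied to functions such as
    [logh z * \1_K z] that jump at the boundary. *)
Lemma compact_uniform K (f : R[i] -> R) (e : R) : compact K ->
  {within K, continuous f} -> 0 < e ->
  exists2 d : R, 0 < d & forall z w, K z -> K w -> modulus (z - w) < d ->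
    `|f z - f w| < e.
Proof.
move=> cK /within_continuous_modulusP cf e0.
have e2 : 0 < e / 2 by rewrite divr_gt0.
have cf' z : exists d : R, K z -> 0 < d /\
    forall w, K w -> modulus (z - w) < d -> `|f z - f w| < e / 2.
  have [Kz|nKz] := pselect (K z); last by exists 0.
  by have [d d0 dP] := cf z _ Kz e2; exists d.
have [del delP] := choice cf'.
pose B c := [set z : R[i] | modulus (c - z) < del c / 2].
have : cover_compact K by rewrite -compact_cover.
move=> /(_ _ K B)[|z Kz|D DK KD].
- move=> c _; apply/open_modulusP => z /= cz.
  exists (del c / 2 - modulus (c - z)); first by rewrite subr_gt0.
  move=> w; rewrite ltrBrDl; apply: le_lt_trans; exact: modulus_triangle.
- by exists z => //; rewrite /B /= subrr Normc.normc0 divr_gt0//; have [] := delP z Kz.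
have [d d0 dP] : exists2 d : R, 0 < d & forall c, c \in finmap.enum_fset D -> d <= del c / 2.
  have : forall c, c \in finmap.enum_fset D -> 0 < del c / 2.
    move=> c cD; have [dc _] := delP c (set_mem (DK c cD)).
    by rewrite divr_gt0.
  exact: seq_pos_lower_bound.
exists d => // z w Kz Kw zw; have [c cD cz] := KD z Kz.
have Kc : K c by exact: set_mem (DK c cD).
have [dc cP] := delP c Kc.
rewrite (splitr e) (_ : f z - f w = (f z - f c) + (f c - f w)); last by ring.
apply: le_lt_trans (ler_normD _ _) _; apply: ltrD.
  by rewrite distrC cP// (lt_le_trans cz)// ler_pdivrMr//; lra.
rewrite cP//; apply: le_lt_trans (modulus_triangle _ _ z) _.
by rewrite (splitr (del c)) ltrD// (lt_le_trans zw)// dP.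
Qed.

End complex_topology.

(** * Bounded measurable functions and positive functionals *)

Definition bmeas d (T : measurableType d) (R : realType) (f : T -> R) : Prop :=
  measurable_fun [set: T] f /\ exists M : R, forall z, `|f z| <= M.

Section bounded_measurable.
Context d (T : measurableType d) (R : realType).
Implicit Types (f g : T -> R).

Lemma bmeas_cst (c : R) : bmeas (fun _ : T => c).
Proof. by split=> //; exists `|c|. Qed.

Lemma bmeasD f g : bmeas f -> bmeas g -> bmeas (fun z => f z + g z).
Proof.
move=> [mf [M fM]] [mg [N gN]]; split; first exact: measurable_funD.
by exists (M + N) => z; apply: le_trans (ler_normD _ _) _; exact: lerD.
Qed.

Lemma bmeasM f g : bmeas f -> bmeas g -> bmeas (fun z => f z * g z).
Proof.
move=> [mf [M fM]] [mg [N gN]]; split; first exact: measurable_funM.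
by exists (M * N) => z; rewrite normrM; exact: ler_pM.
Qed.

Lemma bmeasZ (c : R) f : bmeas f -> bmeas (fun z => c * f z).
Proof. by apply: bmeasM; exact: bmeas_cst. Qed.

Lemma bmeasN f : bmeas f -> bmeas (fun z => - f z).
Proof.
move=> /(bmeasZ (-1)); rewrite (_ : (fun z => -1 * f z) = (fun z => - f z))//.
by apply/funext => z; rewrite mulN1r.
Qed.

Lemma bmeasB f g : bmeas f -> bmeas g -> bmeas (fun z => f z - g z).
Proof. by move=> ? /bmeasN; exact: bmeasD. Qed.

Lemma bmeas_sum (I : Type) (s : seq I) (F : I -> T -> R) :
  (forall i, bmeas (F i)) -> bmeas (fun z => \sum_(i <- s) F i z).
Proof.
move=> H; elim: s => [|i s ih].
  by under eq_fun do rewrite big_nil; exact: bmeas_cst.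
by under eq_fun do rewrite big_cons; exact: bmeasD.
Qed.

Lemma bmeas_prod (I : Type) (s : seq I) (F : I -> T -> R) :
  (forall i, bmeas (F i)) -> bmeas (fun z => \prod_(i <- s) F i z).
Proof.
move=> H; elim: s => [|i s ih].
  by under eq_fun do rewrite big_nil; exact: bmeas_cst.
by under eq_fun do rewrite big_cons; exact: bmeasM.
Qed.

Lemma bmeas_indic (A : set T) : measurable A -> bmeas (\1_A : T -> R).
Proof.
move=> mA; split; first exact: measurable_indic.
by exists 1 => z; rewrite indicE; case: (_ \in _); rewrite ?normr1 ?normr0.
Qed.

Variable P : probability T R.

Lemma bmeas_integrable (D : set T) f : measurable D -> bmeas f ->
  P.-integrable D (EFin \o f).
Proof.
move=> mD [mf [M fM]]; apply: measurable_bounded_integrable => //.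
- by rewrite (le_lt_trans (probability_le1 P mD))// ltry.
- exact: measurable_funTS.
- exists M; split; first exact: num_real.
  by move=> x Mx y _ /=; rewrite (le_trans (fM y))// ltW.
Qed.

Lemma bmeas_int_fin f : bmeas f ->
  (\int[P]_z (f z)%:E)%E = (\int[P]_z f z)%:E.
Proof.
by move=> bf; rewrite fineK//; apply: integrable_fin_num => //; exact: bmeas_integrable.
Qed.

Lemma bmeas_intD f g : bmeas f -> bmeas g ->
  \int[P]_z (f z + g z) = \int[P]_z f z + \int[P]_z g z.
Proof. by move=> bf bg; apply: RintegralD => //; exact: bmeas_integrable. Qed.

Lemma bmeas_intB f g : bmeas f -> bmeas g ->
  \int[P]_z (f z - g z) = \int[P]_z f z - \int[P]_z g z.
Proof. by move=> bf bg; apply: RintegralB => //; exact: bmeas_integrable. Qed.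

Lemma bmeas_intZ (c : R) f : bmeas f ->
  \int[P]_z (c * f z) = c * \int[P]_z f z.
Proof. by move=> bf; apply: RintegralZl => //; exact: bmeas_integrable. Qed.

Lemma bmeas_int_cst (c : R) : \int[P]_z c = c.
Proof. by rewrite Rintegral_cst// [X in fine X]probability_setT mulr1. Qed.

Lemma bmeas_int_ge0 f : (forall z, 0 <= f z) -> 0 <= \int[P]_z f z.
Proof. by move=> f0; exact: Rintegral_ge0. Qed.

Lemma bmeas_int_le f g : bmeas f -> bmeas g -> (forall z, f z <= g z) ->
  \int[P]_z f z <= \int[P]_z g z.
Proof. by move=> bf bg fg; apply: le_Rintegral => //; exact: bmeas_integrable. Qed.

Lemma bmeas_int_sum (I : Type) (s : seq I) (F : I -> T -> R) :
  (forall i, bmeas (F i)) ->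
  \int[P]_z (\sum_(i <- s) F i z) = \sum_(i <- s) \int[P]_z F i z.
Proof.
move=> bF; elim: s => [|i s ih].
  by under eq_Rintegral do rewrite big_nil; rewrite bmeas_int_cst big_nil.
under eq_Rintegral do rewrite big_cons.
by rewrite bmeas_intD ?ih ?big_cons//; exact: bmeas_sum.
Qed.

Lemma bmeas_int_indic (A : set T) : measurable A ->
  \int[P]_z (\1_A z : R) = fine (P A).
Proof. by move=> mA; rewrite /Rintegral integral_indic// setIT. Qed.

Lemma prob_fineK (A : set T) : measurable A -> (fine (P A))%:E = P A.
Proof. by move=> mA; rewrite fineK// fin_num_measure. Qed.

Lemma bmeas_int_cvg (F : nat -> T -> R) f (M : R) :
  (forall n, measurable_fun [set: T] (F n)) -> (forall n z, `|F n z| <= M) ->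
  (forall z, F n z @[n --> \oo] --> f z) ->
  bmeas f /\ \int[P]_z F n z @[n --> \oo] --> \int[P]_z f z.
Proof.
move=> mF FM Ff.
have mf : measurable_fun [set: T] f.
  exact: (measurable_fun_cvg (h := F)).
have fM z : `|f z| <= M.
  apply: (cvgr_to_le (cvg_norm (Ff z))); exact: nearW.
have bf : bmeas f by split=> //; exists M.
have bF n : bmeas (F n) by split=> //; exists M.
split=> //.
have : (\int[P]_z (F n z)%:E @[n --> \oo] --> \int[P]_z (f z)%:E)%E.
  apply: (@dominated_cvg _ _ _ P setT measurableT _ _ (fun=> M%:E)).
  - by move=> n; apply/measurable_EFinP.
  - by move=> z _; apply: cvg_EFin; [exact: nearW|exact: Ff].
  - by [].
  - exact: bmeas_integrable (bmeas_cst M).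
  - by move=> n z _ /=; rewrite lee_fin.
rewrite bmeas_int_fin//; under eq_fun do rewrite bmeas_int_fin//.
by move=> /fine_cvgP[].
Qed.

End bounded_measurable.

(** Only finite additivity is asked, which survives limits along ultrafilters. The axioms cover all
    bounded measurable functions rather than the continuous ones, so that [Lam] can be evaluated on
    indicators of cells in the Riesz construction. *)
Record positive_functional (R : realType) (Lam : (R[i] -> R) -> R) : Prop := {
  functionalD : forall f g, bmeas f -> bmeas g ->
    Lam (fun z => f z + g z) = Lam f + Lam g;
  functionalZ : forall (c : R) f, bmeas f -> Lam (fun z => c * f z) = c * Lam f;
  functional_ge0 : forall f, bmeas f -> (forall z, 0 <= f z) -> 0 <= Lam f;
  functional1 : Lam (fun=> 1) = 1 }.

Section functional_theory.
Context (R : realType) (Lam : (R[i] -> R) -> R).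
Hypothesis pLam : positive_functional Lam.
Implicit Types f g : R[i] -> R.

Lemma functionalB f g : bmeas f -> bmeas g ->
  Lam (fun z => f z - g z) = Lam f - Lam g.
Proof.
move=> bf bg; rewrite (_ : (fun z => _) = (fun z => f z + (-1) * g z)).
  by rewrite functionalD ?functionalZ ?mulN1r//; exact: bmeasZ.
by apply/funext => z; rewrite mulN1r.
Qed.

Lemma functional_le f g : bmeas f -> bmeas g -> (forall z, f z <= g z) ->
  Lam f <= Lam g.
Proof.
move=> bf bg fg; rewrite -subr_ge0 -functionalB//.
by apply: functional_ge0 => //; [exact: bmeasB|move=> z; rewrite subr_ge0].
Qed.

Lemma functional_cst (c : R) : Lam (fun=> c) = c.
Proof.
rewrite (_ : (fun=> c) = (fun z => c * (fun=> 1) z)).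
  by rewrite functionalZ ?functional1 ?mulr1//; exact: bmeas_cst.
by apply/funext => z; rewrite mulr1.
Qed.

Lemma functional_sum (I : Type) (s : seq I) (F : I -> R[i] -> R) :
  (forall i, bmeas (F i)) ->
  Lam (fun z => \sum_(i <- s) F i z) = \sum_(i <- s) Lam (F i).
Proof.
move=> bF; elim: s => [|i s ih].
  by under eq_fun do rewrite big_nil; rewrite functional_cst big_nil.
under eq_fun do rewrite big_cons.
by rewrite functionalD ?ih ?big_cons//; exact: bmeas_sum.
Qed.

Lemma functional_norm_le f g (e : R) : bmeas f -> bmeas g ->
  (forall z, `|f z| <= e + g z) -> `|Lam f| <= e + Lam g.
Proof.
move=> bf bg H; have be := bmeasD (bmeas_cst _ e) bg.
rewrite -[X in X + Lam g](functional_cst e) -functionalD//; last exact: bmeas_cst.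
rewrite ler_norml; apply/andP; split.
  rewrite lerNl -mulN1r -functionalZ//; apply: functional_le => //.
    exact: bmeasZ.
  by move=> z; rewrite mulN1r (le_trans (ler_norm _))// normrN.
by apply: functional_le => // z; exact: le_trans (ler_norm _) (H z).
Qed.

End functional_theory.

(** * Riesz representation on a compact set *)

Definition unit_lebesgue (R : realType) : set (measurableTypeR R) -> \bar R :=
  mrestr lebesgue_measure (measurable_itv `[0%R, 1%R[).

Section unit_lebesgue.
Context (R : realType).
HB.instance Definition _ := Measure.on (@unit_lebesgue R).

Lemma unit_lebesgue_setT : @unit_lebesgue R setT = 1%E.
Proof.
rewrite /unit_lebesgue /mrestr setTI; apply: etrans (lebesgue_measure_itv _) _.
by rewrite /= lte_fin ltr01 oppr0 adde0.
Qed.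

HB.instance Definition _ := Measure_isProbability.Build _ _ _
  (@unit_lebesgue R) unit_lebesgue_setT.

Lemma unit_lebesgue_itv (a b : R) : 0 <= a -> a <= b -> b <= 1 ->
  @unit_lebesgue R `[a, b[%classic = (b - a)%:E.
Proof.
move=> a0 ab b1; rewrite /unit_lebesgue /mrestr.
rewrite (_ : _ `&` _ = `[a, b[%classic); last first.
  apply/seteqP; split=> x /=; rewrite !in_itv /=; first by case.
  move=> /andP[ax xb]; rewrite ax xb; split=> //.
  by rewrite (le_trans a0 ax) (lt_le_trans xb b1).
apply: etrans (lebesgue_measure_itv _) _; rewrite /= lte_fin.
by move: ab; rewrite le_eqVlt => /predU1P[->|->//]; rewrite ltxx subrr.
Qed.

End unit_lebesgue.

Section riesz.
Context (R : realType) (K : set R[i]) (Lam : (R[i] -> R) -> R).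
Hypothesis (cK : compact K) (pLam : positive_functional Lam).
Hypothesis LamK : Lam \1_(~` K) = 0.

Let e_ (j : nat) : R := (2 ^+ j)^-1.
Let e_gt0 j : 0 < e_ j. Proof. by rewrite invr_gt0 exprn_gt0. Qed.

Let net j : seq R[i] := sval (cid (compact_net cK (e_gt0 j))).
Let netP j z : K z -> exists2 c, c \in net j & modulus (c - z) < e_ j.
Proof. exact: (svalP (cid (compact_net cK (e_gt0 j)))). Qed.

Let near_net j (c z : R[i]) : bool := modulus (c - z) < e_ j.
Let digit j z : nat := find (near_net j ^~ z) (net j).
Let D j : nat := (size (net j)).+1.

(* [code j z] lists in mixed radix the cells of the first [j] nets containing [z]. *)
Fixpoint code_of j z : nat :=
  if j is k.+1 then (code_of k z * D k + digit k z)%N else 0%N.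
Let code := code_of.
Fixpoint codes_of j : nat := if j is k.+1 then (codes_of k * D k)%N else 1%N.
Let B := codes_of.

Let digit_lt j z : (digit j z < D j)%N.
Proof. by rewrite /digit/D ltnS find_size. Qed.

Let code_lt j z : (code j z < B j)%N.
Proof.
elim: j => //= j ih; rewrite (@leq_trans ((code j z).+1 * D j))//.
  by rewrite mulSn addnC ltn_add2r digit_lt.
by rewrite leq_mul2r ih orbT.
Qed.

Let code_div j z : (code j.+1 z %/ D j)%N = code j z.
Proof. by rewrite /= divnMDl// (divn_small (digit_lt _ _)) addn0. Qed.

Let code_mod j z : (code j.+1 z %% D j)%N = digit j z.
Proof. by rewrite /= modnMDl modn_small. Qed.

Let measurable_digit j i : measurable [set z | digit j z = i].
Proof.
rewrite /digit; elim: (net j) i => [|c s ih] i /=.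
  have [->|i0] := eqVneq i 0%N.
    by rewrite [X in measurable X](_ : _ = setT)//; apply/seteqP; split.
  rewrite [X in measurable X](_ : _ = set0)//; apply/seteqP; split=> //= z /esym.
  by move/eqP : i0.
have mc : measurable [set z | near_net j c z].
  apply: open_measurableC; apply/open_modulusP => z /= cz.
  exists (e_ j - modulus (c - z)); first by rewrite subr_gt0.
  move=> w; rewrite /near_net ltrBrDl; apply: le_lt_trans.
  exact: modulus_triangle.
case: i => [|i].
  rewrite [X in measurable X](_ : _ = [set z | near_net j c z])//.
  by apply/seteqP; split=> z /=; case: near_net.
rewrite [X in measurable X](_ : _ = ~` [set z | near_net j c z] `&`
    [set z | find (near_net j ^~ z) s = i]).
  by apply: measurableI => //; exact: measurableC.
apply/seteqP; split=> z /=; case: near_net => //.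
- by move=> [].
- by case.
- by move=> [_ ->].
Qed.

Let cell j m : set R[i] := [set z | code j z = m].

Let measurable_cell j m : measurable (cell j m).
Proof.
elim: j m => [|j ih] m.
  rewrite /cell/=; have [->|m0] := eqVneq m 0%N.
    by rewrite [X in measurable X](_ : _ = setT)//; apply/seteqP; split.
  rewrite [X in measurable X](_ : _ = set0)//; apply/seteqP; split=> //= z /esym.
  by move/eqP : m0.
rewrite [X in measurable X](_ : _ = cell j (m %/ D j)%N `&`
    [set z | digit j z = (m %% D j)%N]).
  by apply: measurableI; [exact: ih|exact: measurable_digit].
apply/seteqP; split=> z.
  move=> zm; have {}zm : code j.+1 z = m by [].
  by split; [apply: etrans (esym (code_div j z)) _|apply: etrans (esym (code_mod j z)) _];
    rewrite zm.
by move=> [zm dm]; have {}zm : code j z = (m %/ D j)%N by []; rewrite /cell/= -/(code j z) zm dm -divn_eq.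
Qed.

Let bcell j m : bmeas (\1_(cell j m) : R[i] -> R).
Proof. exact: bmeas_indic. Qed.

Let p j m : R := Lam \1_(cell j m).

Let p_ge0 j m : 0 <= p j m.
Proof. by apply: (functional_ge0 pLam) => // z; rewrite indicE. Qed.

Let F j m : R := \sum_(0 <= i < m) p j i.

Let F_le j m n : (m <= n)%N -> F j m <= F j n.
Proof.
move=> mn; rewrite /F (@big_cat_nat _ _ _ m 0 n)//= lerDl.
by apply: sumr_ge0 => i _.
Qed.

Let F0 j : F j 0 = 0. Proof. by rewrite /F big_geq. Qed.

Let FS j m : F j m.+1 = F j m + p j m.
Proof. by rewrite /F big_nat_recr. Qed.

(** The cells of one level partition the plane, so a function of [code j z] is the simple function
    with these coefficients, and finite additivity of [Lam] suffices to evaluate it. *)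
Let sum_cell j z (g : nat -> R) :
  \sum_(0 <= m < B j) g m * \1_(cell j m) z = g (code j z).
Proof.
rewrite (big_nat_widen _ _ (B j)) // big_mkord.
rewrite (bigD1 (Ordinal (code_lt j z)))//= big1 ?addr0.
  by rewrite indicE mem_set// mulr1.
move=> i /andP[_ /eqP Hi]; rewrite indicE memNset ?mulr0// /cell/= => Hc; apply: Hi.
by apply/val_inj => /=; rewrite -Hc.
Qed.

Let F_B j : F j (B j) = 1.
Proof.
rewrite /F/p -(functional_sum pLam)// -[RHS](functional1 pLam).
congr (Lam _); apply/funext => z; rewrite -[RHS](sum_cell j z (fun=> 1)).
by apply: eq_bigr => m _; rewrite mul1r.
Qed.

Let p_refine j m : p j m = \sum_(m * D j <= i < m.+1 * D j) p j.+1 i.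
Proof.
rewrite /p -(functional_sum pLam)//; congr (Lam _); apply/funext => z.
rewrite mulSn addnC -{1}[(m * D j)%N]add0n big_addn addKn big_mkord.
have [zm|zm] := eqVneq (code j z) m.
  rewrite (bigD1 (Ordinal (digit_lt j z)))//= big1.
    rewrite addr0 !indicE !mem_set//; by rewrite /cell/= -/(code j z) zm addnC.
  move=> i /eqP Hi; rewrite indicE memNset// /cell/= => Hc; apply: Hi.
  by apply/val_inj => /=; move: Hc; rewrite -/(code j z) zm [RHS]addnC => /addnI.
rewrite indicE memNset; last exact/eqP.
rewrite big1// => i _; rewrite indicE memNset// => Hc.
move/eqP : zm; apply; by rewrite -code_div Hc addnC divnMDl// divn_small// addn0.
Qed.

(** Cell [m] of level [j] is cut into the consecutive cells of level [j.+1] whose quotient by [D j]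
    is [m]. Hence the partial sums of one level occur among those of the next. *)
Let F_refine j m : F j.+1 (m * D j) = F j m.
Proof. by rewrite /F big_nat_mul; apply: eq_bigr => i _; rewrite p_refine. Qed.

(** The unit interval is cut into consecutive half-open intervals whose lengths are the masses of
    the cells. By [F_refine] these partitions are nested; a cell of mass zero has an empty slot. *)
Let slot j u (m : nat) : Prop := F j m <= u < F j m.+1.

Let slot_ex j u : 0 <= u < 1 -> exists m, slot j u m.
Proof.
move=> /andP[u0 u1].
have : exists m, u < F j m.+1.
  exists (B j); rewrite (lt_le_trans u1)// -(F_B j) F_le//.
move=> /ex_minnP[[|m] um mmin]; first by exists 0%N; rewrite /slot F0 u0.
exists m.+1; rewrite /slot um andbT leNgt; apply/negP => /mmin.
by rewrite ltnn.
Qed.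

Let slot_uniq j u m n : slot j u m -> slot j u n -> m = n.
Proof.
move=> /andP[m1 m2] /andP[n1 n2]; apply/eqP; rewrite eqn_leq; apply/andP; split.
  rewrite leqNgt; apply/negP => /(F_le j) H.
  by have := lt_le_trans n2 (le_trans H m1); rewrite ltxx.
rewrite leqNgt; apply/negP => /(F_le j) H.
by have := lt_le_trans m2 (le_trans H n1); rewrite ltxx.
Qed.

Let slot_lt j u m : u < 1 -> slot j u m -> (m < B j)%N.
Proof.
move=> u1 /andP[m1 m2]; rewrite ltnNge; apply/negP => /(F_le j).
by rewrite F_B => /le_trans/(_ m1)/le_lt_trans/(_ u1); rewrite ltxx.
Qed.

Let slot_div j u m : slot j.+1 u m -> slot j u (m %/ D j)%N.
Proof.
move=> /andP[m1 m2]; apply/andP; split.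
  by rewrite -F_refine (le_trans _ m1)// F_le// leq_trunc_div.
by rewrite -F_refine (lt_le_trans m2)// F_le// -ltn_divLR.
Qed.

(** A nonempty slot has positive length, whereas a cell missing [K] has at most the mass of the
    complement of [K], which is zero. *)
Let slot_cell j u m : slot j u m -> exists2 z, K z & cell j m z.
Proof.
move=> /andP[m1 m2]; have : 0 < p j m.
  by have := le_lt_trans m1 m2; rewrite FS ltrDl.
move=> pm; apply: contrapT => H; move: pm; rewrite -LamK ltNge => /negP; apply.
apply: (functional_le pLam) => //.
- exact: bmeas_indic (measurableC (compact_measurableC cK)).
- move=> z; rewrite !indicE; have [zm|] := boolP (z \in cell j m) => //.
  by rewrite mem_set//= => Kz; apply: H; exists z; rewrite // -inE.
Qed.

Let K0 : exists z, K z.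
Proof.
have [|m /slot_cell[z Kz _]] := @slot_ex 0%N 0; first by rewrite lexx ltr01.
by exists z.
Qed.
Let z0 := sval (cid K0).
Let Kz0 : K z0. Proof. exact: (svalP (cid K0)). Qed.

Let pick_ex j m : exists z, K z /\ ((exists2 w, K w & cell j m w) -> cell j m z).
Proof.
have [[w Kw mw]|H] := pselect (exists2 w, K w & cell j m w); first by exists w.
by exists z0.
Qed.
Let pt j m := sval (cid (pick_ex j m)).
Let ptK j m : K (pt j m). Proof. by have [] := svalP (cid (pick_ex j m)). Qed.
Let ptP j m : (exists2 w, K w & cell j m w) -> cell j m (pt j m).
Proof. by have [] := svalP (cid (pick_ex j m)). Qed.

(** Digit [j] is read off the code of level [j.+1], and two points sharing it lie in the same ball
    of radius [e_ j]. That [z] is in [K] excludes the extra digit of the points in no ball. *)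
Let near_cell j z w : K z -> code j.+1 z = code j.+1 w ->
  modulus (z - w) < 2 * e_ j.
Proof.
move=> Kz zw; have : digit j z = digit j w by rewrite -!code_mod zw.
have hz : has (near_net j ^~ z) (net j).
  by have [c cn cz] := netP j Kz; apply/hasP; exists c.
move=> dzw; have hw : has (near_net j ^~ w) (net j).
  by move: hz; rewrite !has_find -/(digit j z) dzw.
have := nth_find 0 hz; have := nth_find 0 hw; rewrite -/(digit j z) -/(digit j w) dzw.
rewrite /near_net => H1 H2; apply: le_lt_trans (modulus_triangle _ _ (nth 0 (net j) (digit j w))) _.
by rewrite modulusB mulr2n mulrDl mul1r ltrD.
Qed.

Let idx_ex j u : exists m, 0 <= u < 1 -> slot j u m.
Proof.
have [/(slot_ex j)[m mP]|H] := pselect (0 <= u < 1); first by exists m.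
by exists 0%N.
Qed.
Let idx j u := sval (cid (idx_ex j u)).
Let idxP j u : 0 <= u < 1 -> slot j u (idx j u).
Proof. exact: (svalP (cid (idx_ex j u))). Qed.

Let I : set (measurableTypeR R) := `[0, 1[%classic.
Let IE u : I u = (0 <= u < 1). Proof. by rewrite /I/= in_itv. Qed.
Let mI : measurable I. Proof. exact: measurable_itv. Qed.

Let X_ j (u : R) : R[i] := if 0 <= u < 1 then pt j.+1 (idx j.+1 u) else z0.

Let XK j u : K (X_ j u). Proof. by rewrite /X_; case: ifP. Qed.

(** Slots are nested, so the point chosen at a deeper level still lies in the coarser cell. This
    makes [X_ j u] a Cauchy sequence, at the rate [2 * e_ j]. *)
Let code_X k j u : 0 <= u < 1 -> code j.+1 (X_ (j + k) u) = idx j.+1 u.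
Proof.
move=> u01; elim: k j => [|k ih] j.
  by rewrite addn0 /X_ u01; apply: ptP; apply: slot_cell; exact: idxP.
rewrite -code_div addnS -addSn ih; apply: (@slot_uniq j.+1 u); last exact: idxP.
by apply: slot_div; exact: idxP.
Qed.

Let X_near i j u : (j <= i)%N -> modulus (X_ i u - X_ j u) <= 2 * e_ j.
Proof.
move=> ji; have [u01|u01] := boolP (0 <= u < 1); last first.
  by rewrite /X_ (negbTE u01) subrr Normc.normc0 mulr_ge0// ltW.
apply/ltW/near_cell => //; rewrite -(subnKC ji) code_X//.
by have := @code_X 0%N j u u01; rewrite addn0 => ->.
Qed.

Let e_cvg0 (d : R) : 0 < d -> exists j, 2 * e_ j < d.
Proof.
move=> d0; have : (2 * e_ j) @[j --> \oo] --> (2 * 0 : R).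
  apply: cvgM; first exact: cvg_cst.
  rewrite (_ : e_ = (fun j => 2^-1 ^+ j)).
    by apply: cvg_expr; rewrite ger0_norm// invf_lt1// ltr1n.
  by apply/funext => j; rewrite /e_ exprVn.
rewrite mulr0 => /cvgrPdist_lt/(_ d d0)[j _ /(_ j (leqnn j))] /=.
rewrite sub0r normrN ger0_norm ?mulr_ge0 ?ltW//.
by exists j.
Qed.

Let lim_ex u : exists x, K x /\ forall j, modulus (X_ j u - x) <= 2 * e_ j.
Proof.
have [|x [Kx xP]] := @cK (X_ j u @[j --> \oo]).
  by exists 0%N => // j _; exact: XK.
exists x; split=> // j; apply/ler_addgt0Pr => e e0.
pose A := [set X_ i u | i in [set i | (j <= i)%N]].
pose Bx := [set w | modulus (x - w) < e].
have [||w [[i /= ji <-] xi]] := xP A Bx.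
- by exists j => // i /= ji; exists i.
- by apply/nbhs_modulusP; exists e.
apply: le_trans (modulus_triangle _ _ (X_ i u)) _.
rewrite modulusB lerD//; first exact: X_near.
by rewrite modulusB ltW.
Qed.

Let X u := sval (cid (lim_ex u)).
Let X_in u : K (X u). Proof. by have [] := svalP (cid (lim_ex u)). Qed.
Let X_lim j u : modulus (X_ j u - X u) <= 2 * e_ j.
Proof. by have [] := svalP (cid (lim_ex u)). Qed.

Let S j m : set (measurableTypeR R) := [set u | slot j u m].
Let S_itv j m : S j m = `[F j m, F j m.+1[%classic.
Proof. by apply/seteqP; split=> u; rewrite /S/slot/= in_itv. Qed.
Let mS j m : measurable (S j m).
Proof. by rewrite S_itv; exact: measurable_itv. Qed.

Let X_slot j u m : 0 <= u < 1 -> slot j.+1 u m -> X_ j u = pt j.+1 m.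
Proof.
by move=> u01 um; rewrite /X_ u01 (slot_uniq um (idxP _ u01)).
Qed.

(** For [u] in the unit interval, [X u] is within [2 * e_ j] of [X_ j u], so it lies in an open [U]
    exactly when at some level the closed disc of that radius about [X_ j u] is inside [U]. Each
    such condition depends on the slot of [u] only, so countably many intervals suffice. *)
Let measurable_X : measurable_fun [set: measurableTypeR R] (X : _ -> R[i]).
Proof.
apply: (@measurability _ _ (measurableTypeR R) R[i] _ _ (@open R[i])) => //.
move=> _ [U oU <-]; rewrite setTI.
pose G j m := [set u : measurableTypeR R | (I u /\ S j.+1 m u) /\
  forall w, modulus (pt j.+1 m - w) <= 2 * e_ j -> U w].
have mG j m : measurable (G j m).
  have [GO|GO] := pselect (forall w, modulus (pt j.+1 m - w) <= 2 * e_ j -> U w).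
    rewrite [X in measurable X](_ : _ = I `&` S j.+1 m); first exact: measurableI.
    by apply/seteqP; split=> u [].
  rewrite [X in measurable X](_ : _ = set0)//.
  by apply/seteqP; split=> u // [_].
have mI' : measurable [set u : measurableTypeR R | ~ I u /\ U (X u)].
  have Xz0 u : ~ I u -> X u = z0.
    rewrite IE => /negP u01; apply/eqP; rewrite eq_sym -subr_eq0.
    rewrite -[_ == 0]negbK -modulus_gt0; apply/negP => /e_cvg0[j].
    by rewrite ltNge => /negP; apply; have := X_lim j u; rewrite /X_ (negbTE u01).
  have [Uz|Uz] := pselect (U z0).
    rewrite [X in measurable X](_ : _ = ~` I); first exact: measurableC.
    by apply/seteqP; split=> u; [case|move=> /= Iu; rewrite Xz0].
  rewrite [X in measurable X](_ : _ = set0)//.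
  by apply/seteqP; split=> u // [/Xz0 ->].
rewrite [X in measurable X](_ : _ = (\bigcup_j \bigcup_m G j m) `|`
    [set u | ~ I u /\ U (X u)]).
  by apply: measurableU => //; do 2 apply: bigcupT_measurable => ?.
apply/seteqP; split=> u.
  move=> /= UX; have [Iu|Iu] := pselect (I u); last by right.
  left; have /open_modulusP/(_ _ UX)[d d0 dP]  := oU.
  have [j jd] : exists j, 2 * e_ j < d / 2 by apply: e_cvg0; rewrite divr_gt0.
  have u01 : 0 <= u < 1 by rewrite -IE.
  exists j => //; exists (idx j.+1 u) => //; split; first by split=> //; exact: idxP.
  move=> w jw; apply: dP; rewrite (splitr d).
  apply: le_lt_trans (modulus_triangle _ _ (X_ j u)) _.
  rewrite modulusB ltrD// ?(le_lt_trans (X_lim j u))//.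
  by rewrite (X_slot u01 (idxP j.+1 u01)) (le_lt_trans jw).
move=> [[j _ [m _ [[Iu um] H]]]|[]//]; apply: H.
by have := X_lim j u; rewrite (@X_slot j u m)// -IE.
Qed.

Let P : probability (measurableTypeR R) R := @unit_lebesgue R.

Let step (f : R[i] -> R) j : (fun u => f (X_ j u)) = (fun u : measurableTypeR R =>
  \sum_(0 <= m < B j.+1) f (pt j.+1 m) * \1_(S j.+1 m) u + f z0 * \1_(~` I) u).
Proof.
apply/funext => u; have [u01|u01] := boolP (0 <= u < 1).
  rewrite [X in _ + _ * X]indicE memNset ?mulr0 ?addr0; last by rewrite /= IE.
  have um := idxP j.+1 u01; have mB : (idx j.+1 u < B j.+1)%N.
    by apply: slot_lt um; case/andP : u01.
  rewrite big_mkord (bigD1 (Ordinal mB))//= big1.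
    by rewrite (X_slot u01 um) indicE mem_set// mulr1 addr0.
  move=> i /eqP Hi; rewrite indicE memNset ?mulr0// => ui; apply: Hi.
  by apply/val_inj => /=; exact: slot_uniq ui um.
rewrite [X in _ + _ * X]indicE mem_set/=; last by rewrite IE; exact/negP.
rewrite mulr1 big_nat big1 ?add0r ?/X_ ?(negbTE u01)// => m /andP[_ mB].
rewrite indicE memNset ?mulr0// => /andP[u1 u2].
move/negP : u01; apply; apply/andP; split.
  by rewrite (le_trans _ u1)// -(F0 j.+1) F_le.
by rewrite (lt_le_trans u2)// -(F_B j.+1) F_le.
Qed.

Let bstep (f : R[i] -> R) j : bmeas (fun u : measurableTypeR R => f (X_ j u)).
Proof.
rewrite step; apply: bmeasD.
  by apply: bmeas_sum => m; apply: bmeasZ; exact: bmeas_indic.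
by apply: bmeasZ; apply: bmeas_indic; exact: measurableC.
Qed.

(** The slot of a cell has the mass of that cell as its length, so both sides are the same finite
    sum. As [X_ j] takes finitely many values, this holds for arbitrary [f]. *)
Let int_step (f : R[i] -> R) j : \int[P]_u f (X_ j u) = Lam (fun z => f (pt j.+1 (code j.+1 z))).
Proof.
rewrite step bmeas_intD; last 2 first.
- by apply: bmeas_sum => m; apply: bmeasZ; exact: bmeas_indic.
- by apply: bmeasZ; apply: bmeas_indic; exact: measurableC.
rewrite bmeas_int_sum; last by move=> m; apply: bmeasZ; exact: bmeas_indic.
rewrite bmeas_intZ; last by apply: bmeas_indic; exact: measurableC.
rewrite bmeas_int_indic; last exact: measurableC.
rewrite [X in fine X](_ : _ = 0%E); last first.
  by rewrite /P/= /unit_lebesgue /mrestr setICl measure0.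
rewrite mulr0 addr0.
transitivity (\sum_(0 <= m < B j.+1) f (pt j.+1 m) * p j.+1 m).
  rewrite !big_nat; apply: eq_bigr => m /andP[_ mB].
  rewrite bmeas_intZ ?bmeas_int_indic//; last exact: bmeas_indic.
  congr (_ * _); rewrite /P/= S_itv unit_lebesgue_itv/=.
  - by rewrite FS addrC addKr.
  - by rewrite -(F0 j.+1) F_le.
  - exact: F_le.
  - by rewrite -(F_B j.+1) F_le.
under [in RHS]eq_fun do rewrite -(sum_cell j.+1 _ (fun m => f (pt j.+1 m))).
rewrite (functional_sum pLam); last by move=> m; exact: bmeasZ.
by apply: eq_bigr => m _; rewrite (functionalZ pLam).
Qed.

(** The measure is the law of [X], a random point of [K] driven by a uniform variable [u]. Agreement
    is claimed for functions continuous on [K], as a finitely additive [Lam] may differ from every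
    measure on indicators. *)
Theorem riesz_compact : exists mu : probability R[i] R, mu K = 1%E /\
  forall f, bmeas f -> {within K, continuous f} -> \int[mu]_z f z = Lam f.
Proof.
pose Xm : {mfun measurableTypeR R >-> R[i]} :=
  HB.pack (X : measurableTypeR R -> R[i])
    (isMeasurableFun.Build _ _ _ _ _ measurable_X).
exists (distribution P Xm); split.
  rewrite /distribution /pushforward /= (_ : X @^-1` K = setT).
    exact: probability_setT.
  by apply/seteqP; split=> // u _; exact: X_in.
move=> f bf cf.
have bfX : bmeas (fun u : measurableTypeR R => f (X u)).
  case: bf => mf [M fM]; split; last by exists M => u; exact: fM.
  by apply: measurableT_comp => //; exact: measurable_X.
have [mf [M fM]] := bf.
have -> : \int[distribution P Xm]_z f z = \int[P]_u f (X u).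
  rewrite /Rintegral integral_distribution//; first exact/measurable_EFinP.
  exact: (bmeas_integrable _ _ bfX).
apply/eqP; rewrite -subr_eq0 -normr_le0; apply/ler_addgt0Pr => e e0; rewrite add0r.
have e2 : 0 < e / 2 by rewrite divr_gt0.
have [d d0 dP] := compact_uniform cK cf e2.
have cv : \int[P]_u f (X_ j u) @[j --> \oo] --> \int[P]_u f (X u).
  apply: (@bmeas_int_cvg _ _ _ P _ _ M _ _ _).2.
  - by move=> n; have [] := bstep f n.
  - by move=> n u; exact: fM.
  - move=> u; apply/cvgrPdist_lt => e' e'0.
    have [d' d'0 d'P] := compact_uniform cK cf e'0.
    have [j jd] := e_cvg0 d'0; exists j => // i /= ji.
    apply: d'P => //; rewrite modulusB (le_lt_trans _ jd)//.
    rewrite (le_trans (X_lim i u))// ler_wpM2l// lef_pV2 ?posrE ?exprn_gt0//.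
    by rewrite ler_eXn2l// ltr1n.
have /cvgrPdist_lt/(_ _ e2)[N _ NP] := cv.
have [j jd] := e_cvg0 d0.
pose k := maxn N j.
have kd : 2 * e_ k < d.
  rewrite (le_lt_trans _ jd)// ler_wpM2l// lef_pV2 ?posrE ?exprn_gt0//.
  by rewrite ler_eXn2l ?ltr1n// leq_maxr.
have bc : bmeas (fun z => f (pt k.+1 (code k.+1 z))).
  under eq_fun do rewrite -(sum_cell k.+1 _ (fun m => f (pt k.+1 m))).
  by apply: bmeas_sum => m; exact: bmeasZ.
(* Off [K] the two functions may differ by as much as [2 * M], but there [Lam] has no mass. *)
have bK : bmeas (fun z => 2 * M * (\1_(~` K) z : R)).
  apply: bmeasZ; exact: bmeas_indic (measurableC (compact_measurableC cK)).
have H : `|Lam f - Lam (fun z => f (pt k.+1 (code k.+1 z)))| <= e / 2.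
  rewrite -(functionalB pLam)// -[leRHS]addr0 -[X in _ + X](mulr0 (2 * M)) -LamK.
  rewrite -(functionalZ pLam); last first.
    exact: bmeas_indic (measurableC (compact_measurableC cK)).
  apply: (functional_norm_le pLam) => //; first exact: bmeasB.
  move=> z; rewrite indicE; have [zK|zK] := boolP (z \in ~` K).
    rewrite mulr1; apply: le_trans (ler_normB _ _) _.
    by rewrite ler_wpDl ?(ltW e2)// mulr2n mulrDl mul1r lerD.
  rewrite mulr0 addr0; have Kz : K z.
    by apply: contrapT => nKz; move/negP : zK; apply; rewrite inE.
  apply/ltW/dP => //.
  apply: lt_trans kd; apply: near_cell => //.
  by apply/esym; apply: (@ptP k.+1 (code k.+1 z)); exists z.
rewrite (splitr e) -(subrKA (\int[P]_u f (X_ k u))).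
apply: le_trans (ler_normD _ _) _; apply: lerD.
  by apply/ltW/NP; rewrite /= leq_maxl.
by rewrite int_step distrC.
Qed.

End riesz.

(** * Limits along ultrafilters *)

Section ultralimit.
Context (R : realType).

Lemma bounded_ultra_cvg (U : set_system nat) (a : nat -> R) (M : R) :
  UltraFilter U -> (\forall n \near U, `|a n| <= M) -> cvg (a n @[n --> U]).
Proof.
move=> UU aM.
have [|x [_ xP]] := @segment_compact R (- M) M (a n @[n --> U]) _.
  by near=> n; rewrite /= in_itv/= -ler_norml; near: n.
apply/cvg_ex; exists x => V xV; have [//|UV] := in_ultra_setVsetC (a @^-1` V) UU.
by have [y [/= nVy /nVy]] := xP (~` V) V UV xV.
Unshelve. all: by end_near. Qed.

(** If convergence fails, the set of bad indices meets every tail, so the trace of [\oo] on it is a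
    proper filter; an ultrafilter above that trace contradicts the hypothesis. *)
Lemma cvg_ultra (a : nat -> R) (l : R) :
  (forall U, UltraFilter U -> \oo `<=` U -> a n @[n --> U] --> l) ->
  a n @[n --> \oo] --> l.
Proof.
move=> H; apply/cvgrPdist_lt => e e0; apply: contrapT => nbad.
pose A := [set n | ~ `|l - a n| < e].
have PF : ProperFilter (within A \oo).
  apply: Build_ProperFilter_ex => B; rewrite /within /= => -[N _ NB].
  apply: contrapT => B0; apply: nbad; exists N => // n Nn.
  by apply: contrapT => nA; apply: B0; exists n; exact: NB.
have [U [UU sU]] := ultraFilterLemma PF.
have oU : \oo `<=` U by move=> B oB; apply: sU; exact: filterS oB.
have := H U UU oU; move=> /cvgrPdist_lt/(_ e e0) Ue.
have UA : U A by apply: sU; rewrite /within/=; exact: nearW.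
by have [n [/= ? ?]] := @filter_ex _ U _ _ (@filterI _ U _ _ _ Ue UA).
Qed.

Lemma functional_bound (Lam : (R[i] -> R) -> R) (f : R[i] -> R) (M : R) :
  positive_functional Lam -> bmeas f -> (forall z, `|f z| <= M) -> `|Lam f| <= M.
Proof.
move=> pL bf fM; rewrite -[M]addr0 -[X in _ + X](functional_cst pL 0).
apply: (functional_norm_le pL) => //; first exact: bmeas_cst.
by move=> z; rewrite addr0.
Qed.

(** A single ultrafilter makes the values on all bounded measurable functions converge at once. The
    axioms are asked only near [U], as the average over an empty list of zeros violates
    [functional1]. *)
Lemma ultralimit_functional (U : set_system nat)
    (Lam_ : nat -> (R[i] -> R) -> R) :
  UltraFilter U -> (\forall n \near U, positive_functional (Lam_ n)) ->
  let Lam f := lim (Lam_ n f @[n --> U]) in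
  positive_functional Lam /\
  forall f, bmeas f -> Lam_ n f @[n --> U] --> Lam f.
Proof.
move=> UU pL Lam.
have cv f : bmeas f -> Lam_ n f @[n --> U] --> Lam f.
  move=> bf; have [_ [M fM]] := bf; apply: (@bounded_ultra_cvg U _ M) => //.
  by near=> n; apply: functional_bound => //; near: n.
split=> //; split.
- move=> f g bf bg; apply/cvg_lim => //.
  apply: (cvg_trans _ (cvgD (cv f bf) (cv g bg))); apply: near_eq_cvg.
  by near=> n; rewrite functionalD//; near: n.
- move=> c f bf; apply/cvg_lim => //.
  apply: (cvg_trans _ (cvgM (cvg_cst c) (cv f bf))); apply: near_eq_cvg.
  by near=> n; rewrite functionalZ//; near: n.
- move=> f bf f0; apply: limr_ge; first exact: cv.
  by near=> n; apply: functional_ge0 => //; near: n.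
- apply/cvg_lim => //; apply: (cvg_trans _ (@cvg_cst _ (1 : R) _ U _)); apply: near_eq_cvg.
  by near=> n; rewrite functional1//; near: n.
Unshelve. all: by end_near. Qed.

End ultralimit.

(** * The logarithmic kernel *)

Section log_series.
Context (R : realType).
Implicit Types q t : R.

Lemma is_derive_monomial (j : nat) t :
  is_derive t 1 (fun x : R => x ^+ j.+1 / j.+1%:R) (t ^+ j).
Proof.
rewrite (_ : (fun x : R => _) = j.+1%:R^-1 *: (@idfun R) ^+ j.+1); last first.
  by apply/funext => x; rewrite mulrC scalrfctE exprfctE.
have H := is_deriveX j.+1 (is_derive_id t (1 : R)).
have := is_deriveZ (j.+1%:R^-1 : R) H; rewrite [X in is_derive _ _ _ X -> _](_ : _ = t ^+ j)//.
by rewrite /= -[(_ *: 1 : R)]/(_ * 1) mulr1 -[LHS]/(_ * _) mulKf// pnatr_eq0.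
Qed.

Lemma is_derive_ln1B t : t < 1 ->
  is_derive t 1 (fun x : R => - ln (1 - x)) (1 - t)^-1.
Proof.
move=> t1; have t10 : 0 < 1 - t by rewrite subr_gt0.
have h1 : is_derive (1 - t) 1 (@ln R) (1 - t)^-1 by exact: is_derive1_ln.
have h2 : is_derive t (1 : R) (fun x : R => 1 - x) (0 - 1).
  by apply: is_deriveB.
have := is_deriveN (@is_derive1_comp _ (@ln R) (fun x : R => 1 - x) t _ _ h1 h2).
by rewrite sub0r mulrN1 opprK.
Qed.

(** By the geometric sum, the derivative of the remainder at [t] is [t ^+ M / (1 - t)]; the mean
    value theorem on the interval from 0 to [q] gives both bounds. *)
Lemma log_series_remainder q M : 0 <= q < 1 ->
  0 <= - ln (1 - q) - \sum_(j < M) q ^+ j.+1 / j.+1%:R <= q ^+ M.+1 / (1 - q).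
Proof.
move=> /andP[q0 q1].
pose f t : R := - ln (1 - t) - \sum_(j < M) t ^+ j.+1 / j.+1%:R.
pose df t : R := (1 - t)^-1 - \sum_(j < M) t ^+ j.
have dfE t : t < 1 -> df t = t ^+ M / (1 - t).
  move=> t1; have t10 : 1 - t != 0 by rewrite subr_eq0 gt_eqF.
  apply: (mulIf t10); rewrite mulfVK// mulrBl mulVf// -(opprB t 1) mulrN opprK mulrC.
  by rewrite -subrX1 addrC subrK.
have fdf t : t < 1 -> is_derive t 1 f (df t).
  move=> t1; rewrite /f /df; elim: M {f df dfE} => [|M ih].
    under [X in is_derive _ _ X]eq_fun do rewrite big_ord0 subr0.
    by rewrite big_ord0 subr0; exact: is_derive_ln1B.
  under [X in is_derive _ _ X]eq_fun do rewrite big_ord_recr/= opprD addrA.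
  rewrite big_ord_recr/= opprD addrA.
  by apply: is_deriveB => //; exact: is_derive_monomial.
have cf : {within `[0, q], continuous f}.
  apply: derivable_within_continuous => x; rewrite in_itv/= => /andP[_ xq].
  by have [] := fdf x (le_lt_trans xq q1).
have fd x : x \in `]0, q[ -> is_derive x 1 f (df x).
  by rewrite in_itv/= => /andP[_ xq]; apply: fdf; exact: lt_trans q1.
have [x] := MVT_segment q0 fd cf.
rewrite in_itv/= => /andP[x0 xq] fq.
have x1 : x < 1 by rewrite (le_lt_trans xq).
have f0 : f 0 = 0.
  rewrite /f subr0 ln1 oppr0 big1 ?subrr// => i _.
  by rewrite expr0n/= mul0r.
move: fq; rewrite f0 !subr0 dfE// {1}/f => ->.
have xM : 0 <= x ^+ M by rewrite exprn_ge0.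
have qx : 0 < 1 - q by rewrite subr_gt0.
have xx : 0 < 1 - x by rewrite subr_gt0.
have -> : x ^+ M / (1 - x) * q = (x ^+ M * q) / (1 - x) by rewrite mulrAC.
rewrite divr_ge0 ?(ltW xx) ?mulr_ge0//= exprSr.
rewrite ler_pM ?mulr_ge0 ?invr_ge0 ?(ltW xx)//.
  by rewrite ler_wpM2r// lerXn2r.
by rewrite lef_pV2// lerD2l lerN2.
Qed.

Lemma log_series_cvg q : 0 <= q < 1 ->
  \sum_(j < M) q ^+ j.+1 / j.+1%:R @[M --> \oo] --> - ln (1 - q).
Proof.
move=> q01; have /andP[q0 q1] := q01.
have g0 : q ^+ M.+1 / (1 - q) @[M --> \oo] --> (0 : R).
  rewrite -[X in _ --> X](mul0r ((1 - q)^-1)); apply: cvgM; last exact: cvg_cst.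
  rewrite cvg_shiftS; apply: cvg_expr; by rewrite ger0_norm.
have h0 : - ln (1 - q) - \sum_(j < M) q ^+ j.+1 / j.+1%:R @[M --> \oo] --> (0 : R).
  apply: (squeeze_cvgr _ (@cvg_cst _ 0 _ \oo _) g0).
  by apply: nearW => M; exact: log_series_remainder.
rewrite (_ : (fun M => _) = (fun M => - ln (1 - q) -
  (- ln (1 - q) - \sum_(j < M) q ^+ j.+1 / j.+1%:R))); last first.
  by apply/funext => M; rewrite subKr.
by rewrite -[X in _ --> X]subr0; apply: cvgB; [exact: cvg_cst|exact: h0].
Qed.

Lemma log_series_le q M : 0 <= q < 1 ->
  \sum_(j < M) q ^+ j.+1 / j.+1%:R <= - ln (1 - q).
Proof.
by move=> /(log_series_remainder M)/andP[]; rewrite subr_ge0.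
Qed.

(** Serves the diagonal of the kernel, where [chord z z = 1] and the series has to diverge to the
    value [+oo]. *)
Lemma harmonic_sum_cvgy : (\sum_(j < M) (j.+1%:R^-1 : R)) @[M --> \oo] --> +oo.
Proof.
have nd : nondecreasing_seq (series (@harmonic R)).
  by apply: nondecreasing_series => n _ _; exact: harmonic_ge0.
have := dvg_harmonic (R := R).
move=> H; have := nondecreasing_dvgn_lt nd H.
rewrite /series/=; under eq_fun do rewrite big_mkord.
exact.
Qed.

End log_series.

Section kernel.
Context (R : realType).
Local Notation Re := (@complex.Re R).
Local Notation Im := (@complex.Im R).
Implicit Types z w : R[i].

Definition hgt z : R := 1 + modulus z ^+ 2.

Definition logh z : R := 2^-1 * ln (hgt z).

(* These functions embed the plane in a sphere: their Gram matrix [chord] is one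
   minus the squared chordal distance. *)
Definition feat (i : 'I_6) z : R :=
  nth 0 [:: 1; Re z; Re z; Im z; Im z; modulus z ^+ 2] i / hgt z.

Definition chord z w : R := \sum_i feat i z * feat i w.

(** Minus the logarithm of the chordal distance on the sphere, normalized to be at most one. It
    differs from the kernel of [potential] by a function of [z] plus a function of [w], but it is
    nonnegative, and [+oo] exactly on the diagonal. *)
Definition kern z w : \bar R :=
  ((logh z + logh w)%:E - lne (modulus (z - w))%:E)%E.

(** The first [M] terms of [- ln (1 - chord z w) / 2], the 2 being there because [1 - chord z w] is
    a squared distance. The sum starts in degree one, which is why the moment of the empty word is
    treated apart later. *)
Definition kernM M z w : R :=
  \sum_(j < M) chord z w ^+ j.+1 / (2 * j.+1%:R).

Lemma hgt_ge1 z : 1 <= hgt z. Proof. by rewrite lerDl sqr_ge0. Qed.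
Lemma hgt_gt0 z : 0 < hgt z. Proof. exact: lt_le_trans ltr01 (hgt_ge1 z). Qed.

Lemma logh_ge0 z : 0 <= logh z.
Proof. by rewrite mulr_ge0// ln_ge0// hgt_ge1. Qed.

Lemma ln_modulus_le z : z != 0 -> ln (modulus z) <= logh z.
Proof.
move=> z0; rewrite ler_pdivlMl// -ler_expR.
rewrite mulrC -[2 : R]/(2%:R) expRM_natr lnK ?posrE ?modulus_gt0// lnK ?posrE ?hgt_gt0//.
by rewrite /hgt lerDr.
Qed.

Lemma modulus_sqr z : modulus z ^+ 2 = Re z ^+ 2 + Im z ^+ 2.
Proof. by case: z => a b; rewrite sqr_sqrtr// addr_ge0 ?sqr_ge0. Qed.

Lemma chordE z w : 1 - chord z w = modulus (z - w) ^+ 2 / (hgt z * hgt w).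
Proof.
have z0 := hgt_gt0 z; have w0 := hgt_gt0 w.
move: z0 w0; rewrite /chord /feat !big_ord_recl big_ord0/= /hgt !modulus_sqr.
case: z => a b; case: w => c d /= /lt0r_neq0 s0 /lt0r_neq0 t0.
by field; rewrite s0 t0.
Qed.

Lemma feat_continuous i : continuous (feat i).
Proof.
have ch : continuous hgt.
  move=> z; apply: (@cvgD _ _ _ (nbhs z)); first exact: cvg_cst.
  by apply: (@cvgM _ _ (nbhs z)); exact: continuous_modulus.
move=> z; apply: (@cvgM _ _ (nbhs z)); last first.
  by apply: (@cvgV _ _ (nbhs z)); [rewrite gt_eqF// hgt_gt0|exact: ch].
have c1 := @continuous_Re R z; have c2 := @continuous_Im R z.
have c3 := @continuous_modulus R z.
case: i => -[|[|[|[|[|[|//]]]]]] ? /=; rewrite /feat/=; [|exact: c1|exact: c1|exact: c2|exact: c2|].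
  exact: cvg_cst.
by apply: (@cvgM _ _ (nbhs z)); exact: c3.
Qed.

Lemma feat_le1 i z : `|feat i z| <= 1.
Proof.
have z0 := hgt_gt0 z; rewrite /feat normrM normfV (gtr0_norm z0) ler_pdivrMr// mul1r.
have m0 := modulus_ge0 z.
have mh : modulus z <= hgt z.
  rewrite /hgt; have := sqr_ge0 (modulus z - 1); nra.
case: i => -[|[|[|[|[|[|//]]]]]] ? /=.
- by rewrite normr1 hgt_ge1.
- exact: le_trans (Re_le_modulus z) mh.
- exact: le_trans (Re_le_modulus z) mh.
- exact: le_trans (Im_le_modulus z) mh.
- exact: le_trans (Im_le_modulus z) mh.
- by rewrite ger0_norm ?sqr_ge0// /hgt lerDr.
Qed.

Lemma bmeas_feat i : bmeas (feat i : R[i] -> R).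
Proof.
split; first by apply: continuous_measurableC; exact: feat_continuous.
by exists 1 => z; exact: feat_le1.
Qed.

Lemma chord_ge0 z w : 0 <= chord z w.
Proof.
rewrite /chord /feat !big_ord_recl big_ord0/=.
have z0 := hgt_gt0 z; have w0 := hgt_gt0 w.
have -> : forall a b c d e f : R, a / hgt z * (b / hgt w) + (c / hgt z * (d / hgt w) +
  (c / hgt z * (d / hgt w) + (e / hgt z * (f / hgt w) + (e / hgt z * (f / hgt w) +
  (modulus z ^+ 2 / hgt z * (modulus w ^+ 2 / hgt w) + 0))))) =
  (a * b + c * d *+ 2 + e * f *+ 2 + modulus z ^+ 2 * modulus w ^+ 2) / (hgt z * hgt w).
  by move=> a b c d e f; field; rewrite !gt_eqF.
rewrite divr_ge0// ?mulr_ge0 ?(ltW z0) ?(ltW w0)// !modulus_sqr mulr1.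
case: z {z0} => a b; case: w {w0} => c d /=.
(* The numerator is the squared modulus of one plus [z] times the conjugate of [w]. *)
have -> : 1 + a * c *+ 2 + b * d *+ 2 + (a ^+ 2 + b ^+ 2) * (c ^+ 2 + d ^+ 2) =
  (1 + a * c + b * d) ^+ 2 + (a * d - b * c) ^+ 2 by ring.
by rewrite addr_ge0 ?sqr_ge0.
Qed.

Lemma chord_lt1 z w : z != w -> chord z w < 1.
Proof.
rewrite -subr_eq0 -modulus_gt0 => zw.
by rewrite -subr_gt0 chordE divr_gt0 ?exprn_gt0// mulr_gt0 ?hgt_gt0.
Qed.

Lemma chordxx z : chord z z = 1.
Proof.
apply/eqP; rewrite eq_sym -subr_eq0 chordE subrr Normc.normc0.
by rewrite expr0n mul0r.
Qed.

Lemma kernM_ge0 M z w : 0 <= kernM M z w.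
Proof.
by apply: sumr_ge0 => j _; rewrite divr_ge0// exprn_ge0// chord_ge0.
Qed.

Lemma kernM_nd z w : nondecreasing_seq (fun M => kernM M z w).
Proof.
apply/nondecreasing_seqP => n; rewrite /kernM big_ord_recr/= lerDl.
by rewrite divr_ge0// exprn_ge0// chord_ge0.
Qed.

Lemma kernE z w : z != w ->
  kern z w = (logh z + logh w - ln (modulus (z - w)))%:E.
Proof.
by rewrite -subr_eq0 -modulus_gt0 => zw; rewrite /kern lne_EFin.
Qed.

Lemma ln_chord z w : z != w ->
  - ln (1 - chord z w) = 2 * (logh z + logh w - ln (modulus (z - w))).
Proof.
rewrite -subr_eq0 -modulus_gt0 => zw.
have z0 := hgt_gt0 z; have w0 := hgt_gt0 w.
rewrite chordE ln_div ?posrE ?exprn_gt0 ?mulr_gt0// lnM ?posrE//.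
by rewrite lnXn// /logh -mulr_natl; field.
Qed.

Lemma kernM_half M z w :
  kernM M z w = 2^-1 * \sum_(j < M) chord z w ^+ j.+1 / j.+1%:R.
Proof.
by rewrite /kernM big_distrr/=; apply: eq_bigr => j _; rewrite invfM mulrCA.
Qed.

Lemma kernM_cvg z w : (kernM M z w)%:E @[M --> \oo] --> kern z w.
Proof.
have [->|zw] := eqVneq z w.
  rewrite /kern subrr Normc.normc0 le0_lneNy//=.
  apply/cvgeryP; under eq_fun do rewrite kernM_half chordxx.
  under eq_fun do under eq_bigr do rewrite expr1n mul1r.
  apply/cvgryPge => A.
  have H := @harmonic_sum_cvgy R; move/cvgryPge : H => /(_ (2 * A)).
  by apply: filterS => M; rewrite ler_pdivlMl.
rewrite kernE//; apply: cvg_EFin; first exact: nearW.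
rewrite (_ : logh _ + _ - _ = 2^-1 * - ln (1 - chord z w)); last first.
  by rewrite ln_chord// mulKf.
under eq_fun do rewrite kernM_half.
apply: cvgM; first exact: cvg_cst.
by apply: log_series_cvg; rewrite chord_ge0 chord_lt1.
Qed.

Lemma kernM_le M z w : ((kernM M z w)%:E <= kern z w)%E.
Proof.
have [->|zw] := eqVneq z w.
  by rewrite /kern subrr Normc.normc0 le0_lneNy//= leey.
rewrite kernE// lee_fin kernM_half ler_pdivrMl// -ln_chord//.
by apply: log_series_le; rewrite chord_ge0 chord_lt1.
Qed.

Lemma kern_ge0 z w : (0 <= kern z w)%E.
Proof. by apply: le_trans (kernM_le 0 z w); rewrite lee_fin kernM_ge0. Qed.

End kernel.

(** * Monomials and the energy form *)

Section words.
Context (R : realType).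
Implicit Types z w : R[i].

Definition mon (s : seq 'I_6) z : R := \prod_(i <- s) feat i z.

(** Words rather than multisets of indices: a power of a sum expands over words with all
    coefficients equal to one. *)
Fixpoint words k : seq (seq 'I_6) :=
  if k is k'.+1 then [seq i :: s | i <- index_enum 'I_6, s <- words k'] else [:: [::]].

Lemma mem_words s : s \in words (size s).
Proof.
elim: s => //= i s ih; apply/allpairsP; exists (i, s); split=> //=.
by rewrite mem_index_enum.
Qed.

Lemma chordX k z w : chord z w ^+ k = \sum_(s <- words k) mon s z * mon s w.
Proof.
elim: k => [|k ih]; first by rewrite /= big_seq1 /mon !big_nil mulr1.
rewrite exprS ih /= big_allpairs_dep /chord big_distrl/=; apply: eq_bigr => i _.
rewrite big_distrr/=; apply: eq_bigr => s _.
by rewrite /mon !big_cons mulrACA.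
Qed.

Lemma bmeas_mon s : bmeas (mon s : R[i] -> R).
Proof. by apply: bmeas_prod; exact: bmeas_feat. Qed.

Lemma mon_continuous s : continuous (mon s : R[i] -> R).
Proof.
elim: s => [|i s ih] z.
  rewrite (_ : mon [::] = fun=> 1); first exact: cst_continuous.
  by apply/funext => w; rewrite /mon big_nil.
have -> : mon (i :: s) = (fun w => feat i w * mon s w).
  by apply/funext => w; rewrite /mon big_cons.
by apply: (@cvgM _ _ (nbhs z)); [exact: feat_continuous|exact: ih].
Qed.

(** With [a] and [b] the moments of two measures, this is the integral of [kernM M] against their
    product. Arbitrary families are allowed, so that bilinearity covers point evaluations, values of
    functionals and signed combinations alike. *)
Definition energyM M (a b : seq 'I_6 -> R) : R :=
  \sum_(j < M) (\sum_(s <- words j.+1) a s * b s) / (2 * j.+1%:R).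

Lemma kernM_energyM M z w : kernM M z w = energyM M (mon ^~ z) (mon ^~ w).
Proof. by apply: eq_bigr => j _; rewrite chordX. Qed.

Lemma energyMC M a b : energyM M a b = energyM M b a.
Proof.
by apply: eq_bigr => j _; congr (_ / _); apply: eq_bigr => s _; rewrite mulrC.
Qed.

Lemma energyMDl M a a' b :
  energyM M (fun s => a s + a' s) b = energyM M a b + energyM M a' b.
Proof.
rewrite /energyM -big_split/=; apply: eq_bigr => j _; rewrite -mulrDl -big_split/=.
by congr (_ / _); apply: eq_bigr => s _; rewrite mulrDl.
Qed.

Lemma energyMZl M (c : R) a b : energyM M (fun s => c * a s) b = c * energyM M a b.
Proof.
rewrite /energyM big_distrr/=; apply: eq_bigr => j _; rewrite mulrA big_distrr/=.
by congr (_ / _); apply: eq_bigr => s _; rewrite mulrA.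
Qed.

Lemma energyMDr M a b b' :
  energyM M a (fun s => b s + b' s) = energyM M a b + energyM M a b'.
Proof. by rewrite energyMC energyMDl !(energyMC _ a). Qed.

Lemma energyMZr M (c : R) a b : energyM M a (fun s => c * b s) = c * energyM M a b.
Proof. by rewrite energyMC energyMZl (energyMC _ a). Qed.

Lemma energyM_term_ge0 (a : seq 'I_6 -> R) j :
  0 <= (\sum_(s <- words j.+1) a s * a s) / (2 * j.+1%:R).
Proof. by rewrite divr_ge0// sumr_ge0// => s _; rewrite -expr2 sqr_ge0. Qed.

(** A sum of squares with positive weights that is at most zero has only zero terms. Taking [M] to
    be the length of the word exposes its square; the empty word does not occur in the form. *)
Lemma energyM_eq0 (a : seq 'I_6 -> R) s : (0 < size s)%N ->
  (forall M, energyM M a a <= 0) -> a s = 0.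
Proof.
case: s => // i s _ H; have := H (size s).+1; set t := i :: s.
rewrite /energyM big_ord_recr/= => Hle.
have h1 : 0 <= \sum_(j < size s) (\sum_(s0 <- words j.+1) a s0 * a s0) / (2 * j.+1%:R).
  by apply: sumr_ge0 => j _; exact: energyM_term_ge0.
have h2 : \sum_(s0 <- words (size s).+1) a s0 * a s0 <= 0.
  have c0 : 0 < (2 * (size s).+1%:R : R) by rewrite mulr_gt0.
  by rewrite -(ler_pM2r (x := (2 * (size s).+1%:R)^-1)) ?invr_gt0// mul0r (le_trans _ Hle)// lerDr.
have := mem_words t; move: h2; rewrite -[size t]/(size s).+1.
elim: (words _) => // u l ih; rewrite big_cons inE => h2.
have h3 : 0 <= \sum_(s0 <- l) a s0 * a s0.
  by apply: sumr_ge0 => s0 _; rewrite -expr2 sqr_ge0.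
have u0 : 0 <= a u * a u by rewrite -expr2 sqr_ge0.
move=> /orP[/eqP ->|]; last by apply: ih; rewrite (le_trans _ h2)// lerDr.
apply/eqP; rewrite -[_ == 0]orbb -mulf_eq0 eq_le u0 andbT.
by rewrite (le_trans _ h2)// lerDl.
Qed.

End words.

Arguments feat {R} i z.
Arguments mon {R} s z.

(** * Monotone limits, exceptional sets and infinite integrals *)

Section integral_tools.
Context d (T : measurableType d) (R : realType) (P : probability T R).

Lemma ge0_nd_integral_cvg (g : nat -> T -> R) (f : T -> \bar R) :
  (forall n, measurable_fun [set: T] (g n)) -> (forall n x, 0 <= g n x) ->
  (forall x, nondecreasing_seq (fun n => g n x)) ->
  (forall x, (g n x)%:E @[n --> \oo] --> f x) ->
  measurable_fun [set: T] f /\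
  (\int[P]_x (g n x)%:E @[n --> \oo] --> \int[P]_x f x)%E.
Proof.
move=> mg g0 nd gf; have mg' n : measurable_fun [set: T] (EFin \o g n).
  exact/measurable_EFinP.
split; first by apply: (emeasurable_fun_cvg _ _ mg') => x _; exact: gf.
have -> : f = (fun x => limn (fun n => (g n x)%:E)).
  by apply/funext => x; apply/esym/cvg_lim => //; exact: gf.
apply: (@cvg_monotone_convergence _ _ _ P setT measurableT (fun n x => (g n x)%:E)) => //.
- by move=> n x _; rewrite lee_fin.
- by move=> x _ m n mn; rewrite lee_fin nd.
Qed.

Lemma prob_ae (K : set T) (Q : T -> Prop) : measurable K -> P K = 1%E ->
  (forall x, K x -> Q x) -> {ae P, forall x, Q x}.
Proof.
move=> mK PK KQ; exists (~` K); split; first exact: measurableC.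
  by rewrite probability_setC// PK subee.
by move=> x /= nQ Kx; apply: nQ; exact: KQ.
Qed.

Lemma prob_ae_Rintegral (K : set T) (f g : T -> R) : measurable K -> P K = 1%E ->
  measurable_fun [set: T] f -> measurable_fun [set: T] g ->
  (forall x, K x -> f x = g x) -> \int[P]_x f x = \int[P]_x g x.
Proof.
move=> mK PK mf mg fg; rewrite /Rintegral; congr fine.
apply: ae_eq_integral => //; try exact/measurable_EFinP.
by apply: (prob_ae mK PK) => x /fg + _ => /= ->.
Qed.

(** The delicate case is an infinite integral of [f]: then [f - h] is not integrable, but its
    negative part is bounded by a constant, so the integral is still [+oo]. *)
Lemma integral_ge0B (f : T -> \bar R) (h : T -> R) :
  measurable_fun [set: T] f -> (forall x, 0 <= f x)%E -> bmeas h ->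
  (\int[P]_x (f x - (h x)%:E) = \int[P]_x f x - (\int[P]_x h x)%:E)%E.
Proof.
move=> mf f0 bh; have ih := bmeas_integrable P measurableT bh.
have hfin := bmeas_int_fin P bh.
have [fi|fi] := eqVneq (\int[P]_x f x)%E (+oo)%E; last first.
  rewrite integralB//; first by congr (_ - _)%E.
  apply/integrableP; split=> //.
  under eq_integral do rewrite gee0_abs//.
  by rewrite ltey.
rewrite fi addye//; have [mh [M hM]] := bh.
pose g x := (f x - (h x)%:E)%E.
have mg : measurable_fun [set: T] g.
  by apply: emeasurable_funB => //; exact/measurable_EFinP.
rewrite -[LHS]/(\int[P]_x g x)%E integralE.
have gn : (\int[P]_x (g^\- x) \is a fin_num)%E.
  rewrite ge0_fin_numE; last exact: integral_ge0.
  apply: (@le_lt_trans _ _ (\int[P]_x (`|M|)%:E)%E).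
    apply: ge0_le_integral => //.
    - exact: measurable_funeneg.
    - move=> x _; rewrite funenegE ge_max lee_fin normr_ge0 andbT leeNl.
      rewrite /g -EFinN -[X in (X <= _)%E]add0e leeD// -EFinN lee_fin lerN2.
      by rewrite (le_trans (ler_norm _))// (le_trans (hM x))// ler_norm.
  by rewrite integral_cst//= probability_setT mule1 ltry.
suff -> : (\int[P]_x (g^\+ x) = +oo)%E.
  by move: gn; case: (\int[P]_x g^\- x)%E.
apply/eqP; rewrite -leye_eq -fi.
have : (\int[P]_x f x <= \int[P]_x (g^\+ x + (`|M|)%:E))%E.
  apply: ge0_le_integral => //.
  - by apply: emeasurable_funD => //; exact: measurable_funepos.
  - move=> x _; apply: (@le_trans _ _ (g x + (`|M|)%:E)%E).
      rewrite /g -addeA -[X in (X <= _)%E]adde0 leeD2l// -EFinN -EFinD lee_fin.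
      by rewrite addrC subr_ge0 (le_trans (ler_norm _))// (le_trans (hM x))// ler_norm.
    by rewrite leeD2r// funeposE le_max lexx.
rewrite ge0_integralD//; last exact: measurable_funepos.
rewrite integral_cst//= probability_setT mule1 fi.
by case: (\int[P]_x _)%E.
Qed.

End integral_tools.

(** * Potentials and energies for the spherical kernel *)

Section potentials.
Context (R : realType).
Implicit Types (nu mu : probability R[i] R) (K : set R[i]) (z w : R[i]).

Lemma logh_continuous : continuous (@logh R).
Proof.
move=> z; apply: (@cvgM _ _ (nbhs z)); first exact: cvg_cst.
apply: continuous_cvg; last first.
  apply: (@cvgD _ _ _ (nbhs z)); first exact: cvg_cst.
  by apply: (@cvgM _ _ (nbhs z)); exact: continuous_modulus.
by apply: continuous_ln; exact: hgt_gt0.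
Qed.

Lemma compact_bmeas K (f : R[i] -> R) : compact K -> continuous f ->
  bmeas (fun z => f z * \1_K z).
Proof.
move=> cK cf; split.
  apply: measurable_funM; first exact: continuous_measurableC.
  by apply: measurable_indic; exact: compact_measurableC.
have [K0|K0] := pselect (K !=set0); last first.
  exists 0 => z; rewrite indicE memNset ?mulr0 ?normr0// => Kz.
  by apply: K0; exists z.
have cnf : continuous (fun z => `|f z|).
  by move=> z; apply: (@cvg_norm _ _ _ (nbhs z)); exact: cf.
have [c _ cP] := compact_EVT_max K0 cK (continuous_subspaceT cnf).
exists `|f c| => z; rewrite indicE.
by have [zK|_] := boolP (z \in K); rewrite ?mulr1 ?mulr0 ?normr0//; exact: cP.
Qed.

Lemma within_continuous_eq K (f g : R[i] -> R) : continuous g ->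
  (forall z, K z -> f z = g z) -> {within K, continuous f}.
Proof.
move=> /continuous_modulusP cg fg; apply/within_continuous_modulusP => z e Kz e0.
have [d d0 dP] := cg z e e0; exists d => // w Kw zw.
by rewrite !fg//; exact: dP.
Qed.

Lemma within_continuous_indic K (f : R[i] -> R) : continuous f ->
  {within K, continuous (fun z => f z * \1_K z)}.
Proof.
by move=> cf; apply: (within_continuous_eq cf) => z Kz; rewrite indicE mem_set// mulr1.
Qed.

Definition moment nu s : R := \int[nu]_z mon s z.

Definition ell nu : R := \int[nu]_z logh z.

(** The potential for [kern]. As this kernel is nonnegative, [spot] and [mutual] have a meaning,
    possibly [+oo], for every probability; [spotM] and [energyM] approach them from below. *)
Definition spot nu z : \bar R := (\int[nu]_w kern z w)%E.

Definition spotM nu M z : R := energyM M (mon ^~ z) (moment nu).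

Definition mutual mu nu : \bar R := (\int[mu]_z spot nu z)%E.

Lemma bmeas_energyM M (a : seq 'I_6 -> R) :
  bmeas (fun z : R[i] => energyM M (mon ^~ z) a).
Proof.
apply: bmeas_sum => j; rewrite (_ : (fun z => _) =
  (fun z => (2 * j.+1%:R)^-1 * \sum_(s <- words j.+1) a s * mon s z)).
  by apply: bmeasZ; apply: bmeas_sum => s; apply: bmeasZ; exact: bmeas_mon.
apply/funext => z; rewrite mulrC; congr (_ * _).
by apply: eq_bigr => s _; rewrite mulrC.
Qed.

Lemma functional_energyM Lam M (a : seq 'I_6 -> R) : positive_functional Lam ->
  Lam (fun z : R[i] => energyM M (mon ^~ z) a) = energyM M (fun s => Lam (mon s)) a.
Proof.
move=> pL; rewrite /energyM (functional_sum pL); last first.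
  move=> j; rewrite (_ : (fun z => _) =
    (fun z => (2 * j.+1%:R)^-1 * \sum_(s <- words j.+1) a s * mon s z)).
    by apply: bmeasZ; apply: bmeas_sum => s; apply: bmeasZ; exact: bmeas_mon.
  apply/funext => z; rewrite mulrC; congr (_ * _).
  by apply: eq_bigr => s _; rewrite mulrC.
apply: eq_bigr => j _; rewrite (_ : (fun z => _) =
    (fun z => (2 * j.+1%:R)^-1 * \sum_(s <- words j.+1) a s * mon s z)); last first.
  apply/funext => z; rewrite mulrC; congr (_ * _).
  by apply: eq_bigr => s _; rewrite mulrC.
rewrite (functionalZ pL); last first.
  by apply: bmeas_sum => s; apply: bmeasZ; exact: bmeas_mon.
rewrite mulrC (functional_sum pL); last by move=> s; apply: bmeasZ; exact: bmeas_mon.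
congr (_ / _); apply: eq_bigr => s _.
by rewrite (functionalZ pL) 1?mulrC//; exact: bmeas_mon.
Qed.

Lemma integral_functional nu : positive_functional (fun f => \int[nu]_z f z).
Proof.
split.
- by move=> f g bf bg; rewrite bmeas_intD.
- by move=> c f bf; rewrite bmeas_intZ.
- by move=> f _ f0; exact: bmeas_int_ge0.
- by rewrite bmeas_int_cst.
Qed.

Lemma int_kernM nu M z : \int[nu]_w kernM M z w = spotM nu M z.
Proof.
rewrite /spotM energyMC -(functional_energyM _ _ (integral_functional nu)).
by apply: eq_Rintegral => w _; rewrite kernM_energyM energyMC.
Qed.

Lemma int_spotM mu nu M :
  \int[mu]_z spotM nu M z = energyM M (moment mu) (moment nu).
Proof. exact: functional_energyM (integral_functional mu). Qed.

Lemma spotM_ge0 nu M z : 0 <= spotM nu M z.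
Proof. by rewrite -int_kernM; apply: bmeas_int_ge0 => w; exact: kernM_ge0. Qed.

Lemma bmeas_kernM M z : bmeas (fun w : R[i] => kernM M z w).
Proof.
under eq_fun do rewrite kernM_energyM energyMC; exact: bmeas_energyM.
Qed.

Lemma spotM_nd nu z : nondecreasing_seq (fun M => spotM nu M z).
Proof.
move=> m n mn; rewrite -!int_kernM; apply: bmeas_int_le; [exact: bmeas_kernM..|].
by move=> w; exact: kernM_nd.
Qed.

Lemma measurable_kern z : measurable_fun [set: R[i]] (kern z).
Proof.
apply: (emeasurable_fun_cvg (fun M w => (kernM M z w)%:E)).
  by move=> M; apply/measurable_EFinP; have [] := bmeas_kernM M z.
by move=> w _; exact: kernM_cvg.
Qed.

Lemma spot_cvg nu z : (spotM nu M z)%:E @[M --> \oo] --> spot nu z.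
Proof.
under eq_fun do rewrite -int_kernM -(bmeas_int_fin _ (bmeas_kernM _ _)).
have [||||_ H] := @ge0_nd_integral_cvg _ _ _ nu (fun M => kernM M z) (kern z);
  last exact: H.
- by move=> n; have [] := bmeas_kernM n z.
- by move=> n w; exact: kernM_ge0.
- by move=> w; exact: kernM_nd.
- by move=> w; exact: kernM_cvg.
Qed.

Lemma ereal_nd_cvg_ge (u : nat -> R) (l : \bar R) n : nondecreasing_seq u ->
  (u m)%:E @[m --> \oo] --> l -> ((u n)%:E <= l)%E.
Proof.
move=> nd ul; rewrite -(cvg_lim _ ul)//; apply: lime_ge; first by apply/cvg_ex; exists l.
by exists n => // m /= nm; rewrite lee_fin nd.
Qed.

Lemma spotM_le nu M z : ((spotM nu M z)%:E <= spot nu z)%E.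
Proof. exact: (@ereal_nd_cvg_ge _ _ _ (spotM_nd nu z) (@spot_cvg nu z)). Qed.

Lemma spot_ge0 nu z : (0 <= spot nu z)%E.
Proof. by apply: integral_ge0 => w _; exact: kern_ge0. Qed.

Lemma measurable_spotM nu M : measurable_fun [set: R[i]] (spotM nu M).
Proof. by have [] := bmeas_energyM M (moment nu). Qed.

Lemma measurable_spot nu : measurable_fun [set: R[i]] (spot nu).
Proof.
apply: (emeasurable_fun_cvg (fun M z => (spotM nu M z)%:E)).
  by move=> M; apply/measurable_EFinP; exact: measurable_spotM.
by move=> w _; exact: spot_cvg.
Qed.

Lemma mutual_cvg mu nu :
  (energyM M (moment mu) (moment nu))%:E @[M --> \oo] --> mutual mu nu.
Proof.
under eq_fun do rewrite -int_spotM -(bmeas_int_fin _ (bmeas_energyM _ _)).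
have [||||_ H] := @ge0_nd_integral_cvg _ _ _ mu (fun M => spotM nu M) (spot nu);
  last exact: H.
- by move=> n; exact: measurable_spotM.
- by move=> n w; exact: spotM_ge0.
- by move=> w; exact: spotM_nd.
- by move=> w; exact: spot_cvg.
Qed.

Lemma energyM_nd mu nu :
  nondecreasing_seq (fun M => energyM M (moment mu) (moment nu)).
Proof.
move=> m n mn; rewrite -!int_spotM; apply: bmeas_int_le; [exact: bmeas_energyM..|].
by move=> w; exact: spotM_nd.
Qed.

Lemma energyM_le_mutual mu nu M :
  ((energyM M (moment mu) (moment nu))%:E <= mutual mu nu)%E.
Proof. exact: (@ereal_nd_cvg_ge _ _ _ (energyM_nd mu nu) (@mutual_cvg mu nu)). Qed.

Lemma mutual_ge0 mu nu : (0 <= mutual mu nu)%E.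
Proof. by apply: integral_ge0 => w _; exact: spot_ge0. Qed.

(** Symmetry is inherited from the truncated forms through the monotone limit. *)
Lemma mutualC mu nu : mutual mu nu = mutual nu mu.
Proof.
have := @mutual_cvg nu mu; under eq_fun do rewrite energyMC.
by move/cvg_lim => <- //; rewrite (cvg_lim _ (@mutual_cvg mu nu)).
Qed.

(** Truncated energies depend on moments only, and these converge along weak limits. Bounding every
    truncation is thus the form in which lower semicontinuity of the energy is used. *)
Lemma mutual_le mu nu (e : R) :
  (forall M, energyM M (moment mu) (moment nu) <= e) -> (mutual mu nu <= e%:E)%E.
Proof.
move=> H; rewrite -(cvg_lim _ (@mutual_cvg mu nu))//; apply: lime_le.
  by apply/cvg_ex; eexists; exact: mutual_cvg.
by apply: nearW => M; rewrite lee_fin.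
Qed.

Lemma measurable_logh : measurable_fun [set: R[i]] (@logh R).
Proof. by apply: continuous_measurableC; exact: logh_continuous. Qed.

Lemma ell_indic nu K : compact K -> nu K = 1%E ->
  ell nu = \int[nu]_z (logh z * \1_K z).
Proof.
move=> cK nuK; apply: (prob_ae_Rintegral (compact_measurableC cK) nuK).
- exact: measurable_logh.
- by have [] := compact_bmeas cK logh_continuous.
- by move=> z Kz; rewrite indicE mem_set// mulr1.
Qed.

Lemma measurable_logpot z :
  measurable_fun [set: R[i]] (fun w => (- lne (modulus (z - w))%:E)%E).
Proof.
rewrite (_ : (fun w => _) = (fun w => kern z w - (logh z + logh w)%:E)%E).
  apply: emeasurable_funB; first exact: measurable_kern.
  by apply/measurable_EFinP; apply: measurable_funD => //; exact: measurable_logh.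
by apply/funext => w; rewrite /kern addeAC -EFinB subrr add0e.
Qed.

(** Compact support bounds [logh], so the correction has a finite integral and can be split off even
    where the potential is infinite. *)
Lemma potentialE nu K z : compact K -> nu K = 1%E ->
  potential nu z = (spot nu z - (logh z + ell nu)%:E)%E.
Proof.
move=> cK nuK; have bl := compact_bmeas cK logh_continuous.
rewrite (ell_indic cK nuK) -[logh z in RHS](bmeas_int_cst nu) -bmeas_intD//; last exact: bmeas_cst.
rewrite -integral_ge0B//; last 3 first.
- exact: measurable_kern.
- by move=> w; exact: kern_ge0.
- by apply: bmeasD => //; exact: bmeas_cst.
apply: ae_eq_integral => //; first exact: measurable_logpot.
  apply: emeasurable_funB; first exact: measurable_kern.
  by apply/measurable_EFinP; apply: measurable_funD => //; case: bl.
apply: (prob_ae (compact_measurableC cK) nuK) => w Kw _.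
by rewrite indicE mem_set// mulr1 /kern addeAC -EFinB subrr add0e.
Qed.

Lemma measurable_potential nu K : compact K -> nu K = 1%E ->
  measurable_fun [set: R[i]] (potential nu).
Proof.
move=> cK nuK; rewrite (_ : potential nu = (fun z => spot nu z - (logh z + ell nu)%:E)%E).
  apply: emeasurable_funB; first exact: measurable_spot.
  by apply/measurable_EFinP; apply: measurable_funD => //; exact: measurable_logh.
by apply/funext => z; rewrite (potentialE _ cK).
Qed.

Lemma integral_potential mu nu K K' : compact K -> nu K = 1%E ->
  compact K' -> mu K' = 1%E ->
  (\int[mu]_z potential nu z = mutual mu nu - (ell mu + ell nu)%:E)%E.
Proof.
move=> cK nuK cK' muK'; have bl := compact_bmeas cK' logh_continuous.
rewrite (ell_indic cK' muK') -[X in (_ + X)%:E](bmeas_int_cst mu) -bmeas_intD//; last exact: bmeas_cst.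
rewrite -integral_ge0B//; last 3 first.
- exact: measurable_spot.
- by move=> w; exact: spot_ge0.
- by apply: bmeasD => //; exact: bmeas_cst.
apply: ae_eq_integral => //; first exact: measurable_potential cK nuK.
  apply: emeasurable_funB; first exact: measurable_spot.
  by apply/measurable_EFinP; apply: measurable_funD => //; case: bl.
apply: (prob_ae (compact_measurableC cK') muK') => w Kw _.
by rewrite indicE mem_set// mulr1 (potentialE _ cK).
Qed.

Lemma energyE nu K : compact K -> nu K = 1%E ->
  energy nu = (mutual nu nu - (2 * ell nu)%:E)%E.
Proof.
by move=> cK nuK; rewrite /energy (integral_potential cK nuK cK nuK) mulr2n mulrDl mul1r.
Qed.

End potentials.

(** * Equilibrium measures *)

Section equilibrium.
Context (R : realType).
Implicit Types (nu mu : probability R[i] R) (K S : set R[i]) (z w : R[i]).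

Definition minimizer K nu (V : R) : Prop := [/\ nu K = 1%E, energy nu = V%:E &
  forall mu, mu K = 1%E -> (energy nu <= energy mu)%E].

Lemma energyM_cvg (F : set_system nat) M (a b : nat -> seq 'I_6 -> R)
    (a' b' : seq 'I_6 -> R) : Filter F ->
  (forall s, a n s @[n --> F] --> a' s) -> (forall s, b n s @[n --> F] --> b' s) ->
  energyM M (a n) (b n) @[n --> F] --> energyM M a' b'.
Proof.
move=> FF ca cb; rewrite /energyM.
apply: cvg_big => [|j _]; first exact: add_continuous.
apply: cvgM; last exact: cvg_cst.
by apply: cvg_big => [|s _]; [exact: add_continuous|exact: cvgM].
Qed.

Lemma functional_realize K Lam : compact K -> positive_functional Lam ->
  Lam \1_(~` K) = 0 ->
  exists mu : probability R[i] R, [/\ mu K = 1%E,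
    moment mu = (fun s => Lam (mon s)) & ell mu = Lam (fun z => logh z * \1_K z)].
Proof.
move=> cK pL LK; have [mu [muK muP]] := riesz_compact cK pL LK.
exists mu; split=> //.
  apply/funext => s; apply: muP; first exact: bmeas_mon.
  by apply: continuous_subspaceT; exact: mon_continuous.
rewrite (ell_indic cK muK); apply: muP.
  exact: compact_bmeas (@logh_continuous R).
exact: within_continuous_indic (@logh_continuous R).
Qed.

(** Lets minimality be tested on a functional given by a formula, such as a convex combination or a
    normalized restriction; [functional_realize] turns it into a competitor on [K]. *)
Lemma functional_energy_ge K nu V Lam (e : R) : compact K -> minimizer K nu V ->
  positive_functional Lam -> Lam \1_(~` K) = 0 ->
  (forall M, energyM M (fun s => Lam (mon s)) (fun s => Lam (mon s)) <= e) ->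
  V <= e - 2 * Lam (fun z => logh z * \1_K z).
Proof.
move=> cK [nuK nuV nuP] pL LK Le.
have [mu [muK muM <-]] := functional_realize cK pL LK.
have := nuP mu muK; rewrite nuV (energyE cK muK) leeBrDr// -EFinD => H.
rewrite lerBrDr -lee_fin (le_trans H)//.
by apply: mutual_le => M; rewrite muM.
Qed.

Lemma compact_logh_le K : compact K -> exists C : R, forall z, logh z * \1_K z <= C.
Proof.
move=> cK; have [_ [C CP]] := compact_bmeas cK (@logh_continuous R).
by exists C => z; rewrite (le_trans (ler_norm _)).
Qed.

Lemma energy_ge K : compact K -> exists C : R, forall mu, mu K = 1%E ->
  (C%:E <= energy mu)%E.
Proof.
move=> cK; have [C CP] := compact_logh_le cK.
exists (- (2 * C)) => mu muK; rewrite (energyE cK muK).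
rewrite leeBrDr// (le_trans _ (mutual_ge0 mu mu))// -EFinD lee_fin.
rewrite addrC subr_le0 ler_wpM2l// (ell_indic cK muK).
rewrite -[leRHS](bmeas_int_cst mu) bmeas_int_le//.
  exact: compact_bmeas (@logh_continuous R).
exact: bmeas_cst.
Qed.

Lemma energy_fin_mutual K nu (V : R) : compact K -> nu K = 1%E ->
  energy nu = V%:E -> mutual nu nu = (V + 2 * ell nu)%:E.
Proof.
by move=> cK nuK; rewrite (energyE cK nuK) => /eqP; rewrite EFinD; case: (mutual nu nu) => //= r; rewrite -EFinB eqe => /eqP <-; rewrite -EFinD subrK.
Qed.

(** Direct method: a minimizing sequence has a limit functional along an ultrafilter, carried by [K]
    and realized by a measure. Its energy is at most the infimum, since truncated energies converge
    and so does [ell], the function [logh] being continuous on [K]. *)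
Lemma equilibriumP K : compact K -> nonpolar K ->
  exists V : R, minimizer K (equilibrium_measure K) V.
Proof.
move=> cK [nu0 [nu0K nu0oo]]; have [C CP] := energy_ge cK.
pose A := [set e : R | exists nu, nu K = 1%E /\ energy nu = e%:E].
have fin nu : nu K = 1%E -> (energy nu < +oo)%E -> exists e : R, energy nu = e%:E.
  move=> nuK noo; exists (fine (energy nu)); rewrite fineK//.
  by rewrite fin_numE -ltNye -ltey noo andbT (lt_le_trans _ (CP _ nuK))// ltNyr.
have hA : has_inf A.
  split; first by have [e eP] := fin _ nu0K nu0oo; exists e, nu0.
  by exists C => e [nu [nuK nue]]; rewrite -lee_fin -nue CP.
have ge_infA nu : nu K = 1%E -> ((inf A)%:E <= energy nu)%E.
  move=> nuK; have [noo|] := ltP (energy nu) (+oo)%E; last first.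
    by rewrite leye_eq => /eqP ->; rewrite leey.
  have [e eP] := fin _ nuK noo; rewrite eP lee_fin; apply: ge_inf; last by exists nu.
  by case: hA.
have min_seq n : exists nu, nu K = 1%E /\
    exists2 e : R, energy nu = e%:E & e < inf A + n.+1%:R^-1.
  have [|e [nu [nuK nue]] eA] := @inf_adherent _ A n.+1%:R^-1 _ hA.
    by rewrite invr_gt0.
  by exists nu; split=> //; exists e.
have [nu_ nuP] := choice min_seq.
have [U [UU sU]] := ultraFilterLemma eventually_filter.
have [] := @ultralimit_functional R U (fun n f => \int[nu_ n]_z f z) UU.
  by apply: nearW => n; exact: integral_functional.
set Lam := fun f => lim _ => pL cL.
have cle (a : nat -> R) (l : R) : a n @[n --> \oo] --> l -> a n @[n --> U] --> l.
  by move=> H B /H; exact: sU.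
have LK : Lam \1_(~` K) = 0.
  apply/cvg_lim => //; apply: (cvg_trans _ (@cvg_cst _ (0 : R) _ U _)).
  apply: near_eq_cvg; apply: nearW => n; have [nuK _] := nuP n.
  have mK := compact_measurableC cK.
  rewrite bmeas_int_indic; last exact: measurableC.
  by rewrite probability_setC// nuK subee.
have [mu [muK muM muL]] := functional_realize cK pL LK.
have muV : (energy mu <= (inf A)%:E)%E.
  rewrite (energyE cK muK) leeBlDr// -EFinD; apply: mutual_le => M.
  have c1 : energyM M (moment (nu_ n)) (moment (nu_ n)) @[n --> U] -->
      energyM M (moment mu) (moment mu).
    by apply: energyM_cvg => s; rewrite muM; apply: cL; exact: bmeas_mon.
  have c2 : inf A + n.+1%:R^-1 + 2 * ell (nu_ n) @[n --> U] --> inf A + 0 + 2 * ell mu.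
    apply: cvgD.
      by apply: cvgD; [exact: cvg_cst|apply: cle; exact: cvg_harmonic].
    apply: cvgM; first exact: cvg_cst.
    rewrite muL; under eq_fun do rewrite (ell_indic cK (nuP _).1).
    by apply: cL; exact: compact_bmeas (@logh_continuous R).
  rewrite addr0 in c2.
  apply: (ler_cvg_to c1 c2); apply: nearW => n; have [nuK [e nue eA]] := nuP n.
  apply: (@le_trans _ _ (e + 2 * ell (nu_ n))); last by rewrite lerD2r ltW.
  by rewrite -lee_fin -(energy_fin_mutual cK nuK nue) energyM_le_mutual.
have : exists nu, nu K = 1%E /\ forall mu, mu K = 1%E -> (energy nu <= energy mu)%E.
  by exists mu; split=> // mu' mu'K; rewrite (le_trans muV)// ge_infA.
move=> /(@getPex (probability R[i] R)); rewrite -/(equilibrium_measure K) => -[eqK eqmin].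
exists (inf A); split=> //; apply/eqP; rewrite eq_le ge_infA// andbT.
exact: le_trans (eqmin _ muK) muV.
Qed.

Lemma small_quadratic (x y : R) :
  (forall t, 0 < t < 1 -> 0 <= x + t * y) -> 0 <= x.
Proof.
move=> H; rewrite leNgt; apply/negP => x0.
have d0 : 0 < 2 * (`|y| + `|x|) by rewrite mulr_gt0// ltr_wpDl// normr_gt0 lt_eqF.
(* For this [t] the product [t * y] is at most half the absolute value of [x], too small to
   compensate a negative [x]. *)
pose t := `|x| / (2 * (`|y| + `|x|)).
have xx : 0 < `|x| by rewrite normr_gt0 lt_eqF.
have t01 : 0 < t < 1.
  rewrite /t divr_gt0//= ltr_pdivrMr// mul1r.
  by have := normr_ge0 y; lra.
have := H t t01; apply/negP; rewrite -ltNge.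
have ty : t * y <= `|x| / 2.
  apply: (@le_trans _ _ (t * (`|y| + `|x|))).
    rewrite ler_wpM2l//; first by case/andP : t01 => /ltW.
    by rewrite (le_trans (ler_norm _))// lerDl.
  rewrite /t invfM mulrA mulfVK//.
  by move: d0; rewrite pmulr_rgt0// => /lt0r_neq0.
rewrite (ltr0_norm x0) in ty xx; lra.
Qed.

(** First variation at the minimizer: the energy of the mixture of [nu] and [Lam] with weights
    [1 - t] and [t] is at least [V], so its derivative at [t = 0] is nonnegative. The bound [e]
    keeps the quadratic term finite and is absent from the conclusion. *)
Lemma variation K nu V Lam (e x : R) : compact K -> minimizer K nu V ->
  positive_functional Lam -> Lam \1_(~` K) = 0 ->
  (forall M, energyM M (fun s => Lam (mon s)) (fun s => Lam (mon s)) <= e) ->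
  (forall M, energyM M (moment nu) (fun s => Lam (mon s)) <= x) ->
  V + ell nu + Lam (fun z => logh z * \1_K z) <= x.
Proof.
move=> cK mnu pL LK Le Lx; have [nuK nuV _] := mnu.
set l := Lam (fun z => logh z * \1_K z).
have nuE := energy_fin_mutual cK nuK nuV.
rewrite -subr_ge0 -(pmulr_rge0 _ (ltr0Sn R 1)).
(* The argument is the coefficient of [t ^+ 2] in the bound for the mixture. The goal was doubled to
   match the coefficient of [t]. *)
apply: (@small_quadratic _ (V + 2 * ell nu - 2 * x + e)) => t /andP[t0 t1].
pose Lt f := (1 - t) * \int[nu]_z f z + t * Lam f.
have t1' : 0 <= 1 - t by rewrite subr_ge0 ltW.
have pLt : positive_functional Lt.
  split; rewrite /Lt.
  - move=> f g bf bg; rewrite bmeas_intD// (functionalD pL)//; ring.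
  - move=> c f bf; rewrite bmeas_intZ// (functionalZ pL)//; ring.
  - move=> f bf f0; rewrite addr_ge0// mulr_ge0 ?(ltW t0)//.
      exact: bmeas_int_ge0.
    exact: (functional_ge0 pL).
  - by rewrite bmeas_int_cst (functional1 pL) !mulr1 subrK.
have mK := compact_measurableC cK.
have LtK : Lt \1_(~` K) = 0.
  rewrite /Lt LK mulr0 addr0 bmeas_int_indic; last exact: measurableC.
  by rewrite probability_setC// nuK subee//= mulr0.
have := functional_energy_ge cK mnu pLt LtK (e := (1 - t) ^+ 2 * (V + 2 * ell nu) +
  2 * t * (1 - t) * x + t ^+ 2 * e).
rewrite {3}/Lt -(ell_indic cK nuK) -/l => H.
have : V <= (1 - t) ^+ 2 * (V + 2 * ell nu) + 2 * t * (1 - t) * x + t ^+ 2 * e -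
  2 * ((1 - t) * ell nu + t * l).
  apply: H => M.
  rewrite /Lt energyMDl !energyMDr !energyMZl !energyMZr.
  rewrite (energyMC M (fun s => Lam (mon s)) (fun s => \int[nu]_z mon s z)).
  have e1 : energyM M (moment nu) (moment nu) <= V + 2 * ell nu.
    by rewrite -lee_fin -nuE energyM_le_mutual.
  have e2 := Lx M; have e3 := Le M.
  move: e1 e2 e3; rewrite /moment.
  move: (energyM M _ _) (energyM M _ _) (energyM M _ _) => p q r e1 e2 e3.
  have h1 : (1 - t) ^+ 2 * r <= (1 - t) ^+ 2 * (V + 2 * ell nu) by rewrite ler_wpM2l// sqr_ge0.
  have h2 : 2 * t * (1 - t) * q <= 2 * t * (1 - t) * x by rewrite ler_wpM2l// !mulr_ge0// ltW.
  have h3 : t ^+ 2 * p <= t ^+ 2 * e by rewrite ler_wpM2l// sqr_ge0.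
  lra.
by move=> HV; rewrite -(pmulr_rge0 _ t0); lra.
Qed.

(** The first variation in the direction of the normalized restriction of [mu] to [S], which has
    finite energy because [mu] has and the kernel is nonnegative. On average over [S], the potential
    of [nu] is thus no less than its equilibrium value [V + ell nu + logh z]. *)
Lemma variation_subset K nu V mu S (e x : R) : compact K -> minimizer K nu V ->
  measurable S -> S `<=` K -> (mutual mu mu <= e%:E)%E ->
  (\int[mu]_(z in S) spot nu z <= x%:E)%E ->
  (V + ell nu) * fine (mu S) + \int[mu]_z (logh z * \1_S z) <= x.
Proof.
move=> cK mnu mS SK mue nux; have bS : bmeas (\1_S : R[i] -> R) by exact: bmeas_indic.
have lS : (fun z => logh z * \1_S z) = (fun z => logh z * \1_K z * \1_S z).
  apply/funext => z; rewrite !indicE; have [zS|zS] := boolP (z \in S).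
    by rewrite (mem_set (SK _ (set_mem zS))) !mulr1.
  by rewrite !mulr0.
have bl := compact_bmeas cK (@logh_continuous R).
have int_S (g : R[i] -> R) : bmeas g -> (forall z, 0 <= g z) ->
    (\int[mu]_(z in S) (g z)%:E)%E = (\int[mu]_z (g z * \1_S z))%:E.
  move=> bg g0; rewrite -bmeas_int_fin; last exact: bmeasM.
  rewrite integral_mkcond; apply: eq_integral => z _; rewrite patchE indicE.
  by case: ifPn => _; rewrite ?mulr1 ?mulr0.
have mS0 : 0 <= fine (mu S) by exact: fine_ge0.
have [m0|m_neq0] := eqVneq (fine (mu S)) 0.
  rewrite m0 mulr0 add0r.
  have muS0 : mu S = 0%E by rewrite -(prob_fineK mu mS) m0.
  rewrite (_ : \int[mu]_z _ = 0).
    rewrite -lee_fin (le_trans _ nux)//; apply: integral_ge0 => z _.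
    exact: spot_ge0.
  rewrite -[RHS](bmeas_int_cst mu 0) /Rintegral; congr fine.
  apply: ae_eq_integral => //.
    by apply/measurable_EFinP; rewrite lS; case: (bmeasM bl bS).
  exists S; split=> // z /= nz; apply: contrapT => zS; apply: nz => _.
  by rewrite indicE memNset// mulr0.
have m_gt0 : 0 < fine (mu S) by rewrite lt_neqAle eq_sym m_neq0.
set m := fine (mu S) in m_neq0 m_gt0 mS0 *.
have minv : 0 <= m^-1 by rewrite invr_ge0.
pose Lam (f : R[i] -> R) := m^-1 * \int[mu]_z (f z * \1_S z).
have pL : positive_functional Lam.
  split; rewrite /Lam.
  - move=> f g bf bg; rewrite -mulrDr -bmeas_intD; [|exact: bmeasM..].
    by congr (_ * _); apply: eq_Rintegral => z _; rewrite mulrDl.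
  - move=> c f bf; rewrite mulrCA -(bmeas_intZ mu c); last exact: bmeasM.
    by congr (_ * _); apply: eq_Rintegral => z _; rewrite mulrA.
  - move=> f bf f0; rewrite mulr_ge0//; apply: bmeas_int_ge0 => z.
    by rewrite mulr_ge0// indicE.
  - under eq_Rintegral do rewrite mul1r.
    by rewrite bmeas_int_indic// mulVf.
have LK : Lam \1_(~` K) = 0.
  rewrite /Lam (_ : \int[mu]_z _ = 0) ?mulr0//.
  rewrite -[RHS](bmeas_int_cst mu 0); apply: eq_Rintegral => z _; rewrite !indicE.
  have [zS|_] := boolP (z \in S); last by rewrite mulr0.
  by rewrite memNset ?mul0r// => /=; apply; apply: SK; rewrite -inE.
have Lam_le f g : bmeas f -> bmeas g -> (forall z, f z <= g z) -> Lam f <= Lam g.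
  exact: functional_le.
have Lam_int f : bmeas f -> (forall z, 0 <= f z) -> Lam f <= m^-1 * \int[mu]_z f z.
  move=> bf f0; rewrite /Lam ler_wpM2l// bmeas_int_le//; first exact: bmeasM.
  by move=> z; rewrite indicE ler_piMr//; case: (_ \in _).
have H : V + ell nu + Lam (fun z => logh z * \1_K z) <= m^-1 * x.
  (* The self-energy contains the normalizing factor twice. *)
  apply: (variation (e := m^-1 * (m^-1 * e)) cK mnu pL LK).
    move=> M; rewrite -(functional_energyM _ _ pL).
    apply: (@le_trans _ _ (Lam (fun z => m^-1 * spotM mu M z))).
      apply: Lam_le; first exact: bmeas_energyM.
        by apply: bmeasZ; exact: bmeas_energyM.
      move=> z; rewrite energyMC -(functional_energyM _ _ pL) -int_kernM.
      under eq_fun do rewrite energyMC -kernM_energyM.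
      by apply: Lam_int; [exact: bmeas_kernM|move=> w; exact: kernM_ge0].
    rewrite (functionalZ pL); last exact: bmeas_energyM.
    rewrite ler_wpM2l//; apply: (le_trans (Lam_int _ _ _)).
    - exact: bmeas_energyM.
    - by move=> z; exact: spotM_ge0.
    - rewrite ler_wpM2l// int_spotM -lee_fin (le_trans _ mue)//.
      exact: energyM_le_mutual.
  move=> M; rewrite energyMC -(functional_energyM _ _ pL) /Lam ler_wpM2l//.
  rewrite -lee_fin -int_S; [|exact: bmeas_energyM|by move=> z; exact: spotM_ge0].
  apply: le_trans nux; apply: ge0_le_integral => //.
  - by move=> z _; rewrite lee_fin spotM_ge0.
  - by apply/measurable_EFinP/measurable_funTS; exact: measurable_spotM.
  - by apply/measurable_funTS; exact: measurable_spot.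
  - by move=> z _; exact: spotM_le.
rewrite -(ler_pM2l m_gt0) mulrA mulfV// mul1r in H.
apply: le_trans H; rewrite mulrDr [m * (V + _)]mulrC lerD2l lS.
by rewrite /Lam mulrA mulfV// mul1r.
Qed.

Lemma continuous_sum (I : Type) (s : seq I) (F : I -> R[i] -> R) :
  (forall i, continuous (F i)) -> continuous (fun z => \sum_(i <- s) F i z).
Proof.
move=> cF; elim: s => [|i s ih].
  by under eq_fun do rewrite big_nil; exact: cst_continuous.
under eq_fun do rewrite big_cons.
by move=> z; apply: (@cvgD _ _ _ (nbhs z)); [exact: cF|exact: ih].
Qed.

Lemma energyM_continuous M (a : seq 'I_6 -> R) :
  continuous (fun z : R[i] => energyM M (mon ^~ z) a).
Proof.
apply: continuous_sum => j z; apply: (@cvgM _ _ (nbhs z)); last exact: cvg_cst.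
apply: continuous_sum => s w.
by apply: (@cvgM _ _ (nbhs w)); [exact: mon_continuous|exact: cvg_cst].
Qed.

Lemma bmeas_logh_indic K S : compact K -> measurable S -> S `<=` K ->
  bmeas (fun z : R[i] => logh z * \1_S z).
Proof.
move=> cK mS SK; rewrite (_ : (fun z => _) = (fun z => logh z * \1_K z * \1_S z)).
  apply: bmeasM; first exact: (compact_bmeas cK (@logh_continuous R)).
  exact: bmeas_indic.
apply/funext => z; rewrite !indicE; have [zS|zS] := boolP (z \in S).
  by rewrite (mem_set (SK _ (set_mem zS))) !mulr1.
by rewrite !mulr0.
Qed.

(** By [variation_subset] the potential is on average at least its equilibrium value on every part
    of [K]. If it exceeded this value by [d] on a set of positive mass, the energy of [nu] would
    therefore exceed [V]. *)
Lemma frostman_ae K nu V : compact K -> minimizer K nu V ->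
  exists S, [/\ compact S, S `<=` K, nu S = 1%E &
    forall z, S z -> (spot nu z <= (V + ell nu + logh z)%:E)%E].
Proof.
move=> cK mnu; have [nuK nuV _] := mnu; have mK := compact_measurableC cK.
have nuE := energy_fin_mutual cK nuK nuV.
set kap := V + ell nu.
have clogh (c : R) : continuous (fun z : R[i] => c + logh z).
  by move=> z; apply: (@cvgD _ _ _ (nbhs z)); [exact: cvg_cst|exact: logh_continuous].
(* Truncated potentials are continuous, so these sets are closed. Intersecting them over all [M]
   gives a compact [S], although [spot nu] itself may be discontinuous. *)
pose C M (d : R) := [set z | spotM nu M z <= kap + d + logh z].
have cC M d : closed (C M d) by apply: closed_le_fun => //; exact: energyM_continuous.
have mC M d : measurable (C M d) by exact: closed_measurableC.
have null M (d : R) : 0 < d -> nu (K `\` C M d) = 0%E.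
  move=> d0; set S := K `\` C M d.
  have mS : measurable S by exact: measurableD.
  pose S' := K `\` S; have mS' : measurable S' by exact: measurableD.
  have SK : S `<=` K by exact: subDsetl.
  have KE : S `|` S' = K by rewrite setDUK.
  have bS (A : set R[i]) : measurable A -> bmeas (\1_A : R[i] -> R) by exact: bmeas_indic.
  have ab : (\int[nu]_(z in S) spot nu z + \int[nu]_(z in S') spot nu z <=
      (V + 2 * ell nu)%:E)%E.
    rewrite -ge0_integral_setU//.
    - rewrite -nuE KE; apply: ge0_subset_integral => //.
        exact: measurable_spot.
      by move=> z _; exact: spot_ge0.
    - by apply/measurable_funTS; exact: measurable_spot.
    - by move=> z _; exact: spot_ge0.
    - by apply/disj_setPS => z [? []].
  have a0 : (0 <= \int[nu]_(z in S) spot nu z)%E.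
    by apply: integral_ge0 => z _; exact: spot_ge0.
  have b0 : (0 <= \int[nu]_(z in S') spot nu z)%E.
    by apply: integral_ge0 => z _; exact: spot_ge0.
  have H1 : (((kap + d) * fine (nu S) + \int[nu]_z (logh z * \1_S z))%:E <=
      \int[nu]_(z in S) spot nu z)%E.
    have bl : bmeas (fun z => logh z * \1_S z).
      exact: (bmeas_logh_indic cK).
    rewrite -bmeas_int_indic// -bmeas_intZ; last exact: bS.
    rewrite -bmeas_intD//; last by apply: bmeasZ; exact: bS.
    rewrite -bmeas_int_fin; last by apply: bmeasD => //; apply: bmeasZ; exact: bS.
    apply: (@le_trans _ _ (\int[nu]_z (spotM nu M z * \1_S z)%:E)%E).
      have bM : bmeas (fun z => spotM nu M z * \1_S z).
        by apply: bmeasM; [exact: bmeas_energyM|exact: bS].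
      have bD : bmeas (fun z => (kap + d) * \1_S z + logh z * \1_S z).
        by apply: bmeasD => //; apply: bmeasZ; exact: bS.
      rewrite !bmeas_int_fin// lee_fin bmeas_int_le// => z.
      rewrite indicE; have [zS|_] := boolP (z \in S); last by rewrite !mulr0 addr0.
      rewrite !mulr1; have [_ /negP] := set_mem zS.
      by rewrite -ltNge => /ltW.
    rewrite [leRHS]integral_mkcond; apply: ge0_le_integral => //.
    - by move=> z _; rewrite lee_fin mulr_ge0 ?spotM_ge0// indicE.
    - apply/measurable_EFinP; apply: measurable_funM; first exact: measurable_spotM.
      exact: measurable_indic.
    - by apply/measurable_restrict => //; apply/measurable_funTS; exact: measurable_spot.
    - move=> z _; rewrite patchE indicE.
      by case: ifPn => _; rewrite ?mulr1 ?mulr0//; exact: spotM_le.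
  have [a' [b' [aE bE abV]]] : exists a' b', [/\ (\int[nu]_(z in S) spot nu z = a'%:E)%E,
      (\int[nu]_(z in S') spot nu z = b'%:E)%E & a' + b' <= V + 2 * ell nu].
    move: ab a0 b0; case: (\int[nu]_(z in S) _)%E => [a'| |] //.
      case: (\int[nu]_(z in S') _)%E => [b'| |] //; rewrite -EFinD lee_fin => *.
      by exists a', b'.
    by case: (\int[nu]_(z in S') _)%E.
  rewrite aE lee_fin in H1.
  have H2 : kap * fine (nu S') + \int[nu]_z (logh z * \1_S' z) <= b'.
    by apply: (variation_subset cK mnu mS' _ _ _ (e := V + 2 * ell nu));
      rewrite ?nuE ?bE//; exact: subDsetl.
  have H3 : fine (nu S) + fine (nu S') = 1.
    rewrite -fineD ?fin_num_measure// -measureU//; last by apply/seteqP; split=> z // [? []].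
    by rewrite KE; move: nuK; rewrite /= => ->.
  have H4 : \int[nu]_z (logh z * \1_S z) + \int[nu]_z (logh z * \1_S' z) = ell nu.
    rewrite (ell_indic cK nuK) -bmeas_intD.
    - apply: eq_Rintegral => z _; rewrite -mulrDr -KE; congr (_ * _).
      rewrite !indicE in_setU; have [zS|zS] := boolP (z \in S); last by rewrite add0r.
      by rewrite /= memNset ?addr0// => -[_]; apply; exact: set_mem.
    - exact: (bmeas_logh_indic cK).
    - by apply: (bmeas_logh_indic cK) => //; exact: subDsetl.
  have S0 : fine (nu S) <= 0.
    have : d * fine (nu S) <= 0.
      by move: H1 H2 H3 H4 abV; rewrite /kap; nra.
    by rewrite pmulr_rle0.
  by apply/eqP; rewrite -(prob_fineK nu mS) eqe eq_le S0 fine_ge0.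
pose S := K `&` \bigcap_M C M 0.
have cS : closed S.
  by apply: closedI; [exact: compact_closedC|apply: closed_bigI => M _; exact: cC].
have mS := closed_measurableC cS.
exists S; split.
- by apply: (subclosed_compact cS cK) => z [].
- by move=> z [].
- have mU : measurable (\bigcup_M \bigcup_k (K `\` C M k.+1%:R^-1)).
    by do 2 apply: bigcupT_measurable => ?; exact: measurableD.
  have nU : nu (\bigcup_M \bigcup_k (K `\` C M k.+1%:R^-1)) = 0%E.
    apply: measure_negligible => //; apply: negligible_bigcup => M.
    apply: negligible_bigcup => k; apply/negligibleP; first exact: measurableD.
    by apply: null; rewrite invr_gt0.
  apply/eqP; rewrite eq_le probability_le1//= -nuK.
  set U := \bigcup_M _ in mU nU.
  apply: (@le_trans _ _ (nu (S `|` U))).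
    apply: le_measure; rewrite ?inE//; first exact: measurableU.
    move=> z Kz; have [?|nUz] := pselect (U z); first by right.
    left; split=> // M _; rewrite /C/= addr0; apply/ler_addgt0Pr => e e0.
    have [k ke] : exists k, 0 + k.+1%:R^-1 < e by exact: ltr_add_invr.
    rewrite add0r in ke; have : C M k.+1%:R^-1 z.
      by apply: contrapT => nC; apply: nUz; exists M => //; exists k.
    rewrite /C/= => /le_trans; apply; rewrite addrAC lerD2l; exact: ltW.
  by rewrite (le_trans (measureU2 _ _ _))// [X in (_ + X)%E]nU adde0.
move=> z [Kz H]; rewrite -(cvg_lim _ (@spot_cvg _ nu z))//; apply: lime_le.
  by apply/cvg_ex; eexists; exact: spot_cvg.
by apply: nearW => M; rewrite lee_fin (le_trans (H M I))// addr0.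
Qed.

End equilibrium.

Lemma prod_unity_roots (R : realType) (N : nat) : (0 < N)%N -> exists rs : seq R[i],
  [/\ size rs = N, (1 : R[i]) \in rs, forall x, x \in rs -> modulus x = 1 &
    forall t : R[i], \prod_(x <- rs) (t - x) = t ^+ N - 1].
Proof.
move=> N0; have [rs rsE] := closed_field_poly_normal ('X^N - 1%:P : {poly R[i]}).
rewrite lead_coefXnsubC// scale1r in rsE.
have rsP x : (x \in rs) = (x ^+ N == 1).
  rewrite -root_prod_XsubC -rsE rootE !hornerE subr_eq0//.
exists rs; split.
- by apply: succn_inj; rewrite -(size_prod_XsubC rs idfun) -rsE size_XnsubC.
- by rewrite rsP expr1n.
- move=> x; rewrite rsP => /eqP/(congr1 (fun y => modulus y)).
  rewrite modulusX Normc.normc1 => /eqP; rewrite -[X in _ == X](expr1n _ N).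
  by rewrite eqrXn2 ?modulus_ge0// => /eqP.
- move=> t; rewrite -[RHS]/(t ^+ N - 1).
  have := congr1 (fun p => p.[t]) rsE; rewrite !hornerE => ->.
  by rewrite horner_prod; apply: eq_bigr => x _; rewrite !hornerE.
Qed.

(** * The maximum principle *)

Section maximum_principle.
Context (R : realType) (nu : probability R[i] R) (S : set R[i]).
Hypotheses (cS : compact S) (nuS : nu S = 1%E).
Implicit Types (z w : R[i]) (r : R).

Let mS : measurable S := compact_measurableC cS.

Lemma ln_lip r (a b : R) : 0 < r -> r <= a -> r <= b -> ln b - ln a <= `|b - a| / r.
Proof.
move=> r0 ra rb; have a0 := lt_le_trans r0 ra; have b0 := lt_le_trans r0 rb.
rewrite -ln_div ?posrE// (_ : b / a = 1 + (b - a) / a); last first.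
  by rewrite mulrBl mulfV ?gt_eqF// addrC subrK.
apply: le_trans (le_ln1Dx _) _.
  by rewrite mulrBl mulfV ?gt_eqF// ltrBrDl subrr divr_gt0.
apply: (@le_trans _ _ (`|b - a| / a)).
  by rewrite ler_wpM2r ?invr_ge0 ?(ltW a0)// ler_norm.
by rewrite ler_wpM2l// lef_pV2.
Qed.

Lemma support_neq0 : S !=set0.
Proof.
apply: contrapT => S0; move: nuS; rewrite (_ : S = set0) ?measure0.
  by move=> /eqP; rewrite eq_sym onee_eq0.
by apply/seteqP; split=> // z Sz; apply: S0; exists z.
Qed.

(* The logarithm is cut off below at [ln r], so that [potr r] agrees with the
   potential at distance at least [r] from [S] and is Lipschitz everywhere. *)
Definition logr r z w : R := ln (Num.max r (modulus (z - w))) * \1_S w.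

Definition potr r z : R := - \int[nu]_w logr r z w.

Lemma ln_max_lip r (a b : R) : 0 < r ->
  `|ln (Num.max r a) - ln (Num.max r b)| <= `|a - b| / r.
Proof.
move=> r0; have ml : `|Num.max r a - Num.max r b| <= `|a - b|.
  have n1 := ler_norm (a - b); have n2 := ler_norm (b - a).
  rewrite distrC in n2; rewrite ler_norml !maxEle.
  by apply/andP; split; case: ifPn; case: ifPn; rewrite -?ltNge => h1 h2; lra.
apply: (@le_trans _ _ (`|Num.max r a - Num.max r b| / r)); last first.
  by rewrite ler_wpM2r// invr_ge0 ltW.
rewrite ler_norml lerNl opprB {1}distrC.
by rewrite !ln_lip ?le_max ?lexx.
Qed.

Lemma logr_lip r z z' w : 0 < r ->
  `|ln (Num.max r (modulus (z - w))) - ln (Num.max r (modulus (z' - w)))| <=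
  modulus (z - z') / r.
Proof.
move=> r0; apply: le_trans (ln_max_lip _ _ r0) _.
rewrite ler_wpM2r ?invr_ge0 ?(ltW r0)// (le_trans (modulus_lip _ _))//.
by rewrite (_ : z - w - (z' - w) = z - z')//; ring.
Qed.

Lemma bmeas_logr r z : 0 < r -> bmeas (logr r z).
Proof.
move=> r0; apply: (compact_bmeas cS).
apply: (@lipschitz_continuous _ _ r^-1) => w w'.
rewrite [leRHS]mulrC (le_trans (ln_max_lip _ _ r0))//.
rewrite ler_wpM2r ?invr_ge0 ?(ltW r0)// (le_trans (modulus_lip _ _))//.
by rewrite modulusB (_ : z - w' - (z - w) = w - w')//; ring.
Qed.

Lemma potr_lip r z z' : 0 < r -> `|potr r z - potr r z'| <= r^-1 * modulus (z - z').
Proof.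
move=> r0; rewrite /potr -opprD normrN -bmeas_intB; try exact: bmeas_logr.
rewrite mulrC -[leRHS]addr0 -[X in _ + X](bmeas_int_cst nu).
apply: (functional_norm_le (integral_functional nu)).
- by apply: bmeasB; exact: bmeas_logr.
- exact: bmeas_cst.
move=> w; rewrite addr0 /logr -mulrBl normrM indicE.
case: (_ \in _); rewrite ?normr0 ?mulr0 ?normr1 ?mulr1; first exact: logr_lip.
by rewrite divr_ge0 ?modulus_ge0 ?ltW.
Qed.

Lemma potr_continuous r : 0 < r -> continuous (potr r).
Proof. by move=> r0; apply: lipschitz_continuous => z w; exact: potr_lip. Qed.

Lemma potential_potr r z : 0 < r -> (forall w, S w -> r <= modulus (z - w)) ->
  potential nu z = (potr r z)%:E.
Proof.
move=> r0 zr; have bl := bmeas_logr z r0.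
rewrite /potr -mulN1r -bmeas_intZ// -bmeas_int_fin; last exact: bmeasZ.
apply: ae_eq_integral => //; first exact: measurable_logpot.
  by apply/measurable_EFinP; case: (bmeasZ (-1) bl).
apply: (prob_ae mS nuS) => w Sw _.
have zw := zr _ Sw; rewrite lne_EFin ?(lt_le_trans r0)// mulN1r EFinN.
by rewrite /logr indicE mem_set// mulr1 (elimT max_idPr).
Qed.

Lemma potr_infty (V : R) : exists R0 : R, forall r z, 0 < r ->
  R0 < modulus z -> potr r z <= V.
Proof.
have [M M0 SM] := compact_modulus_le cS.
(* Beyond this radius every [w] in [S] is at distance more than [expR (- V)], whatever the cutoff
   [r]. *)
exists (M + expR (- V)) => r z r0 zR.
have -> : V = - \int[nu]_w (- V * \1_S w).
  rewrite bmeas_intZ; last exact: bmeas_indic.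
  by rewrite bmeas_int_indic//; move: nuS => /= ->; rewrite mulr1 opprK.
rewrite /potr lerN2; apply: bmeas_int_le; last first.
- move=> w; rewrite /logr indicE.
  have [/set_mem Sw|_] := boolP (w \in S); last by rewrite !mulr0.
  rewrite !mulr1 -[leLHS]expRK.
  have H : expR (- V) < modulus (z - w).
    by have := ler_modulusB z w; have := SM w Sw; lra.
  by rewrite ler_ln ?posrE ?expR_gt0 ?lt_max ?r0// le_max (ltW H) orbT.
- exact: bmeas_logr.
- by apply: bmeasZ; exact: bmeas_indic.
Qed.

(* The circle average is replaced by the average over N-th roots of unity, whose
   product formula turns the mean value property into an elementary estimate. *)
Lemma discrete_mean (N : nat) r z c : (0 < N)%N -> 0 < r -> c != 0 ->
  (forall w, S w -> 2 * modulus c <= modulus (z - w)) -> r <= modulus c ->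
  exists rs : seq R[i], [/\ size rs = N, (1 : R[i]) \in rs,
    forall x, x \in rs -> modulus x = 1 &
    N%:R * potr r z - 2^-1 ^+ N <= \sum_(x <- rs) potr r (z + c * x)].
Proof.
move=> N0 r0 c0 zc rc; have [rs [srs rs1 rsm rsp]] := prod_unity_roots R N0.
exists rs; split=> //.
rewrite /potr sumrN mulrN -opprD lerN2 -bmeas_int_sum; last by move=> x; exact: bmeas_logr.
rewrite -bmeas_intZ; last exact: bmeas_logr.
rewrite -[2^-1 ^+ N](bmeas_int_cst nu) -bmeas_intD; last 2 first.
- by apply: bmeasZ; exact: bmeas_logr.
- exact: bmeas_cst.
apply: bmeas_int_le.
- by apply: bmeas_sum => x; exact: bmeas_logr.
- by apply: bmeasD; [apply: bmeasZ; exact: bmeas_logr|exact: bmeas_cst].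
move=> w; rewrite /logr -mulr_suml indicE.
have [/set_mem Sw|_] := boolP (w \in S); last by rewrite !mulr0 add0r exprn_ge0.
rewrite !mulr1; have zw := zc _ Sw; have c1 : 0 < modulus c by rewrite modulus_gt0.
have zw0 : 0 < modulus (z - w) by rewrite (lt_le_trans _ zw)// mulr_gt0.
have zxw x : x \in rs -> modulus c <= modulus (z + c * x - w).
  move=> xr; have : modulus (z - w) <= modulus (z + c * x - w) + modulus c.
    have -> : modulus c = modulus (- (c * x)) by rewrite normcN Normc.normcM (rsm x xr) mulr1.
    by rewrite (_ : z - w = (z + c * x - w) + - (c * x)) ?le_normcD//; ring.
  by lra.
rewrite (eq_big_seq (fun x => ln (modulus (z + c * x - w)))); last first.
  by move=> x xr; rewrite (elimT max_idPr)// (le_trans rc)// zxw.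
rewrite (elimT max_idPr); last by rewrite (le_trans rc)//; lra.
have pos : 0 < \prod_(x <- rs) modulus (z + c * x - w).
  by rewrite big_seq; apply: prodr_gt0 => x xr; rewrite (lt_le_trans c1)// zxw.
have -> : \sum_(x <- rs) ln (modulus (z + c * x - w)) =
    ln (\prod_(x <- rs) modulus (z + c * x - w)).
  have : forall x, x \in rs -> 0 < modulus (z + c * x - w).
    by move=> x xr; rewrite (lt_le_trans c1)// zxw.
  elim: rs {pos srs rs1 rsm rsp zxw} => [|x s ih] H; first by rewrite !big_nil ln1.
  rewrite !big_cons lnM ?posrE ?H ?mem_head//.
    by rewrite ih// => y ys; apply: H; rewrite inE ys orbT.
  rewrite big_seq; apply: prodr_gt0 => y ys; apply: H; rewrite inE ys orbT//.
have prodE : \prod_(x <- rs) modulus (z + c * x - w) =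
    modulus c ^+ N * modulus (((w - z) / c) ^+ N - 1).
  rewrite -rsp -srs; elim: rs {pos srs rs1 rsm rsp zxw} => [|x s ih].
    by rewrite !big_nil expr0 Normc.normc1 mulr1.
  rewrite !big_cons ih exprS Normc.normcM mulrACA -Normc.normcM; congr (_ * _).
  rewrite -normcN; congr (modulus _); field.
  exact: c0.
rewrite prodE in pos *.
have tN : modulus (((w - z) / c) ^+ N - 1) <= (modulus (z - w) / modulus c) ^+ N + 1.
  rewrite (le_trans (le_normcD _ _))// normcN Normc.normc1 lerD2r modulusX.
  by rewrite Normc.normcM Normc.normcV modulusB.
have zwN : 0 < modulus (z - w) ^+ N by rewrite exprn_gt0.
apply: (@le_trans _ _ (ln (modulus (z - w) ^+ N * (1 + (modulus c / modulus (z - w)) ^+ N)))).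
  rewrite ler_ln ?posrE.
  - apply: (le_trans (ler_wpM2l _ tN)); first by rewrite exprn_ge0// ltW.
    rewrite !mulrDr !mulr1 -!exprMn mulrC divfK ?gt_eqF// mulrCA mulfV ?gt_eqF// mulr1.
    by rewrite addrC.
  - exact: pos.
  - by rewrite mulr_gt0// ltr_pwDl// exprn_ge0// divr_ge0 ?modulus_ge0.
(* The centre is at distance at least [2 * modulus c] from [S], whence one half; its power [N] is
   the error committed by the whole sum of [N] terms. *)
have q2 : modulus c / modulus (z - w) <= 2^-1 by rewrite ler_pdivrMr//; lra.
have q0 : 0 <= modulus c / modulus (z - w) by rewrite divr_ge0 ?modulus_ge0.
rewrite lnM ?posrE//; last by rewrite ltr_pwDl// exprn_ge0.
rewrite lnXn// -[ln _ *+ N]mulr_natl lerD2l; apply: le_trans (le_ln1Dx _) _.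
  by rewrite (lt_le_trans (ltrN10 _))// exprn_ge0.
by rewrite lerXn2r ?nnegrE ?invr_ge0.
Qed.

Lemma spot_on_support z : spot nu z = (\int[nu]_(w in S) kern z w)%E.
Proof.
rewrite /spot (ge0_negligible_integral (N := ~` S))//.
- by rewrite setTD setCK.
- exact: measurableC.
- exact: measurable_kern.
- by move=> w _; exact: kern_ge0.
- by apply: etrans (probability_setC nu mS) _; rewrite nuS subee.
Qed.

(** Written with sums on both sides because either potential may be infinite. The kernels are
    compared on [S], where [nu] lives. *)
Lemma spot_compare z z' (h : R[i] -> R) : bmeas h -> (forall w, 0 <= h w) ->
  (forall w, S w -> (kern z w + (logh z')%:E <= kern z' w + (logh z + h w)%:E)%E) ->
  (spot nu z + (logh z')%:E <= spot nu z' + (logh z + \int[nu]_w h w)%:E)%E.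
Proof.
move=> bh h0 H.
have mk u : measurable_fun S (kern u) by apply/measurable_funTS; exact: measurable_kern.
have cE (c : R) : (\int[nu]_(w in S) c%:E = c%:E)%E.
  by rewrite integral_cst//=; move: nuS => /= ->; rewrite mule1.
have hS : (\int[nu]_(w in S) (h w)%:E <= (\int[nu]_w h w)%:E)%E.
  rewrite -bmeas_int_fin//; apply: ge0_subset_integral => //.
    by apply/measurable_EFinP; case: bh.
  by move=> w _; rewrite lee_fin.
rewrite !spot_on_support -(cE (logh z')) -ge0_integralD//; last 2 first.
- by move=> w _; exact: kern_ge0.
- by move=> w _; rewrite lee_fin logh_ge0.
have mh : measurable_fun S (fun w => (logh z + h w)%:E).
  by apply/measurable_funTS/measurable_EFinP; apply: measurable_funD => //; case: bh.
apply: (@le_trans _ _ (\int[nu]_(w in S) (kern z' w + (logh z + h w)%:E))%E).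
  apply: ge0_le_integral => //.
  - by move=> w _; rewrite adde_ge0 ?kern_ge0// lee_fin logh_ge0.
  - by apply: emeasurable_funD.
  - by apply: emeasurable_funD.
rewrite ge0_integralD//.
- rewrite leeD2l//; under eq_integral do rewrite EFinD.
  rewrite ge0_integralD//.
  + by rewrite cE EFinD leeD2l.
  + by move=> w _; rewrite lee_fin logh_ge0.
  + by move=> w _; rewrite lee_fin.
  + by apply/measurable_funTS/measurable_EFinP; case: bh.
- by move=> w _; exact: kern_ge0.
- by move=> w _; rewrite lee_fin addr_ge0// logh_ge0.
Qed.

Variable V : R.
Hypothesis spotS : forall z, S z -> (spot nu z <= (V + ell nu + logh z)%:E)%E.

Let mball z r : measurable [set w | modulus (z - w) < r].
Proof.
apply: open_measurableC; apply/open_modulusP => w /= zw.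
exists (r - modulus (z - w)); first by rewrite subr_gt0.
by move=> u; rewrite ltrBrDl; apply: le_lt_trans; exact: modulus_triangle.
Qed.

(** On the disc of radius [r] about [z] the kernel is at least [- ln r], so boundedness of the
    potential on [S] forces small discs to have small mass, uniformly in the centre. *)
Lemma ball_mass : exists C : R, forall z r, S z -> 0 < r < 1 ->
  fine (nu [set w | modulus (z - w) < r]) * (- ln r) <= C.
Proof.
have [C0 C0P] := compact_logh_le cS.
exists (V + ell nu + C0) => z r Sz /andP[r0 r1].
have lnr : 0 <= - ln r by rewrite oppr_ge0 ln_le0// ltW.
rewrite -lee_fin; apply: (@le_trans _ _ (V + ell nu + logh z)%:E); last first.
  by rewrite lee_fin lerD2l; have := C0P z; rewrite indicE mem_set// mulr1.
apply: le_trans (spotS Sz); rewrite mulrC -bmeas_int_indic//.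
rewrite -bmeas_intZ; last exact: bmeas_indic.
rewrite -bmeas_int_fin; last by apply: bmeasZ; exact: bmeas_indic.
apply: ge0_le_integral => //.
- by move=> w _; rewrite lee_fin mulr_ge0// indicE.
- by apply/measurable_EFinP; apply: measurable_funM => //; exact: measurable_indic.
- exact: measurable_kern.
move=> w _; rewrite indicE; have [/set_mem /= zw|_] := boolP (_ \in _); last first.
  by rewrite mulr0 kern_ge0.
rewrite mulr1; have [<-|nzw] := eqVneq z w.
  by rewrite /kern subrr Normc.normc0 le0_lneNy//= leey.
rewrite kernE// lee_fin -[leLHS]add0r lerD ?addr_ge0 ?logh_ge0// lerN2.
have zw0 : 0 < modulus (z - w) by rewrite modulus_gt0 subr_eq0.
by rewrite ler_ln ?posrE// ltW.
Qed.

(* Comparison with the nearest point [z'] of [S]: since [|z' - w| <= 2 |z - w|], the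
   logarithms differ by [ln 2] on a small ball and by little outside of it. *)
Lemma potr_near (e : R) : 0 < e -> exists2 rho : R, 0 < rho & forall r z, 0 < r ->
  (forall w, S w -> r <= modulus (z - w)) ->
  (exists2 w, S w & modulus (z - w) < rho) -> potr r z <= V + e.
Proof.
move=> e0; have [C CP] := ball_mass.
have e2 : 0 < e / 2 by rewrite divr_gt0.
have ln20 : 0 < ln (2 : R) by rewrite ln_gt0// ltr1n.
(* Chosen so that [ball_mass] bounds the mass of a disc of radius [r0] by [(e / 2) / ln 2]; a
   difference of [ln 2] inside the disc then costs at most [e / 2]. *)
pose r0 : R := expR (- (`|C| + 1) * ln 2 / (e / 2)).
have r0_gt0 : 0 < r0 by exact: expR_gt0.
have C1 : 0 < `|C| + 1 by rewrite ltr_wpDl.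
have lnr0 : - ln r0 = (`|C| + 1) * ln 2 / (e / 2) by rewrite expRK !mulNr opprK.
have lnr0_gt0 : 0 < - ln r0 by rewrite lnr0 divr_gt0// mulr_gt0.
have r0_lt1 : r0 < 1 by rewrite -ltr_ln ?posrE// ln1 -oppr_gt0.
(* The first bound keeps [z] at distance at least [r0 / 2] from the points of [S] outside the disc;
   the second makes the logarithms there differ by at most [e / 2]. *)
pose rho := Num.min (r0 / 2) (r0 / 2 * (e / 2)).
have rho0 : 0 < rho by rewrite lt_min divr_gt0// mulr_gt0// divr_gt0.
exists rho => // r z r_gt0 zr [w0 Sw0 zw0].
have [z' Sz' z'P] := compact_nearest z cS (ex_intro _ w0 Sw0).
have zz' : modulus (z - z') < rho by apply: le_lt_trans (z'P _ Sw0) zw0.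
have zz'r0 : modulus (z - z') < r0 / 2 by apply: lt_le_trans zz' _; rewrite ge_min lexx.
have zz're : modulus (z - z') < r0 / 2 * (e / 2).
  by apply: lt_le_trans zz' _; rewrite ge_min lexx orbT.
pose B := [set w | modulus (z' - w) < r0].
pose h w : R := ln 2 * \1_B w + e / 2.
have mB : measurable B by exact: mball.
have bB := bmeas_indic R mB.
have bh : bmeas h by apply: bmeasD; [exact: bmeasZ|exact: bmeas_cst].
have h0 w : 0 <= h w by rewrite addr_ge0 ?(ltW e2)// mulr_ge0 ?(ltW ln20)// indicE.
have inth : \int[nu]_w h w <= e.
  rewrite bmeas_intD; [|exact: bmeasZ|exact: bmeas_cst].
  rewrite bmeas_intZ// bmeas_int_indic//.
  rewrite bmeas_int_cst [leRHS]splitr lerD2r.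
  have := CP z' r0 Sz'; rewrite r0_gt0 r0_lt1 lnr0 => /(_ isT) H.
  have m0 : 0 <= fine (nu B) by exact: fine_ge0.
  have H2 : fine (nu B) * ((`|C| + 1) * ln 2 / (e / 2)) <= `|C| + 1.
    by rewrite (le_trans H)// (le_trans (ler_norm _))// lerDl.
  rewrite !mulrA ler_pdivrMr// -mulrA in H2.
  by rewrite mulrCA ler_pM2l// in H2; rewrite mulrC.
have key : (spot nu z + (logh z')%:E <= spot nu z' + (logh z + \int[nu]_w h w)%:E)%E.
  apply: spot_compare => // w Sw.
  have zw : 0 < modulus (z - w) by rewrite (lt_le_trans r_gt0)// zr.
  have nzw : z != w by rewrite -subr_eq0 -modulus_gt0.
  rewrite (kernE nzw).
  have [<-|nz'w] := eqVneq z' w.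
    by rewrite [X in (_ <= X + _)%E]/kern subrr Normc.normc0 le0_lneNy//= leey.
  have z'w : 0 < modulus (z' - w) by rewrite modulus_gt0 subr_eq0.
  rewrite kernE// -!EFinD lee_fin.
  suff : ln (modulus (z' - w)) - ln (modulus (z - w)) <= h w by lra.
  have tri : modulus (z' - w) <= modulus (z - z') + modulus (z - w).
    by rewrite (modulusB z z') modulus_triangle.
  rewrite -ln_div ?posrE// /h indicE; have [_|wB] := boolP (w \in B).
    rewrite mulr1 ler_wpDr ?(ltW e2)// ler_ln ?posrE ?divr_gt0//.
    rewrite ler_pdivrMr// (le_trans tri)// mulr2n mulrDl mul1r lerD2r.
    exact: z'P.
  have r0z'w : r0 <= modulus (z' - w).
    by rewrite leNgt; apply/negP => zwr; move/negP : wB; apply; rewrite inE.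
  rewrite mulr0 add0r (_ : _ / _ = 1 + (modulus (z' - w) - modulus (z - w)) / modulus (z - w)); last first.
    by rewrite mulrBl mulfV ?gt_eqF// [RHS]addrC subrK.
  apply: le_trans (le_ln1Dx _) _.
    by rewrite mulrBl mulfV ?gt_eqF// ltrBrDl subrr divr_gt0.
  rewrite ler_pdivrMr// (@le_trans _ _ (modulus (z - z')))//; first by lra.
  apply: (le_trans (ltW zz're)); rewrite mulrC ler_wpM2l ?(ltW e2)//; lra.
rewrite -lee_fin -(potential_potr r_gt0 zr) (potentialE _ cS nuS).
move: key; have := spotS Sz'; have := spot_ge0 nu z'; have := spot_ge0 nu z.
case: (spot nu z) => [a| |] //; case: (spot nu z') => [b| |] // _ _.
by rewrite -!EFinD !lee_fin; lra.
Qed.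

(** If the potential exceeded [V] off [S], then by [potr_near] and [potr_infty] it would attain a
    maximum on a compact set away from [S]. At the maximum point nearest to [S], the mean value
    property propagates the maximum to a point moved towards [S], which is nearer still. *)
Lemma maximum_principle z : (potential nu z <= V%:E)%E.
Proof.
have [Sz|nSz] := pselect (S z).
  by rewrite (potentialE _ cS nuS) leeBlDr// -EFinD (le_trans (spotS Sz))// lee_fin; lra.
rewrite leNgt; apply/negP => Vz.
have near u : exists w, S w /\ forall w', S w' -> modulus (u - w) <= modulus (u - w').
  by have [w Sw wP] := compact_nearest u cS support_neq0; exists w.
have [pr prP] := choice near.
pose dist u := modulus (u - pr u).
have dist_le u w : S w -> dist u <= modulus (u - w) by have [_] := prP u; apply.
have dist_lip u v : `|dist u - dist v| <= 1 * modulus (u - v).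
  have H a b : dist a <= dist b + modulus (a - b).
    have [Sb _] := prP b; apply: (le_trans (dist_le a _ Sb)).
    by rewrite [leRHS]addrC; exact: modulus_triangle.
  have h1 := H u v; have h2 := H v u; rewrite modulusB in h2.
  by rewrite mul1r ler_norml; apply/andP; split; lra.
have dist_cont := lipschitz_continuous dist_lip.
have dist0 u : ~ S u -> 0 < dist u.
  move=> nSu; rewrite modulus_gt0 subr_eq0; apply/eqP => uE; apply: nSu.
  by rewrite uE; have [] := prP u.
have dz0 := dist0 z nSz.
have potz := potential_potr dz0 (dist_le z).
rewrite potz lte_fin in Vz.
pose e := (potr (dist z) z - V) / 2.
have e0 : 0 < e by rewrite divr_gt0// subr_gt0.
have [rho rho0 rhoP] := potr_near e0.
have [R0 R0P] := potr_infty V.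
have r20 : 0 < rho / 2 by rewrite divr_gt0.
pose P u := potr (rho / 2) u.
have PE u r : 0 < r -> r <= dist u -> rho / 2 <= dist u -> P u = potr r u.
  move=> r0 ru rhou; apply: EFin_inj.
  by rewrite -!potential_potr// => w /(dist_le u); [exact: le_trans|exact: le_trans].
pose R1 := Num.max R0 (modulus z).
pose T := [set u | rho <= dist u] `&` [set u | modulus u <= R1].
have cT : compact T.
  apply: (@bounded_closed_compactC _ _ R1); last by move=> u [].
  apply: closedI; apply: closed_le_fun => //; try exact: cst_continuous.
  exact: continuous_modulus.
have outT u : rho / 2 <= dist u -> ~ T u -> P u <= V + e.
  move=> du nTu; have [h1|h1] := leP rho (dist u).
    have h2 : R0 < modulus u.
      rewrite ltNge; apply/negP => h2; apply: nTu; split=> //=.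
      by rewrite le_max h2.
    by rewrite (le_trans (R0P _ _ r20 h2))// lerDl ltW.
  apply: rhoP => //; first by move=> w /(dist_le u); exact: le_trans.
  by exists (pr u) => //; have [] := prP u.
have Tz : T z.
  split=> /=; last by rewrite le_max lexx orbT.
  rewrite leNgt; apply/negP => h1.
  have : potr (dist z) z <= V + e.
    apply: rhoP => //; first exact: dist_le.
    by exists (pr z) => //; have [] := prP z.
  by rewrite /e; lra.
have Pcont := potr_continuous r20.
have [z0 z0T z0P] := compact_EVT_max (ex_intro _ z Tz) cT (continuous_subspaceT Pcont).
have mV : V + e < P z0.
  apply: (@lt_le_trans _ _ (P z)); last by apply: z0P; rewrite inE.
  rewrite (PE z (dist z))//; first by rewrite /e; lra.
  by case: Tz => /= h _; lra.
have Pmax u : rho / 2 <= dist u -> P u <= P z0.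
  move=> du; have [Tu|nTu] := pselect (T u); first by apply: z0P; rewrite inE.
  by rewrite (le_trans (outT u du nTu))// ltW.
pose T' := T `&` [set u | P z0 <= P u].
have cT' : compact T'.
  apply: (subclosed_compact _ cT); last by move=> u [].
  apply: closedI; first exact: compact_closedC.
  by apply: closed_le_fun => //; exact: cst_continuous.
have T'z0 : T' z0 by split=> //=; exact: set_mem.
have [z1 z1T z1P] := compact_EVT_min (ex_intro _ z0 T'z0) cT' (continuous_subspaceT dist_cont).
have [[/= dz1 Rz1] Pz1] := set_mem z1T.
have d1 : 0 < dist z1 by apply: lt_le_trans dz1.
(* A displacement of length [rho / 2] towards the point of [S] nearest to [z1]. As [z1] is at
   distance at least [rho], the whole circle stays at distance at least [rho / 2] from [S]. *)
pose c : R[i] := (rho / 2 / dist z1)%:C%C * (pr z1 - z1).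
have mc : modulus c = rho / 2.
  rewrite /c Normc.normcM (modulusB (pr z1)) -/(dist z1) /= expr0n/= addr0 sqrtr_sqr.
  by rewrite ger0_norm ?divfK ?gt_eqF// divr_ge0// ltW.
have c0 : c != 0 by rewrite -modulus_gt0 mc.
have dc (x : R[i]) : modulus x = 1 -> rho / 2 <= dist (z1 + c * x).
  move=> x1; have := dist_lip z1 (z1 + c * x); rewrite mul1r.
  rewrite (_ : z1 - (z1 + c * x) = - (c * x)); last by ring.
  rewrite normcN Normc.normcM x1 mulr1 mc => /(le_trans (ler_norm _)); lra.
(* The roots of unity depend on [N], but 1 is always among them. The other points of the circle are
   bounded by the maximum, which isolates the value at [z1 + c]. *)
have mean N : (0 < N)%N -> P z0 - 2^-1 ^+ N <= P (z1 + c).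
  move=> N0.
  have [||rs [srs rs1 rsm rsP]] := @discrete_mean N (rho / 2) z1 c N0 r20 c0.
  - move=> w Sw; rewrite mc; apply: le_trans (dist_le z1 w Sw); lra.
  - by rewrite mc.
  move: rsP; rewrite (perm_big _ (perm_to_rem rs1)) big_cons mulr1.
  have : \sum_(x <- rem 1 rs) potr (rho / 2) (z1 + c * x) <= N.-1%:R * P z0.
    have := size_rem rs1; rewrite srs => <-.
    have : {subset rem 1 rs <= rs} by exact: mem_rem.
    elim: (rem 1 rs) => [|x s ih] H; first by rewrite big_nil mul0r.
    rewrite big_cons -[size (x :: s)]/(size s).+1 -[(size s).+1%:R]natr1 mulrDl mul1r [leRHS]addrC lerD ?ih//.
      by apply: Pmax; apply: dc; apply: rsm; apply: H; rewrite mem_head.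
    by move=> y ys; apply: H; rewrite inE ys orbT.
  move=> h1 h2; have h3 : N%:R * P z0 - 2^-1 ^+ N <= P (z1 + c) + N.-1%:R * P z0.
    apply: (le_trans _ (le_trans h2 _)); last by rewrite lerD2l.
    by rewrite lerD2r ler_wpM2l.
  have NE : N%:R = N.-1%:R + 1 :> R by rewrite natr1 prednK.
  by rewrite NE in h3; lra.
have Pc : P z0 <= P (z1 + c).
  have cv : P z0 - 2^-1 ^+ N.+1 @[N --> \oo] --> P z0 - 0.
    apply: cvgB; first exact: cvg_cst.
    rewrite cvg_shiftS; apply: cvg_expr.
    by rewrite ger0_norm// invf_lt1// ltr1n.
  rewrite subr0 in cv; apply: (cvgr_to_le cv); apply: nearW => N; exact: mean.
have dcc : rho / 2 <= dist (z1 + c).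
  by have := dc 1; rewrite mulr1; apply; exact: Normc.normc1.
have T'c : T' (z1 + c).
  split=> //; apply: contrapT => /(outT _ dcc); lra.
have := z1P (z1 + c) (mem_set T'c); apply/negP; rewrite -ltNge.
have [Sp _] := prP z1; apply: le_lt_trans (dist_le _ _ Sp) _.
rewrite (_ : z1 + c - pr z1 = (1 - rho / 2 / dist z1)%:C%C * (z1 - pr z1)); last first.
  by rewrite /c rmorphB/= rmorph1; ring.
rewrite Normc.normcM -/(dist z1) /= expr0n/= addr0 sqrtr_sqr.
have q1 : rho / 2 / dist z1 < 1 by rewrite ltr_pdivrMr//; lra.
have q0 : 0 < rho / 2 / dist z1 by rewrite divr_gt0.
rewrite ger0_norm ?subr_ge0 ?(ltW q1)// mulrBl mul1r ltrBlDr ltrDl mulr_gt0//.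
Qed.

End maximum_principle.

(** * Inversion and Green functions *)

Section inversion.
Context (R : realType).
Implicit Types (nu mu : probability R[i] R) (K : set R[i]) (z w u : R[i]).

Definition lam nu : R := \int[nu]_z ln (modulus z).

Definition inv_prob nu : probability R[i] R := distribution nu (@GRing.inv R[i]).

Lemma recip_recip K : recip (recip K) = K.
Proof.
apply/seteqP; split=> z; first by move=> [_ [w Kw <-] <-]; rewrite invrK.
by move=> Kz; exists z^-1; [exists z|rewrite invrK].
Qed.

Lemma recip_inE K z : recip K z = K z^-1.
Proof.
apply/propext; split; first by move=> [w Kw <-]; rewrite invrK.
by move=> Kz; exists z^-1; rewrite ?invrK.
Qed.

Lemma recip0 K : ~ K 0 -> ~ recip K 0.
Proof. by rewrite recip_inE invr0. Qed.

Lemma compact_away0 K : compact K -> ~ K 0 -> exists2 r : R, 0 < r &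
  forall z, K z -> r <= modulus z.
Proof.
move=> cK K0; have [Kn|Kn] := pselect (K !=set0); last first.
  by exists 1 => // z Kz; exfalso; apply: Kn; exists z.
have [w Kw wP] := compact_nearest 0 cK Kn; exists (modulus w).
  by rewrite modulus_gt0; apply/eqP => w0; apply: K0; rewrite -w0.
by move=> z /wP; rewrite !sub0r !normcN.
Qed.

Lemma compact_recip K : compact K -> ~ K 0 -> compact (recip K).
Proof.
move=> cK K0; apply: continuous_compact => //.
apply: continuous_in_subspaceT => z; rewrite inE => Kz; apply: inv_continuous.
by apply/eqP => z0; apply: K0; rewrite -z0.
Qed.

Lemma inv_prob_setE nu K : inv_prob nu K = nu (recip K).
Proof.
rewrite /inv_prob /distribution /pushforward; congr (nu _).
by apply/seteqP; split=> z /=; rewrite recip_inE.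
Qed.

Lemma logh_inv w : w != 0 -> logh w^-1 = logh w - ln (modulus w).
Proof.
move=> w0; have mw : 0 < modulus w by rewrite modulus_gt0.
rewrite /logh /hgt Normc.normcV (_ : 1 + _ = hgt w / modulus w ^+ 2); last first.
  by rewrite /hgt mulrDl mulfV ?expf_neq0 ?gt_eqF// mul1r addrC exprVn.
by rewrite ln_div ?posrE ?hgt_gt0 ?exprn_gt0// lnXn// /hgt -[ln _ *+ 2]mulr_natl; field.
Qed.

(** Inversion is a rotation of the sphere and preserves the chordal distance. Mutual energies are
    therefore invariant under [inv_prob], so the pole at 0 reduces to the pole at infinity; only
    [ell] changes, by [lam]. *)
Lemma kern_inv z u : z != 0 -> u != 0 -> kern z u^-1 = kern z^-1 u.
Proof.
move=> z0 u0.
have [->|zu] := eqVneq z u^-1.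
  by rewrite /kern !invrK !subrr !Normc.normc0 !le0_lneNy.
have zu' : z^-1 != u by apply: contra zu => /eqP <-; rewrite invrK.
rewrite !kernE//; congr EFin; rewrite !logh_inv//.
have -> : modulus (z - u^-1) = modulus z * modulus (z^-1 - u) / modulus u.
  rewrite -Normc.normcV -!Normc.normcM -[in RHS](normcN) ; congr (modulus _).
  by field; rewrite z0 u0.
rewrite ln_div ?lnM ?posrE ?mulr_gt0 ?modulus_gt0 ?subr_eq0//.
by ring.
Qed.

Section inv_prob.
Variables (K : set R[i]) (nu : probability R[i] R).
Hypotheses (cK : compact K) (K0 : ~ K 0) (nuK : nu K = 1%E).

Lemma spot_inv z : z != 0 -> spot (inv_prob nu) z = spot nu z^-1.
Proof.
move=> z0; rewrite /spot ge0_integral_distribution.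
- apply: ge0_ae_eq_integral => //.
  + by apply: measurableT_comp; [exact: measurable_kern|exact: measurable_invC].
  + exact: measurable_kern.
  + by move=> u _; exact: kern_ge0.
  + by move=> u _; exact: kern_ge0.
  + apply: (prob_ae (compact_measurableC cK) nuK) => u Ku _ /=.
    by apply: kern_inv => //; apply/eqP => u0; apply: K0; rewrite -u0.
- exact: measurable_kern.
- by move=> u; exact: kern_ge0.
Qed.

Lemma mutual_inv K' mu : compact K' -> ~ K' 0 -> mu K' = 1%E ->
  mutual (inv_prob mu) (inv_prob nu) = mutual mu nu.
Proof.
move=> cK' K'0 muK'; rewrite /mutual ge0_integral_distribution.
- apply: ge0_ae_eq_integral => //.
  + by apply: measurableT_comp; [exact: measurable_spot|exact: measurable_invC].
  + exact: measurable_spot.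
  + by move=> u _; exact: spot_ge0.
  + by move=> u _; exact: spot_ge0.
  + apply: (prob_ae (compact_measurableC cK') muK') => u Ku _ /=.
    have u0 : u != 0 by apply/eqP => u0; apply: K'0; rewrite -u0.
    by rewrite spot_inv ?invr_eq0// invrK.
- exact: measurable_spot.
- by move=> u; exact: spot_ge0.
Qed.

End inv_prob.

Lemma measurable_lnmod : measurable_fun [set: R[i]] (fun z : R[i] => ln (modulus z)).
Proof.
apply: measurableT_comp; first exact: measurable_ln.
by apply: continuous_measurableC; exact: continuous_modulus.
Qed.

Lemma bmeas_ln_indic K : compact K -> ~ K 0 ->
  bmeas (fun z : R[i] => ln (modulus z) * \1_K z).
Proof.
move=> cK K0; have [r r0 rK] := compact_away0 cK K0.
rewrite (_ : (fun z => _) = (fun z => ln (Num.max r (modulus z)) * \1_K z)).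
  apply: (compact_bmeas cK); apply: (@lipschitz_continuous _ _ r^-1) => z w.
  rewrite mulrC (le_trans (ln_max_lip _ _ r0))//.
  by rewrite ler_wpM2r ?invr_ge0 ?(ltW r0)// modulus_lip.
apply/funext => z; rewrite indicE; have [/set_mem zK|_] := boolP (z \in K).
  by rewrite (elimT max_idPr)// rK.
by rewrite !mulr0.
Qed.

Lemma lam_indic K nu : compact K -> ~ K 0 -> nu K = 1%E ->
  lam nu = \int[nu]_z (ln (modulus z) * \1_K z).
Proof.
move=> cK K0 nuK; apply: (prob_ae_Rintegral (compact_measurableC cK) nuK).
- exact: measurable_lnmod.
- by have [] := bmeas_ln_indic cK K0.
- by move=> z Kz; rewrite indicE mem_set// mulr1.
Qed.

Lemma int_inv_prob K nu (f : R[i] -> R) : compact K -> ~ K 0 -> nu K = 1%E ->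
  bmeas f -> \int[inv_prob nu]_z f z = \int[nu]_z f z^-1.
Proof.
move=> cK K0 nuK bf; rewrite /Rintegral integral_distribution//.
  by apply/measurable_EFinP; case: bf.
apply: (bmeas_integrable nu measurableT (f := fun z => f z^-1)).
case: bf => mf [M fM]; split; last by exists M => z; exact: fM.
by apply: measurableT_comp => //; exact: measurable_invC.
Qed.

Lemma ell_inv K nu : compact K -> ~ K 0 -> nu K = 1%E ->
  ell (inv_prob nu) = ell nu - lam nu.
Proof.
move=> cK K0 nuK; have cK' := compact_recip cK K0.
have nuK' : inv_prob nu (recip K) = 1%E by rewrite inv_prob_setE recip_recip.
rewrite (ell_indic cK' nuK') (int_inv_prob cK K0 nuK); last first.
  exact: (compact_bmeas cK' (@logh_continuous R)).
rewrite (ell_indic cK nuK) (lam_indic cK K0 nuK) -bmeas_intB.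
- apply: eq_Rintegral => z _; rewrite !indicE.
  have [/set_mem zK|zK] := boolP (z \in K).
    have z0 : z != 0 by apply/eqP => z0; apply: K0; rewrite -z0.
    by rewrite mem_set ?recip_inE ?invrK// !mulr1 logh_inv.
  rewrite memNset ?mulr0 ?subr0//; rewrite recip_inE invrK => Kz.
  by move/negP : zK; apply; rewrite inE.
- exact: (compact_bmeas cK (@logh_continuous R)).
- exact: bmeas_ln_indic.
Qed.

Lemma lam_inv K nu : compact K -> ~ K 0 -> nu K = 1%E ->
  lam (inv_prob nu) = - lam nu.
Proof.
move=> cK K0 nuK; have cK' := compact_recip cK K0; have K'0 := recip0 K0.
have nuK' : inv_prob nu (recip K) = 1%E by rewrite inv_prob_setE recip_recip.
rewrite (lam_indic cK' K'0 nuK') (int_inv_prob cK K0 nuK); last exact: bmeas_ln_indic.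
rewrite (lam_indic cK K0 nuK) -mulN1r -bmeas_intZ; last exact: bmeas_ln_indic.
apply: eq_Rintegral => z _; rewrite !indicE Normc.normcV.
have [/set_mem zK|zK] := boolP (z \in K).
  have z0 : z != 0 by apply/eqP => z0; apply: K0; rewrite -z0.
  by rewrite mem_set ?recip_inE ?invrK// !mulr1 lnV ?posrE ?modulus_gt0// mulN1r.
rewrite memNset ?mulr0//; rewrite recip_inE invrK => Kz.
by move/negP : zK; apply; rewrite inE.
Qed.

Lemma nonpolar_recip K : compact K -> ~ K 0 -> nonpolar K -> nonpolar (recip K).
Proof.
move=> cK K0 [nu [nuK nuoo]]; have cK' := compact_recip cK K0.
have nuK' : inv_prob nu (recip K) = 1%E by rewrite inv_prob_setE recip_recip.
exists (inv_prob nu); split=> //.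
move: nuoo; rewrite (energyE cK nuK) (energyE cK' nuK') (mutual_inv cK K0 nuK cK K0 nuK).
by case: (mutual nu nu) => //= r _; rewrite ltry.
Qed.

Lemma harmonic_zeroE K : harmonic_zero K = inv_prob (equilibrium_measure (recip K)).
Proof. by []. Qed.

End inversion.

(** * Green functions and Robin constants *)

Section green.
Context (R : realType) (K : set R[i]).
Hypotheses (cK : compact K) (npK : nonpolar K).
Implicit Types (mu : probability R[i] R) (z w : R[i]).

Let nu := equilibrium_measure K.

(** The maximum principle extends the bound from the Frostman set to the plane. The potential is
    thus finite everywhere, so that [fine] in [green_infty] discards nothing. *)
Lemma green_data : exists V : R, [/\ minimizer K nu V,
  forall z, (spot nu z <= (V + ell nu + logh z)%:E)%E &
  forall z, spot nu z = (V + ell nu + logh z - green_infty K z)%:E].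
Proof.
have [V mV] := equilibriumP cK npK; have [nuK nuV _] := mV.
have [S [cS SK nuS spotS]] := frostman_ae cK mV.
have pV := maximum_principle cS nuS spotS.
have sV z : (spot nu z <= (V + ell nu + logh z)%:E)%E.
  have := pV z; rewrite (potentialE _ cK nuK) leeBlDr// -EFinD.
  by rewrite (_ : V + (logh z + ell nu) = V + ell nu + logh z)//; ring.
exists V; split=> // z; rewrite /green_infty -/nu nuV (potentialE _ cK nuK).
move: (sV z) (spot_ge0 nu z); case: (spot nu z) => [a| |] //= _ _.
by congr EFin; ring.
Qed.

(** The minimal energy: [xget] names the value provided by [equilibriumP], and [robin_inftyE]
    identifies it with the limit at infinity. *)
Definition robin : R := xget 0 [set V | minimizer K nu V].

Lemma robinP : [/\ minimizer K nu robin,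
  forall z, (spot nu z <= (robin + ell nu + logh z)%:E)%E &
  forall z, spot nu z = (robin + ell nu + logh z - green_infty K z)%:E].
Proof.
have [V [mV H1 H2]] := green_data.
suff -> : robin = V by [].
rewrite /robin; case: xgetP => [W _ [_ W1 _]|/(_ V)//].
by have [_ V1 _] := mV; apply: EFin_inj; rewrite -W1.
Qed.

Lemma green_ge0 z : 0 <= green_infty K z.
Proof. by have [_ H1 H2] := robinP; have := H1 z; rewrite H2 lee_fin gerBl. Qed.

(** For [w] in [K], both [modulus z] and [modulus (z - w)] are at least [modulus z / 2], where the
    logarithm has Lipschitz constant [2 / modulus z], and they differ by at most [M]. *)
Lemma green_near_infty : exists2 M : R, 0 < M & forall z, 2 * M < modulus z ->
  `|green_infty K z - ln (modulus z) - robin| <= 2 * M / modulus z.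
Proof.
have [M M0 KM] := compact_modulus_le cK; exists M => // z Mz.
have [[nuK _ _] _ spE] := robinP.
have z0 : 0 < modulus z by rewrite (lt_trans _ Mz)// mulr_gt0.
have r0 : 0 < modulus z / 2 by rewrite divr_gt0.
have zr w : K w -> modulus z / 2 <= modulus (z - w).
  by move=> /KM wM; have := ler_modulusB z w; lra.
have := potential_potr cK nuK r0 zr; rewrite (potentialE _ cK nuK) spE => -[E].
have -> : green_infty K z - ln (modulus z) - robin = - potr nu K (modulus z / 2) z - ln (modulus z).
  by rewrite -E; ring.
rewrite /potr opprK.
have -> : ln (modulus z) = \int[nu]_w (ln (modulus z) * \1_K w).
  rewrite bmeas_intZ ?bmeas_int_indic; [|exact: compact_measurableC|].
    by move: nuK => /= ->; rewrite mulr1.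
  by apply: bmeas_indic; exact: compact_measurableC.
have b1 := bmeas_logr cK z r0.
have b2 : bmeas (fun w : R[i] => ln (modulus z) * \1_K w).
  by apply: bmeasZ; apply: bmeas_indic; exact: compact_measurableC.
rewrite -bmeas_intB// -[leRHS]addr0 -[X in _ + X](bmeas_int_cst nu).
apply: (functional_norm_le (integral_functional nu)).
- exact: bmeasB.
- exact: bmeas_cst.
move=> w; rewrite addr0 /logr -mulrBl normrM indicE.
have [/set_mem Kw|_] := boolP (w \in K); last first.
  by rewrite normr0 mulr0 divr_ge0 ?mulr_ge0 ?ltW.
rewrite normr1 mulr1 (elimT max_idPr) ?zr//.
have H a b : modulus z / 2 <= a -> modulus z / 2 <= b -> `|b - a| <= modulus w ->
    ln b - ln a <= 2 * M / modulus z.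
  move=> ra rb ab; apply: (le_trans (ln_lip r0 ra rb)).
  rewrite invfM invrK mulrA mulrAC [2 * M]mulrC ler_wpM2r ?invr_ge0 ?(ltW z0)//.
  by rewrite ler_wpM2r// (le_trans ab)// KM.
have zw : `|modulus (z - w) - modulus z| <= modulus w.
  by rewrite (le_trans (modulus_lip _ _))// (_ : z - w - z = - w) ?normcN//; ring.
have zz : modulus z / 2 <= modulus z by rewrite ler_pdivrMr//; lra.
by rewrite ler_norml lerNl opprB !H ?zr// distrC.
Qed.

Lemma robin_inftyE : robin_infty K = robin.
Proof.
have [M M0 H] := green_near_infty.
apply/cvg_lim => //; apply/cvgrPdist_le => e e0.
exists (Num.max (2 * M) (2 * M / e)) => z; rewrite gt_max => /andP[z1 z2].
rewrite distrC (le_trans (H _ z1))//.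
have z0 : 0 < modulus z by rewrite (lt_trans _ z1)// mulr_gt0.
by move: z2; rewrite ltr_pdivrMr// ler_pdivrMr// [e * _]mulrC => /ltW.
Qed.

Lemma green_growth : exists A C : R, forall z, A < modulus z ->
  [/\ 1 <= green_infty K z, ln (modulus z) <= C * green_infty K z,
    logh z <= C * green_infty K z & 1 < modulus z].
Proof.
have [M M0 H] := green_near_infty.
(* Here [logh z] is at most [ln (modulus z) + ln 2], and [ln (modulus z)] at most
   [green_infty K z + 1 - robin], so this factor suffices once the Green function is at least one.
   The radius [expR (2 - robin)] ensures the latter. *)
pose C := 1 + `|1 - robin + ln 2|.
exists (Num.max (Num.max (2 * M) 1) (expR (2 - robin))), C => z.
rewrite !gt_max => /andP[/andP[z1 z2] z3].
have z0 : 0 < modulus z by exact: lt_trans z2.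
have ln3 : 2 - robin < ln (modulus z) by rewrite -[X in X < _]expRK ltr_ln ?posrE ?expR_gt0.
have g1 : robin + ln (modulus z) - 1 <= green_infty K z.
  have := H z z1; rewrite ler_norml => /andP[+ _].
  have : 2 * M / modulus z <= 1 by rewrite ler_pdivrMr// mul1r ltW.
  lra.
have g2 : 1 <= green_infty K z by lra.
have lh : logh z <= ln (modulus z) + ln 2.
  rewrite /logh ler_pdivrMl//.
  rewrite -lnM ?posrE// mulr_natl -lnXn ?mulr_gt0// ler_ln ?posrE ?hgt_gt0 ?exprn_gt0 ?mulr_gt0//.
  rewrite /hgt exprMn; have : 1 <= modulus z ^+ 2 by rewrite exprn_ege1// ltW.
  by nra.
have n1 := ler_norm (1 - robin + ln 2).
have n0 := normr_ge0 (1 - robin + ln 2).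
have key : logh z <= C * green_infty K z by rewrite /C; nra.
split=> //; apply: le_trans key; apply: ln_modulus_le.
by rewrite -modulus_gt0.
Qed.

End green.

Lemma robin_zeroE (R : realType) (K : set R[i]) : compact K -> ~ K 0 -> nonpolar K ->
  robin_zero K = robin (recip K).
Proof.
move=> cK K0 npK; have cK' := compact_recip cK K0.
have npK' := nonpolar_recip cK K0 npK.
have [M M0 H] := green_near_infty cK' npK'.
apply/cvg_lim => //; apply/(@cvgrPdist_le _ _ _ ((0 : R[i])^')) => e e0.
rewrite /prop_near1/= /dnbhs /within/= ; apply/nbhs_modulusP.
exists (Num.min (2 * M)^-1 (e / (2 * M))).
  by rewrite lt_min invr_gt0 divr_gt0// mulr_gt0.
move=> z; rewrite sub0r normcN lt_min => /andP[z1 z2] z0.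
have mz : 0 < modulus z by rewrite modulus_gt0.
have h : 2 * M < modulus z^-1.
  by rewrite Normc.normcV -[X in X < _]invrK ltf_pV2 ?posrE ?invr_gt0 ?mulr_gt0.
rewrite distrC /green_zero; have := H _ h.
rewrite Normc.normcV lnV ?posrE// opprK invrK => /le_trans; apply.
by rewrite mulrC -ler_pdivlMr ?mulr_gt0// ltW.
Qed.

(** * Mutual energy with the equilibrium measure *)

Section green_integral.
Context (R : realType) (K : set R[i]).
Hypotheses (cK : compact K) (npK : nonpolar K).
Implicit Types (z w : R[i]).
Let nu := equilibrium_measure K.

Let nuK : nu K = 1%E. Proof. by have [[]] := robinP cK npK. Qed.

Lemma green_potr r z : 0 < r -> (forall w, K w -> r <= modulus (z - w)) ->
  green_infty K z = robin K - potr nu K r z.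
Proof.
move=> r0 zr; have [_ _ spE] := robinP cK npK.
have := potential_potr cK nuK r0 zr; rewrite (potentialE _ cK nuK) spE => -[<-].
by ring.
Qed.

Lemma nonneg_int0_null (mu : probability R[i] R) (f : R[i] -> R) : bmeas f ->
  (forall z, 0 <= f z) -> \int[mu]_z f z <= 0 -> mu [set z | 0 < f z] = 0%E.
Proof.
move=> bf f0 If; have [mf _] := bf.
have I0 : (\int[mu]_z `|(f z)%:E| = 0)%E.
  under eq_integral do rewrite /= ger0_norm//.
  rewrite bmeas_int_fin//; congr EFin; apply/eqP; rewrite eq_le If/=.
  exact: bmeas_int_ge0.
have mE : measurable_fun [set: R[i]] (EFin \o f) by exact/measurable_EFinP.
have /(ae_eq_integral_abs mu measurableT mE) [N [mN N0 fN]] := I0.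
apply: (subset_measure0 _ mN _ N0).
  rewrite (_ : mkset _ = f @^-1` `]0, +oo[%classic).
    by rewrite -[X in measurable X]setTI; apply: mf => //; exact: measurable_itv.
  by apply/seteqP; split=> z /=; rewrite in_itv/= andbT.
move=> z /= fz; apply: fN => /= /(_ I) [fz0].
by rewrite fz0 ltxx in fz.
Qed.

(** The hypothesis speaks of continuous minorants because these pass to the weak limit. Off [K] the
    Green function is continuous; cutting it off near [K] and at height one gives countably many
    minorants, and each point off [K] where it is positive is seen by one of them. *)
Lemma green_ae_off (mu : probability R[i] R) :
  (forall f : R[i] -> R, continuous f -> bmeas f ->
    (forall z, 0 <= f z <= green_infty K z) -> \int[mu]_z f z <= 0) ->
  exists N, [/\ measurable N, mu N = 0%E &
    forall z, ~ K z -> green_infty K z != 0 -> N z].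
Proof.
move=> H; have K0 : K !=set0 := support_neq0 nuK.
have near u : exists w, K w /\ forall w', K w' -> modulus (u - w) <= modulus (u - w').
  by have [w Sw wP] := compact_nearest u cK K0; exists w.
have [pr prP] := choice near.
pose dist u := modulus (u - pr u).
have dist_le u w : K w -> dist u <= modulus (u - w) by have [_] := prP u; apply.
have dist_lip u v : `|dist u - dist v| <= 1 * modulus (u - v).
  have L a b : dist a <= dist b + modulus (a - b).
    have [Sb _] := prP b; apply: (le_trans (dist_le a _ Sb)).
    by rewrite [leRHS]addrC; exact: modulus_triangle.
  have h1 := L u v; have h2 := L v u; rewrite modulusB in h2.
  by rewrite mul1r ler_norml; apply/andP; split; lra.
have dist_cont := lipschitz_continuous dist_lip.
pose clip (x : R) := Num.min 1 (Num.max 0 x).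
have clip0 x : 0 <= clip x by rewrite le_min ler01 le_max lexx.
have clip1 x : clip x <= 1 by rewrite ge_min lexx.
have clip_cont (g : R[i] -> R) : continuous g -> continuous (fun z => clip (g z)).
  move=> /continuous_modulusP cg; apply/continuous_modulusP => z d d0.
  have [d' d'0 d'P] := cg z d d0; exists d' => // w /d'P; apply: le_lt_trans.
  have n1 := ler_norm (g z - g w); have n2 := ler_norm (g w - g z).
  rewrite distrC in n2; rewrite ler_norml /clip !minEle !maxEle.
  by apply/andP; split; do 4 (case: ifPn); rewrite -?ltNge; lra.
pose rho (k : nat) : R := k.+1%:R^-1.
have rho0 k : 0 < rho k by rewrite invr_gt0.
(* The first factor vanishes within [rho k] of [K], where the truncated potential may no longer
   represent the Green function; the second caps the height at one. *)
pose f k z := clip ((dist z - rho k) / rho k) * clip (robin K - potr nu K (rho k) z).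
have fcont k : continuous (f k).
  move=> z; apply: (@cvgM _ _ (nbhs z)); apply: clip_cont => {}z.
    apply: (@cvgM _ _ (nbhs z)); last exact: cvg_cst.
    by apply: (@cvgB _ _ _ (nbhs z)); [exact: dist_cont|exact: cvg_cst].
  apply: (@cvgB _ _ _ (nbhs z)); first exact: cvg_cst.
  exact: (potr_continuous cK).
have f0 k z : 0 <= f k z by rewrite mulr_ge0.
have bf k : bmeas (f k).
  split; first exact: continuous_measurableC.
  by exists 1 => z; rewrite ger0_norm// /f mulr_ile1.
have fg k z : f k z <= green_infty K z.
  have g0 := green_ge0 cK npK z.
  rewrite /f; have [zr|zr] := leP (dist z) (rho k).
    rewrite (_ : clip ((dist z - rho k) / rho k) = 0) ?mul0r//.
    rewrite /clip (elimT max_idPl) ?(elimT min_idPr)//.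
    by rewrite pmulr_lle0 ?invr_gt0// subr_le0.
  have E := green_potr (rho0 k) (fun w Kw => le_trans (ltW zr) (dist_le z w Kw)).
  rewrite -E (@le_trans _ _ (clip (green_infty K z)))//.
    by rewrite ler_piMl.
  by rewrite /clip ge_min (elimT max_idPr)// lexx orbT.
have mpos k : measurable [set z | 0 < f k z].
  have [mf _] := bf k; rewrite (_ : mkset _ = f k @^-1` `]0, +oo[%classic).
    by rewrite -[X in measurable X]setTI; apply: mf => //; exact: measurable_itv.
  by apply/seteqP; split=> z /=; rewrite in_itv/= andbT.
exists (\bigcup_k [set z | 0 < f k z]); split.
- exact: bigcupT_measurable.
- apply: measure_negligible; first exact: bigcupT_measurable.
  apply: negligible_bigcup => k; apply/negligibleP; first exact: mpos.
  apply: nonneg_int0_null => //; apply: H => // z.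
  by rewrite f0 fg.
move=> z nKz gz; have dz : 0 < dist z.
  rewrite modulus_gt0 subr_eq0; apply/eqP => zE; apply: nKz.
  by rewrite zE; have [] := prP z.
have [k kz] := ltr_add_invr dz; rewrite add0r -/(rho k) in kz.
exists k => //=; rewrite /f mulr_gt0//.
  rewrite /clip lt_min ltr01 lt_max divr_gt0 ?orbT// subr_gt0//.
rewrite -(green_potr (rho0 k) (fun w Kw => le_trans (ltW kz) (dist_le z w Kw))).
have g0 : 0 < green_infty K z by rewrite lt_neqAle eq_sym gz (green_ge0 cK npK).
by rewrite /clip lt_min ltr01 lt_max g0 orbT.
Qed.

(** The upper half of [mutual_equilibrium], obtained by integrating the global bound on the
    potential. It is also what bounds the mutual energy of the two harmonic measures. *)
Lemma mutual_le_robin (mu : probability R[i] R) K' : compact K' -> mu K' = 1%E ->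
  (mutual mu nu <= (robin K + ell nu + ell mu)%:E)%E.
Proof.
move=> cK' muK'; have [_ spV _] := robinP cK npK.
have mK' := compact_measurableC cK'; set kap := robin K + ell nu.
have bll := compact_bmeas cK' (@logh_continuous R).
have bi := bmeas_indic R mK'; have bk := bmeasZ kap bi.
apply: mutual_le => M; rewrite -int_spotM.
rewrite (ell_indic cK' muK') -[X in _ <= X + _](bmeas_int_cst mu).
rewrite -(bmeas_intD _ (bmeas_cst _ kap) bll).
rewrite [leLHS](_ : _ = \int[mu]_z (spotM nu M z * \1_K' z)); last first.
  apply: (prob_ae_Rintegral mK' muK'); first exact: measurable_spotM.
    by apply: measurable_funM; [exact: measurable_spotM|exact: measurable_indic].
  by move=> z Kz; rewrite indicE mem_set// mulr1.
rewrite [leRHS](_ : _ = \int[mu]_z (kap * \1_K' z + logh z * \1_K' z)); last first.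
  apply: (prob_ae_Rintegral mK' muK').
  - by case: (bmeasD (bmeas_cst _ kap) bll).
  - by case: (bmeasD bk bll).
  - by move=> z Kz; rewrite indicE mem_set// !mulr1.
apply: bmeas_int_le.
- by apply: bmeasM => //; exact: bmeas_energyM.
- exact: bmeasD.
- move=> z; rewrite -mulrDl ler_wpM2r ?indicE//.
  by rewrite -lee_fin (le_trans (spotM_le _ _ _))// spV.
Qed.

(* Outside [K] the Green function is continuous, hence vanishes almost everywhere; on
   [K] the variational inequality applies because [mu] has finite energy. *)
Lemma mutual_equilibrium (mu : probability R[i] R) K' (e : R) : compact K' ->
  mu K' = 1%E -> (mutual mu mu <= e%:E)%E ->
  (forall f : R[i] -> R, continuous f -> bmeas f ->
    (forall z, 0 <= f z <= green_infty K z) -> \int[mu]_z f z <= 0) ->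
  mutual mu nu = (robin K + ell nu + ell mu)%:E.
Proof.
move=> cK' muK' mue /green_ae_off [N [mN N0 NP]].
have [mnu spV spE] := robinP cK npK.
have mK := compact_measurableC cK; have mK' := compact_measurableC cK'.
set kap := robin K + ell nu.
pose L := K `|` K'.
have cL : compact L by exact: compactU.
have mL := compact_measurableC cL.
have muL : mu L = 1%E.
  apply/eqP; rewrite eq_le probability_le1//= -muK'; apply: le_measure; rewrite ?inE//.
  by move=> z Kz; right.
pose A := L `\` K; have mA : measurable A by exact: measurableD.
have bl (S : set R[i]) : measurable S -> S `<=` L ->
    bmeas (fun z => kap * \1_S z + logh z * \1_S z).
  move=> mS SL; apply: bmeasD; first by apply: bmeasZ; exact: bmeas_indic.
  exact: (bmeas_logh_indic cL).
have intS (S : set R[i]) : measurable S -> S `<=` L ->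
    \int[mu]_z (kap * \1_S z + logh z * \1_S z) =
    kap * fine (mu S) + \int[mu]_z (logh z * \1_S z).
  move=> mS SL; rewrite bmeas_intD; last exact: (bmeas_logh_indic cL).
    by rewrite bmeas_intZ ?bmeas_int_indic//; exact: bmeas_indic.
  by apply: bmeasZ; exact: bmeas_indic.
have spA : (\int[mu]_(z in A) spot nu z =
    (kap * fine (mu A) + \int[mu]_z (logh z * \1_A z))%:E)%E.
  rewrite -intS//; last exact: subDsetl.
  rewrite -bmeas_int_fin; last by apply: bl => //; exact: subDsetl.
  rewrite integral_mkcond; apply: ae_eq_integral => //.
  - by apply/measurable_restrict => //; apply/measurable_funTS; exact: measurable_spot.
  - by apply/measurable_EFinP; case: (bl A mA (@subDsetl _ _ _)).
  exists N; split=> // z nz; apply: contrapT => nNz; apply: nz => _ /=.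
  rewrite patchE indicE; case: ifPn => [/set_mem[_ nKz]|_]; last by rewrite !mulr0 addr0.
  rewrite spE !mulr1; congr EFin; suff -> : green_infty K z = 0 by rewrite subr0.
  by apply/eqP; apply: contrapT => gz; apply: nNz; apply: NP => //; exact/negP.
have LE : K `|` A = L by apply/seteqP; split=> z; [case; [left|case]|move=> Lz;
  have [?|?] := pselect (K z); [left|right]].
have dKA : [disjoint K & A] by apply/disj_setPS => z [? []].
have spT : mutual mu nu = (\int[mu]_(z in K) spot nu z + \int[mu]_(z in A) spot nu z)%E.
  rewrite -ge0_integral_setU//.
  - rewrite LE /mutual (ge0_negligible_integral (N := ~` L))//.
    + by rewrite setTD setCK.
    + exact: measurableC.
    + exact: measurable_spot.
    + by move=> w _; exact: spot_ge0.
    + by apply: etrans (probability_setC mu mL) _; rewrite muL subee.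
  - by apply/measurable_funTS; exact: measurable_spot.
  - by move=> z _; exact: spot_ge0.
have up : (mutual mu nu <= (kap + ell mu)%:E)%E := mutual_le_robin cL muL.
have [k kE] : exists k : R, (\int[mu]_(z in K) spot nu z = k%:E)%E.
  have k0 : (0 <= \int[mu]_(z in K) spot nu z)%E.
    by apply: integral_ge0 => z _; exact: spot_ge0.
  move: up k0; rewrite spT spA; case: (\int[mu]_(z in K) spot nu z)%E => // k _ _.
  by exists k.
have lo := @variation_subset R K nu (robin K) mu K e k cK mnu mK (@subset_refl _ _) mue.
rewrite kE lexx in lo; move: (lo isT) => {}lo.
have m1 : fine (mu K) + fine (mu A) = 1.
  rewrite -fineD ?fin_num_measure// -measureU//.
    by rewrite LE; move: muL => /= ->.
  by apply/seteqP; split=> z // [? []].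
have l1 : \int[mu]_z (logh z * \1_K z) + \int[mu]_z (logh z * \1_A z) = ell mu.
  rewrite (ell_indic cL muL) -bmeas_intD.
  - apply: eq_Rintegral => z _; rewrite -mulrDr; congr (_ * _); rewrite -LE !indicE in_setU.
    have [zS|zS] := boolP (z \in K); last by rewrite add0r.
    by rewrite /= memNset ?addr0// => -[_]; apply; exact: set_mem.
  - by apply: (bmeas_logh_indic cL) => // z Kz; left.
  - by apply: (bmeas_logh_indic cL) => //; exact: subDsetl.
apply/eqP; rewrite eq_le up /= spT kE spA -EFinD lee_fin.
rewrite -/kap in lo; have := congr1 (fun t => kap * t) m1; rewrite /= mulrDr mulr1.
by rewrite -l1; lra.
Qed.

End green_integral.

(** * Discriminants of integer polynomials *)

Section resultant.
Context (F : fieldType).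

Lemma det_Vandermonde_neq0 (rs : seq F) : uniq rs ->
  \det (Vandermonde (size rs) (\row_(j < size rs) rs`_j)) != 0.
Proof.
move=> urs; rewrite det_Vandermonde; apply/prodf_neq0 => i _.
apply/prodf_neq0 => j ij; rewrite !mxE subr_eq0 nth_uniq//.
by rewrite neq_ltn ij orbT.
Qed.

(* The left side is the resultant of [p] and [q]: multiplying the Sylvester-type
   matrix [S] by the matrix [W] of the roots gives a block triangular matrix. *)
Lemma resultant_integral (f : {rmorphism int -> F}) (p q : {poly int}) (rs : seq F) (m : nat) :
  injective f -> uniq rs ->
  map_poly f p = f (lead_coef p) *: \prod_(x <- rs) ('X - x%:P) ->
  size p = (size rs).+1 -> (size q <= m.+1)%N ->
  exists N : int, f N = f (lead_coef p) ^+ m * \prod_(x <- rs) (map_poly f q).[x].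
Proof.
move=> injf urs pE sp sq; set d := size rs in sp *.
pose pf := map_poly f p; pose qf := map_poly f q.
have f0 : f 0 = 0 by exact: rmorph0.
have spf : size pf = d.+1 by rewrite size_map_inj_poly.
have sqf : (size qf <= m.+1)%N by rewrite size_map_inj_poly.
pose S : 'M[int]_(d + m) := \matrix_(i, k)
  match fintype.split i with inl i => (q * 'X^i)`_k | inr i => (p * 'X^i)`_k end.
pose V : 'M[F]_d := Vandermonde d (\row_(j < d) rs`_j).
(* The first [d] columns list powers of the roots, so that rows of [S] are evaluated there and those
   coming from [p] give zero. The other columns copy the coefficients of index at least [d]. *)
pose W : 'M[F]_(d + m) := block_mx V 0 (\matrix_(i < m, j < d) rs`_j ^+ (d + i)) 1%:M.
pose A : 'M[F]_d := \matrix_(i, j) (rs`_j ^+ i * qf.[rs`_j]).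
pose T : 'M[F]_m := \matrix_(i, j) (pf * 'X^i)`_(d + j).
pose B : 'M[F]_(d, m) := \matrix_(i, j) (qf * 'X^i)`_(d + j).
have colE (g : {poly int}) (x : F) : (size g <= d + m)%N ->
    \sum_(k < d + m) f g`_k * x ^+ k = (map_poly f g).[x].
  move=> sg; rewrite (@horner_coef_wide _ (d + m)); last by rewrite size_map_inj_poly.
  by apply: eq_bigr => k _; rewrite coef_map.
have szX (g : {poly int}) (i k : nat) : (size g <= k.+1)%N -> (size (g * 'X^i)%R <= (k + i).+1)%N.
  move=> sg; apply: (leq_trans (size_polyMleq _ _)).
  by rewrite size_polyXn addnS/= -addSn leq_add2r.
have SW : map_mx f S *m W = block_mx A B 0 T.
  have WE k j : W k (lshift m j) = rs`_j ^+ k.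
    rewrite /W; case: (splitP k) => k' kk'.
      have -> : k = lshift m k' by exact: val_inj.
      by rewrite block_mxEul !mxE.
    have -> : k = rshift d k' by exact: val_inj.
    by rewrite block_mxEdl !mxE.
  have WE2 k j : W k (rshift d j) = (k == rshift d j)%:R.
    rewrite /W; case: (splitP k) => k' kk'.
      have -> : k = lshift m k' by exact: val_inj.
      by rewrite block_mxEur mxE eq_lrshift.
    have -> : k = rshift d k' by exact: val_inj.
    by rewrite block_mxEdr mxE eq_rshift.
  have right i j : (map_mx f S *m W) i (rshift d j) = f (S i (rshift d j)).
    rewrite mxE (bigD1 (rshift d j))//= WE2 eqxx mulr1 mxE big1 ?addr0// => k kj.
    by rewrite WE2 (negbTE kj) mulr0.
  apply/matrixP => i j; case: (splitP j) => j' jj'.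
    have {j jj'}-> : j = lshift m j' by exact: val_inj.
    case: (splitP i) => i' ii'.
      have {i ii'}-> : i = lshift m i' by exact: val_inj.
      rewrite block_mxEul mxE; under eq_bigr do rewrite mxE mxE WE (unsplitK (inl i')).
      rewrite colE; last by rewrite addnC (leq_trans (szX _ _ _ sq))// ltn_add2l.
      by rewrite mxE rmorphM/= map_polyXn !hornerE mulrC.
    have {i ii'}-> : i = rshift d i' by exact: val_inj.
    rewrite block_mxEdl mxE; under eq_bigr do rewrite mxE mxE WE (unsplitK (inr i')).
    rewrite colE; last by rewrite (leq_trans (szX _ _ d _)) ?sp// ltn_add2l.
    rewrite mxE rmorphM/= map_polyXn !hornerE pE hornerZ.
    rewrite (_ : (\prod_(x <- rs) ('X - x%:P)).[rs`_j'] = 0) ?mulr0 ?mul0r//.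
    by apply/eqP; rewrite -rootE root_prod_XsubC mem_nth.
  have {j jj'}-> : j = rshift d j' by exact: val_inj.
  rewrite right mxE; case: (splitP i) => i' ii'.
    have -> : i = lshift m i' by exact: val_inj.
    by rewrite block_mxEur mxE -coef_map rmorphM/= map_polyXn.
  have -> : i = rshift d i' by exact: val_inj.
  by rewrite block_mxEdr mxE -coef_map rmorphM/= map_polyXn.
have detV : \det V != 0 by exact: det_Vandermonde_neq0.
have detA : \det A = \det V * \prod_(x <- rs) qf.[x].
  rewrite (_ : A = V *m diag_mx (\row_j qf.[rs`_j])).
    rewrite det_mulmx det_diag; congr (_ * _).
    by rewrite (big_nth 0) big_mkord; apply: eq_bigr => i _; rewrite mxE.
  by apply/matrixP => i j; rewrite mul_mx_diag !mxE.
have detT : \det T = f (lead_coef p) ^+ m.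
  rewrite det_trig.
    rewrite (eq_bigr (fun=> f (lead_coef p))) ?prodr_const ?card_ord// => i _.
    by rewrite mxE coefMXn ltnNge leq_addl/= addnK coef_map/= /lead_coef sp.
  apply/is_trig_mxP => i j ij; rewrite mxE coefMXn.
  rewrite ltnNge (leq_trans (ltnW ij) (leq_addl _ _))/= nth_default//.
  by rewrite spf -addnBA ?(ltnW ij)// -addn1 leq_add2l subn_gt0.
exists (\det S); apply: (mulIf detV).
have := congr1 determinant SW; rewrite det_mulmx det_map_mx det_ublock detA detT.
rewrite /W det_lblock det1 mulr1 => ->; rewrite -/qf.
by ring.
Qed.

Lemma deriv_prod_XsubC (rs : seq F) x : x \in rs -> uniq rs ->
  (\prod_(y <- rs) ('X - y%:P))^`().[x] = \prod_(y <- rem x rs) (x - y).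
Proof.
move=> xrs urs; rewrite (perm_big _ (perm_to_rem xrs)) big_cons derivM.
rewrite derivXsubC mul1r hornerD hornerM !hornerE subrr mul0r addr0 horner_prod.
by apply: eq_bigr => y _; rewrite !hornerE.
Qed.

End resultant.

Section discriminant.
Context (R : realType).
Variable p : {poly int}.
Hypotheses (p0 : p != 0) (sp : simple_zeros R p).
Local Notation rs := (zeros R p).

Let intr_inj' : injective (intr : int -> R[i]). Proof. exact: intr_inj. Qed.

Lemma zerosE : polyC_of R p = (lead_coef p)%:~R *: \prod_(x <- rs) ('X - x%:P).
Proof.
have := svalP (closed_field_poly_normal (polyC_of R p)); rewrite -/(zeros R p).
by rewrite {2}/polyC_of lead_coef_map_inj.
Qed.

Lemma lead_coefC_neq0 : (lead_coef p)%:~R != 0 :> R[i].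
Proof. by rewrite intr_eq0 lead_coef_eq0. Qed.

Lemma size_zeros : size rs = degree p.
Proof.
have := congr1 (fun g : {poly R[i]} => size g) zerosE.
rewrite size_map_inj_poly//= size_scale ?lead_coefC_neq0// size_prod_XsubC => E.
by rewrite /degree E.
Qed.

Lemma size_zerosS : size p = (size rs).+1.
Proof. by rewrite size_zeros /degree prednK// size_poly_gt0. Qed.

Lemma zeros_root x : (x \in rs) = root (polyC_of R p) x.
Proof. by rewrite zerosE rootZ ?lead_coefC_neq0// root_prod_XsubC. Qed.

Lemma uniq_zeros : uniq rs.
Proof.
apply: count_mem_uniq => x; have [xrs|xrs] := boolP (x \in rs); last first.
  by apply/count_memPn.
have := sp (_ : root (polyC_of R p) x); rewrite -zeros_root => /(_ xrs).
have nr : ~~ root ((lead_coef p)%:~R%:P : {poly R[i]}) x.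
  by rewrite rootE hornerC lead_coefC_neq0.
by rewrite zerosE -mul_polyC (mupMr _ nr) mu_prod_XsubC => ->.
Qed.

Lemma modulus_int (n : int) : modulus (n%:~R : R[i]) = `|n|%:~R.
Proof.
apply: (@complexI R); rewrite -modulus_norm.
by rewrite -intr_norm rmorph_int.
Qed.

Lemma ln_int_ge0 (n : int) : n != 0 -> 0 <= ln (`|n|%:~R : R).
Proof.
move=> n0; apply: ln_ge0; rewrite -[1]/(1%:~R) ler_int.
by rewrite -gtz0_ge1 normr_gt0.
Qed.

Lemma sum_ln_prod (s : seq R[i]) (g : R[i] -> R) : (forall x, x \in s -> 0 < g x) ->
  \sum_(x <- s) ln (g x) = ln (\prod_(x <- s) g x).
Proof.
elim: s => [|x s ih] H; first by rewrite !big_nil ln1.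
have Hs y : y \in s -> 0 < g y by move=> ys; apply: H; rewrite inE ys orbT.
rewrite !big_cons lnM ?posrE ?H ?mem_head// ?ih//.
by rewrite big_seq; exact: prodr_gt0.
Qed.

(** The resultant of [p] and its derivative is an integer, nonzero because the zeros are distinct;
    its absolute value is at least one. *)
Lemma discriminant_bound :
  0 <= 2 * (size rs)%:R * ln (`|lead_coef p|%:~R : R) +
    \sum_(x <- rs) \sum_(y <- rem x rs) ln (modulus (x - y)).
Proof.
have urs := uniq_zeros; set d := size rs.
(* The degree of the derivative is overestimated by one, which raises the power of the leading
   coefficient to [2 * d]. This is harmless in the limit, where its logarithm divided by the degree
   tends to 0. *)
have sq : (size p^`() <= d.+1)%N.
  by rewrite (leq_trans (size_poly _ _))// size_zerosS.
have [N NE] := resultant_integral (f := intr) intr_inj' urs zerosE size_zerosS sq.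
have dpos x y : x \in rs -> y \in rem x rs -> 0 < modulus (x - y).
  move=> xrs yr; rewrite modulus_gt0 subr_eq0; apply/eqP => xy.
  by move: yr; rewrite xy rem_filter// mem_filter /= eqxx.
have dE x : x \in rs -> (map_poly intr p^`()).[x] =
    (lead_coef p)%:~R * \prod_(y <- rem x rs) (x - y).
  move=> xrs; rewrite -deriv_map -[map_poly _ p]/(polyC_of R p) zerosE derivZ hornerZ.
  by rewrite deriv_prod_XsubC.
have modE : modulus (N%:~R : R[i]) = `|lead_coef p|%:~R ^+ (d + d) *
    \prod_(x <- rs) \prod_(y <- rem x rs) modulus (x - y).
  rewrite NE Normc.normcM modulusX modulus_int exprD -mulrA; congr (_ * _).
  rewrite (eq_big_seq _ dE) big_split/= Normc.normcM big_const_seq count_predT iter_mulr_1.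
  rewrite modulusX modulus_int; congr (_ * _).
  have mp (s : seq R[i]) (g : R[i] -> R[i]) : modulus (\prod_(x <- s) g x) =
      \prod_(x <- s) modulus (g x).
    elim: s => [|x s ih]; first by rewrite !big_nil Normc.normc1.
    by rewrite !big_cons Normc.normcM ih.
  by rewrite mp; apply: eq_bigr => x _; rewrite mp.
have prodpos : 0 < \prod_(x <- rs) \prod_(y <- rem x rs) modulus (x - y).
  rewrite big_seq; apply: prodr_gt0 => x xrs; rewrite big_seq.
  by apply: prodr_gt0 => y; exact: dpos.
have lcpos : 0 < (`|lead_coef p|%:~R : R) by rewrite ltr0z normr_gt0 lead_coef_eq0.
have N0 : N != 0.
  apply/eqP => N0; move: modE; rewrite N0 Normc.normc0 => /esym/eqP.
  by rewrite gt_eqF// mulr_gt0// exprn_gt0.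
have := ln_int_ge0 N0; rewrite -modulus_int modE lnM ?posrE ?exprn_gt0//.
rewrite lnXn// -[ln _ *+ _]mulr_natl natrD mulr2n !mulrDl !mul1r => /le_trans; apply.
rewrite lerD2l -sum_ln_prod.
  rewrite big_seq [leRHS]big_seq; apply: ler_sum => x xrs.
  by rewrite sum_ln_prod// => y; exact: dpos.
move=> x xrs; rewrite big_seq; apply: prodr_gt0 => y; exact: dpos.
Qed.

Lemma prod_zeros : `|p`_0|%:~R = `|lead_coef p|%:~R * \prod_(x <- rs) modulus x :> R.
Proof.
have := congr1 (fun g : {poly R[i]} => modulus g.[0]) zerosE.
rewrite horner_coef0 coef_map/= modulus_int => ->.
rewrite hornerZ Normc.normcM modulus_int horner_prod; congr (_ * _).
elim: rs => [|x s ih]; first by rewrite !big_nil Normc.normc1.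
by rewrite !big_cons Normc.normcM ih !hornerE ?sub0r ?add0r normcN.
Qed.

End discriminant.

(** * Measures determined by their moments *)

Section moment_determined.
Context (R : realType).
Local Notation Re := (@complex.Re R).
Local Notation Im := (@complex.Im R).
Implicit Types (f g : R[i] -> R) (z w : R[i]).

(* The smallest class containing the monomials that is a vector space and is
   stable under bounded pointwise limits: it is an algebra, and it contains the
   indicators of open sets. *)
Inductive moment_determined : (R[i] -> R) -> Prop :=
| determined_mon s : moment_determined (mon s)
| determinedD f g : moment_determined f -> moment_determined g ->
    moment_determined (fun z => f z + g z)
| determinedZ (c : R) f : moment_determined f ->
    moment_determined (fun z => c * f z)
| determined_lim (F : nat -> R[i] -> R) f (M : R) :
    (forall n, moment_determined (F n)) -> (forall n z, `|F n z| <= M) ->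
    (forall z, F n z @[n --> \oo] --> f z) -> moment_determined f.

Lemma determined_bmeas f : moment_determined f -> bmeas f.
Proof.
elim=> {f} [s|f g _ bf _ bg|c f _ bf|F f M _ bF FM Ff].
- exact: bmeas_mon.
- exact: bmeasD.
- exact: bmeasZ.
- by have [] := bmeas_int_cvg (\d_(0 : R[i])) (fun n => (bF n).1) FM Ff.
Qed.

Lemma determined_int (mu nu0 nu1 : probability R[i] R) (s1 s2 : R) f :
  (forall s, moment mu s = s1 * moment nu0 s + s2 * moment nu1 s) ->
  moment_determined f ->
  \int[mu]_z f z = s1 * \int[nu0]_z f z + s2 * \int[nu1]_z f z.
Proof.
move=> mE; elim=> {f} [s|f g df ih dg ig|c f df ih|F f M dF ih FM Ff].
- exact: mE.
- move/determined_bmeas in df; move/determined_bmeas in dg.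
  by rewrite !bmeas_intD// ih ig; ring.
- by move/determined_bmeas in df; rewrite !bmeas_intZ// ih; ring.
- have cv (P : probability R[i] R) := (bmeas_int_cvg P
    (fun n => (determined_bmeas (dF n)).1) FM Ff).2.
  apply: (cvg_unique (@norm_hausdorff _ _) (cv mu)).
  rewrite (_ : (fun n => _) = fun n => s1 * \int[nu0]_z F n z + s2 * \int[nu1]_z F n z).
    2: exact/funext.
  by apply: cvgD; apply: cvgM; [exact: cvg_cst|exact: cv|exact: cvg_cst|exact: cv].
Qed.

Lemma eq_determined f g : f =1 g -> moment_determined f -> moment_determined g.
Proof. by move=> /funext ->. Qed.

Lemma determined_cst (c : R) : moment_determined (fun=> c).
Proof.
apply: (eq_determined _ (determinedZ c (determined_mon [::]))) => z.
by rewrite /mon big_nil mulr1.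
Qed.

(** Two nested inductions, with concatenation of words as base case. Limits are preserved because
    members of the class are bounded. *)
Lemma determinedM f g : moment_determined f -> moment_determined g ->
  moment_determined (fun z => f z * g z).
Proof.
move=> df dg; elim: df => {f} [s|f1 f2 _ d1 _ d2|c f _ df|F f M _ dF FM Ff].
- elim: dg => {g} [t|g1 g2 _ d1 _ d2|c g _ dg|G g M _ dG GM Gg].
  + apply: (eq_determined _ (determined_mon (s ++ t))) => z.
    by rewrite /mon big_cat.
  + by apply: (eq_determined _ (determinedD d1 d2)) => z; rewrite mulrDr.
  + by apply: (eq_determined _ (determinedZ c dg)) => z; rewrite mulrCA.
  + have [_ [N sN]] := @bmeas_mon R s.
    apply: (determined_lim (M := N * M) dG) => [n z|z].
      by rewrite normrM; exact: ler_pM.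
    by apply: cvgM; [exact: cvg_cst|exact: Gg].
- by apply: (eq_determined _ (determinedD d1 d2)) => z; rewrite mulrDl.
- by apply: (eq_determined _ (determinedZ c df)) => z; rewrite mulrA.
- have [_ [N gN]] := determined_bmeas dg.
  apply: (determined_lim (M := M * N) dF) => [n z|z].
    by rewrite normrM; exact: ler_pM.
  by apply: cvgM; [exact: Ff|exact: cvg_cst].
Qed.

Lemma determinedX n f : moment_determined f -> moment_determined (fun z => f z ^+ n).
Proof.
move=> df; elim: n => [|n ih]; first exact: determined_cst.
by apply: (eq_determined _ (determinedM df ih)) => z; rewrite exprS.
Qed.

Lemma determined_sum (I : Type) (s : seq I) (F : I -> R[i] -> R) :
  (forall i, moment_determined (F i)) ->
  moment_determined (fun z => \sum_(i <- s) F i z).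
Proof.
move=> dF; elim: s => [|i s ih].
  by apply: (eq_determined _ (determined_cst 0)) => z; rewrite big_nil.
by apply: (eq_determined _ (determinedD (dF i) ih)) => z; rewrite big_cons.
Qed.

Lemma determined_expR f : moment_determined f ->
  moment_determined (fun z => expR (f z)).
Proof.
move=> df; have [_ [M fM]] := determined_bmeas df.
apply: (determined_lim (M := expR M) (F := fun n z => series (exp_coeff (f z)) n)).
- move=> n; rewrite /series/=; apply: determined_sum => k.
  apply: (eq_determined _ (determinedZ (k`!%:R^-1) (determinedX k df))) => z.
  by rewrite /exp_coeff/= mulrC.
- move=> n z; apply: (@le_trans _ _ (expR `|f z|)); last by rewrite ler_expR.
  apply: le_trans (ler_norm_sum _ _ _) _.
  have -> : \sum_(0 <= i < n) `|exp_coeff (f z) i| = series (exp_coeff `|f z|) n.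
    rewrite /series/=; apply: eq_bigr => i _.
    by rewrite /exp_coeff/= normrM normrX (ger0_norm (x := _^-1))// invr_ge0.
  apply: nondecreasing_cvgn_le; last exact: is_cvg_series_exp_coeff.
  by apply: nondecreasing_series => k _ _; rewrite exp_coeff_ge0.
- by move=> z; exact: is_cvg_series_exp_coeff.
Qed.

(** The functions [expR (- expR (n%:R * f z))] tend to 1 where [f] is negative, to [expR (-1)] where
    it vanishes and to 0 where it is positive; powers of this limit then erase the middle value. *)
Lemma determined_negative f : moment_determined f ->
  moment_determined (\1_[set z | f z < 0]).
Proof.
move=> df; pose h z : R := if f z < 0 then 1 else if f z == 0 then expR (-1) else 0.
have e1 : expR (-1) < 1 :> R by rewrite expR_lt1 oppr_lt0.
have h01 z : 0 <= h z <= 1.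
  by rewrite /h; case: ifP => _; [|case: ifP => _]; rewrite ?ler01 ?lexx// expR_ge0 ltW.
have dh : moment_determined h.
  apply: (determined_lim (M := 1) (F := fun n z => expR (- expR (n%:R * f z)))).
  - move=> n; apply: determined_expR.
    by apply: (eq_determined _ (determinedZ (-1) (determined_expR
      (determinedZ n%:R df)))) => z; rewrite mulN1r.
  - move=> n z; rewrite ger0_norm ?expR_ge0// -[leRHS]expR0 ler_expR oppr_le0.
  - move=> z; rewrite /h; case: (ltgtP (f z) 0) => fz.
    + rewrite -[X in _ --> X]expR0 -[X in expR X]oppr0.
      apply: (continuous_cvg _ (@continuous_expR R _)); apply: cvgN.
      under eq_fun do rewrite expRM_natl.
      by apply: cvg_expr; rewrite ger0_norm ?expR_ge0// expR_lt1.
    + have g0 : expR (- f z) ^+ n @[n --> \oo] --> (0 : R).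
        by apply: cvg_expr; rewrite ger0_norm ?expR_ge0// expR_lt1 oppr_lt0.
      apply: (squeeze_cvgr _ (@cvg_cst _ 0 _ \oo _) g0).
      apply: nearW => n; rewrite expR_ge0/= -expRM_natl ler_expR mulrN lerN2.
      by apply: le_trans (expR_ge1Dx _); rewrite lerDr.
    + rewrite fz; under eq_fun do rewrite mulr0 expR0; exact: cvg_cst.
apply: (determined_lim (M := 1) (F := fun n z => h z ^+ n)).
- by move=> n; exact: determinedX.
- move=> n z; have /andP[h0 h1] := h01 z.
  by rewrite ger0_norm ?exprn_ge0// exprn_ile1.
- move=> z; rewrite indicE; have [|zf] := boolP (z \in _).
    rewrite inE /= => zf; rewrite /h zf.
    by under eq_fun do rewrite expr1n; exact: cvg_cst.
  have {}zf : (f z < 0) = false by apply/negP => H; move/negP: zf; apply; rewrite inE.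
  apply: cvg_expr; rewrite /h zf; case: ifP => _; last by rewrite normr0.
  by rewrite ger0_norm ?expR_ge0.
Qed.

Lemma determined_feat (c : 'I_6 -> R) :
  moment_determined (fun z => \sum_i c i * feat i z).
Proof.
apply: determined_sum => i; apply: determinedZ.
by apply: (eq_determined _ (determined_mon [:: i])) => z; rewrite /mon big_seq1.
Qed.

(** A disc is a spherical cap, cut out by a half-space: after division by [hgt z] its equation is
    linear in the features. *)
Lemma determined_ball w (r : R) : 0 < r ->
  moment_determined (\1_[set z | modulus (z - w) < r]).
Proof.
move=> r0.
pose c (i : 'I_6) := nth 0 [:: modulus w ^+ 2 - r ^+ 2; - (2 * Re w); 0; - (2 * Im w); 0; 1] i.
have cE z : \sum_i c i * feat i z = (modulus (z - w) ^+ 2 - r ^+ 2) / hgt z.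
  have := hgt_gt0 z; rewrite /feat !big_ord_recl big_ord0 /c/= /hgt !modulus_sqr.
  by case: z w {c} => [a b] [a' b'] /= /lt0r_neq0 h0; field.
rewrite (_ : [set z | _] = [set z | \sum_i c i * feat i z < 0]); last first.
  apply/seteqP; split=> z /=; rewrite cE pmulr_llt0 ?invr_gt0 ?hgt_gt0// subr_lt0.
    by move=> H; rewrite ltr_pXn2r// nnegrE ?modulus_ge0// ltW.
  by rewrite ltr_pXn2r// nnegrE ?modulus_ge0// ltW.
exact/determined_negative/determined_feat.
Qed.

Lemma determined_bigcup (B : nat -> set R[i]) :
  (forall n, moment_determined (\1_(B n))) ->
  moment_determined (\1_(\bigcup_n B n)).
Proof.
move=> dB.
apply: (determined_lim (M := 1) (F := fun n => \1_(\bigcup_(i < n) B i))).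
- elim=> [|n ih].
    apply: (eq_determined _ (determined_cst 0)) => z.
    by rewrite bigcup_mkord big_ord0 indic0.
  apply: (eq_determined _ (determinedD (determinedD ih (dB n))
    (determinedZ (-1) (determinedM ih (dB n))))) => z.
  rewrite !bigcup_mkord big_ord_recr/= !indicE in_setU.
  by case: (_ \in _); case: (_ \in _); rewrite /=; ring.
- by move=> n z; rewrite indicE; case: (_ \in _); rewrite ?normr1 ?normr0.
- move=> z; have [[n _ Bn]|nB] := pselect ((\bigcup_n B n) z).
    rewrite indicE mem_set; last by exists n.
    apply: cvg_near_cst; exists n.+1 => // m /= nm.
    by rewrite indicE mem_set//; exists n.
  rewrite indicE memNset//; apply: cvg_near_cst; apply: nearW => n.
  by rewrite indicE memNset// => -[m _ Bm]; apply: nB; exists m.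
Qed.

Lemma determined_open (U : set R[i]) : open U -> moment_determined (\1_U).
Proof.
move=> /open_modulusP oU.
pose D (q : rat * rat * rat) : set R[i] :=
  [set z | modulus (z - (ratr q.1.1 +i* ratr q.1.2)%C) < ratr q.2].
pose B n : set R[i] := if unpickle n is Some q then
  if `[< 0 < ratr q.2 :> R /\ D q `<=` U >] then D q else set0 else set0.
rewrite (_ : U = \bigcup_n B n); last first.
  apply/seteqP; split=> [z Uz|z [n _]]; last first.
    rewrite /B; case: unpickle => // q; case: asboolP => // -[_ H] Dz; exact: H.
  have [r r0 rU] := oU z Uz.
  have r4 : 0 < r / 4 by rewrite divr_gt0.
  (* The radius lies strictly between [r / 4] and [r / 2] and the centre within [r / 4] of [z], so
     the disc contains [z] and stays inside [U]. *)
  have [q] := rat_in_itvoo (ltr_pwDr r4 (lexx (r / 4))).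
  have near_rat (x : R) : exists a : rat, `|x - ratr a| < r / 8.
    have r8 : 0 < r / 8 by rewrite divr_gt0.
    have [a] : exists a : rat, (ratr a : R) \in `]x - r / 8, x + r / 8[.
      by apply: rat_in_itvoo; rewrite ltrD2l gtrN.
    by rewrite in_itv/= => /andP[? ?]; exists a; rewrite ltr_norml; lra.
  rewrite in_itv/= => /andP[q1 q2].
  have [a ha] := near_rat (Re z); have [b hb] := near_rat (Im z).
  have zab : modulus (z - (ratr a +i* ratr b)%C) < r / 4.
    apply: le_lt_trans (modulus_le_ReIm _) _.
    by case: z ha hb {Uz rU} => x y /= ha hb; lra.
  pose t := (a, b, q); have Dz : D t z by rewrite /D /=; lra.
  have tU : 0 < ratr t.2 :> R /\ D t `<=` U.
    split; first by rewrite /=; lra.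
    move=> w; rewrite /D /= => Dw; apply: rU.
    have := modulus_triangle w z (ratr a +i* ratr b)%C.
    by rewrite modulusB (modulusB _ z); lra.
  by exists (pickle t); [exact: I|rewrite /B pickleK asboolT].
apply: determined_bigcup => n; rewrite /B.
have d0 : moment_determined (\1_(set0 : set R[i])).
  by apply: (eq_determined _ (determined_cst 0)) => z; rewrite indic0.
case: unpickle => // q; case: asboolP => // -[q0 _]; exact: determined_ball.
Qed.

Lemma moments_mixed (mu nu0 nu1 : probability R[i] R) (s1 s2 : {nonneg R}) :
  (forall s, moment mu s = s1%:num * moment nu0 s + s2%:num * moment nu1 s) ->
  forall A, measurable A -> mu A = measure_add (mscale s1 nu0) (mscale s2 nu1) A.
Proof.
move=> mE A mA; apply: (measure_unique (@open R[i]) (fun=> setT)) => //.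
- exact: openI.
- by move=> _; exact: openT.
- by apply/seteqP; split=> // z _; exists 0%N.
- move=> U oU; have mU := open_measurableC oU.
  have := determined_int mE (determined_open oU); rewrite !bmeas_int_indic// => H.
  have : ((fine (mu U))%:E = s1%:num%:E * (fine (nu0 U))%:E + s2%:num%:E * (fine (nu1 U))%:E)%E.
    by rewrite H EFinD !EFinM.
  rewrite !prob_fineK// => muU; apply: (etrans muU); apply/esym.
  exact: measure_addE.
- by move=> _; rewrite (le_lt_trans (probability_le1 mu measurableT))// ltry.
Qed.

End moment_determined.

(** * Limits of zero counting measures *)

Section moments_equilibrium.
Context (R : realType).
Implicit Types (nu mu : probability R[i] R) (K : set R[i]) (z w : R[i]).

Lemma mutual_inv_prob K nu K' mu : compact K -> ~ K 0 -> nu K = 1%E ->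
  compact K' -> ~ K' 0 -> mu K' = 1%E ->
  mutual (inv_prob mu) nu = mutual mu (inv_prob nu).
Proof.
move=> cK K0 nuK cK' K'0 muK'; rewrite /mutual ge0_integral_distribution.
- apply: ge0_ae_eq_integral => //.
  + by apply: measurableT_comp; [exact: measurable_spot|exact: measurable_invC].
  + exact: measurable_spot.
  + by move=> u _; exact: spot_ge0.
  + by move=> u _; exact: spot_ge0.
  + apply: (prob_ae (compact_measurableC cK') muK') => u Ku _ /=.
    by rewrite (spot_inv cK K0 nuK)//; apply/eqP => u0; apply: K'0; rewrite -u0.
- exact: measurable_spot.
- by move=> u; exact: spot_ge0.
Qed.

Lemma green_at0 K : compact K -> ~ K 0 -> nonpolar K ->
  green_infty K 0 = robin K + lam (equilibrium_measure K).
Proof.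
move=> cK K0 npK; have [r r0 rK] := compact_away0 cK K0.
have [[nuK _ _] _ _] := robinP cK npK.
have rK' w : K w -> r <= modulus (0 - w) by move=> /rK; rewrite sub0r normcN.
rewrite (green_potr cK npK r0 rK'); congr (_ + _).
rewrite (lam_indic cK K0 nuK) /potr opprK; apply: eq_Rintegral => w _.
rewrite /logr indicE; have [/set_mem Kw|_] := boolP (w \in K); last by rewrite !mulr0.
by rewrite sub0r normcN (elimT max_idPr)// rK.
Qed.

Lemma energyM_nondecreasing (a : seq 'I_6 -> R) :
  nondecreasing_seq (fun M => energyM M a a).
Proof.
apply/nondecreasing_seqP => n; rewrite {2}/energyM big_ord_recr/= lerDl.
exact: energyM_term_ge0.
Qed.

Lemma mutual_cvg_fin mu nu (e : R) : mutual mu nu = e%:E ->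
  energyM M (moment mu) (moment nu) @[M --> \oo] --> e.
Proof. by move=> H; have := @mutual_cvg _ mu nu; rewrite H => /fine_cvgP[]. Qed.

Lemma mutual_fin mu nu (e : R) : (mutual mu nu <= e%:E)%E ->
  exists2 x : R, mutual mu nu = x%:E & x <= e.
Proof.
by move: (mutual_ge0 mu nu); case: (mutual mu nu) => // x _; rewrite lee_fin => ?; exists x.
Qed.

(* With [nu0], [nui] the two harmonic measures, the energy of
   [mu - s1 nu0 - s2 nui] is nonpositive: its terms are evaluated by
   [mutual_equilibrium], except for [mutual nu0 nui], which is bounded from the
   side of each pole. *)
Lemma moments_equilibrium K T mu (s1 s2 : R) :
  compact K -> ~ K 0 -> nonpolar K -> compact T -> ~ T 0 -> mu T = 1%E ->
  (mutual mu mu <= (2 * ell mu)%:E)%E -> lam mu = 0 ->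
  (forall f : R[i] -> R, continuous f -> bmeas f ->
    (forall z, 0 <= f z <= green_infty K z) -> \int[mu]_z f z <= 0) ->
  (forall f : R[i] -> R, continuous f -> bmeas f ->
    (forall z, 0 <= f z <= green_infty (recip K) z) ->
    \int[inv_prob mu]_z f z <= 0) ->
  0 <= s1 -> 0 <= s2 -> s1 + s2 = 1 ->
  s1 * robin (recip K) + s2 * green_infty K 0 = 0 ->
  s1 * green_infty (recip K) 0 + s2 * robin K = 0 ->
  forall s, moment mu s =
    s1 * moment (harmonic_zero K) s + s2 * moment (equilibrium_measure K) s.
Proof.
move=> cK K0 npK cT T0 muT mumu lmu Hinf Hzero s1_ge0 s2_ge0 s12 eq0 eqi.
have cK' := compact_recip cK K0; have K'0 := recip0 K0.
have npK' := nonpolar_recip cK K0 npK.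
have [[nuK nuV _] _ _] := robinP cK npK; have [[nuK' nuV' _] _ _] := robinP cK' npK'.
rewrite harmonic_zeroE; set nui := equilibrium_measure K in nuK nuV *.
set nu' := equilibrium_measure (recip K) in nuK' nuV' *.
have mii := energy_fin_mutual cK nuK nuV; have m00' := energy_fin_mutual cK' nuK' nuV'.
set nu0 := inv_prob nu'; set V := robin K in nuV mii eqi; set V0 := robin (recip K) in nuV' m00' eq0.
have nu0K : nu0 K = 1%E by rewrite /nu0 inv_prob_setE.
have cT' := compact_recip cT T0; have T'0 := recip0 T0.
have imuT : inv_prob mu (recip T) = 1%E by rewrite inv_prob_setE recip_recip.
have inuiK : inv_prob nui (recip K) = 1%E by rewrite inv_prob_setE recip_recip.
have ell0 : ell nu' = ell nu0 - lam nu0.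
  by rewrite /nu0 (ell_inv cK' K'0 nuK') (lam_inv cK' K'0 nuK'); ring.
have m00 : mutual nu0 nu0 = (V0 + 2 * (ell nu0 - lam nu0))%:E.
  by rewrite /nu0 (mutual_inv cK' K'0 nuK' cK' K'0 nuK') m00' ell0.
have mmi : mutual mu nui = (V + ell nui + ell mu)%:E.
  exact: mutual_equilibrium cT muT mumu Hinf.
(* The pole at 0 is treated by inversion; [lam mu = 0] says that inversion does not change
   [ell mu]. *)
have mm0 : mutual mu nu0 = (V0 + ell nu0 - lam nu0 + ell mu)%:E.
  rewrite /nu0 -(mutual_inv_prob cK' K'0 nuK' cT T0 muT).
  rewrite (mutual_equilibrium cK' npK' cT' imuT (e := 2 * ell mu) _ Hzero).
    by rewrite -/nu' ell0 (ell_inv cT T0 muT) lmu subr0 addrA.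
  by rewrite (mutual_inv cT T0 muT cT T0 muT).
have [x m0i xi] := mutual_fin (mutual_le_robin cK npK cK nu0K).
(* The first bound on [x] came from the pole at infinity, this one comes from the pole at 0. Each is
   used for one of the two copies of [s1 * s2 * x] in the energy. *)
have x0 : x <= V0 + ell nu0 - lam nu0 + (ell nui - lam nui).
  have : (mutual (inv_prob nui) nu' <= (V0 + ell nu' + ell (inv_prob nui))%:E)%E.
    exact: (@mutual_le_robin R (recip K) cK' npK' (inv_prob nui) (recip K)).
  rewrite (mutual_inv_prob cK' K'0 nuK' cK K0 nuK) mutualC m0i lee_fin ell0.
  by rewrite (ell_inv cK K0 nuK) -/nui; lra.
have [y mmm ymu] := mutual_fin mumu.
rewrite (green_at0 cK K0 npK) -/V in eq0.
rewrite (green_at0 cK' K'0 npK') -/V0 -/nu' in eqi.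
have l0' : lam nu0 = - lam nu' by rewrite /nu0 (lam_inv cK' K'0 nuK').
pose c s := moment mu s + (- s1 * moment nu0 s + - s2 * moment nui s).
suff c0 s : c s = 0.
  by move=> s; have := c0 s; rewrite /c !mulNr -opprD => /eqP; rewrite subr_eq0 => /eqP.
pose Q M := energyM M (moment mu) (moment mu) +
  (s1 ^+ 2 * energyM M (moment nu0) (moment nu0) +
   (s2 ^+ 2 * energyM M (moment nui) (moment nui) +
   (- (2 * s1) * energyM M (moment mu) (moment nu0) +
   (- (2 * s2) * energyM M (moment mu) (moment nui) +
    2 * s1 * s2 * energyM M (moment nu0) (moment nui))))).
have QE M : energyM M c c = Q M.
  rewrite /c energyMDl !energyMDr !energyMDl !energyMZl !energyMZr /Q.
  rewrite (energyMC _ (moment nu0) (moment mu)) (energyMC _ (moment nui) (moment mu)).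
  by rewrite (energyMC _ (moment nui) (moment nu0)); ring.
have Qcvg : Q M @[M --> \oo] --> y + (s1 ^+ 2 * (V0 + 2 * (ell nu0 - lam nu0)) +
   (s2 ^+ 2 * (V + 2 * ell nui) + (- (2 * s1) * (V0 + ell nu0 - lam nu0 + ell mu) +
   (- (2 * s2) * (V + ell nui + ell mu) + 2 * s1 * s2 * x)))).
  have Z (k l : R) (u : nat -> R) : u M @[M --> \oo] --> l ->
      k * u M @[M --> \oo] --> k * l by move=> ul; apply: cvgM => //; exact: cvg_cst.
  apply: cvgD; first exact: mutual_cvg_fin mmm.
  apply: cvgD; first by apply: Z; exact: mutual_cvg_fin m00.
  apply: cvgD; first by apply: Z; exact: mutual_cvg_fin mii.
  apply: cvgD; first by apply: Z; exact: mutual_cvg_fin mm0.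
  apply: cvgD; first by apply: Z; exact: mutual_cvg_fin mmi.
  by apply: Z; exact: mutual_cvg_fin m0i.
(* The empty word is invisible to the energy; its moment is the total mass, and [s1 + s2 = 1]
   settles it. *)
case: s => [|i s].
  rewrite /c /moment /mon; under eq_Rintegral do rewrite big_nil.
  rewrite bmeas_int_cst; under [X in - s1 * X]eq_Rintegral do rewrite big_nil.
  rewrite bmeas_int_cst; under eq_Rintegral do rewrite big_nil.
  by rewrite bmeas_int_cst; lra.
apply: energyM_eq0 => // M.
have ndQ : nondecreasing_seq Q by move=> m n mn; rewrite -!QE energyM_nondecreasing.
rewrite QE; apply: le_trans (nondecreasing_cvgn_le ndQ (cvgP _ Qcvg) M) _.
rewrite (cvg_lim _ Qcvg)//.
have ss : 0 <= s1 * s2 by exact: mulr_ge0.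
have h1 := ler_wpM2l ss xi; have h2 := ler_wpM2l ss x0.
have s2E : s2 = 1 - s1 by lra.
rewrite -/V in h1.
rewrite -/nui in eq0; rewrite l0' in h1 h2 *.
(* The terms in [ell] cancel as [s1 + s2 = 1]. What remains of the bound is minus the combination of
   the two equations with weights [s1] and [s2], hence zero; the products with [s1] are supplied so
   that only linear arithmetic is left. *)
have e1 := congr1 (fun t => s1 * t) eq0; have e2 := congr1 (fun t => s1 * t) eqi.
rewrite s2E in h1 h2 e1 e2 eq0 eqi *; rewrite /= in e1 e2.
move: h1 h2 e1 e2 eq0 eqi ymu; clear; move: V V0 (ell _) (ell _) (ell _) (lam _) (lam _) => V V0 a b d l m.
by lra.
Qed.

End moments_equilibrium.

(** * Averages over the zeros and their discrete energy *)

Section averages.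
Context (R : realType).
Implicit Types (rs : seq R[i]) (f g : R[i] -> R) (z w x y : R[i]).

Definition avg rs f : R := (size rs)%:R^-1 * \sum_(x <- rs) f x.

Lemma avgD rs f g : avg rs (fun z => f z + g z) = avg rs f + avg rs g.
Proof. by rewrite /avg big_split/= mulrDr. Qed.

Lemma avgZ rs (c : R) f : avg rs (fun z => c * f z) = c * avg rs f.
Proof. by rewrite /avg -big_distrr/= mulrCA. Qed.

Lemma avg_le rs f g : (forall x, x \in rs -> f x <= g x) -> avg rs f <= avg rs g.
Proof.
move=> fg; rewrite /avg ler_wpM2l ?invr_ge0// big_seq [leRHS]big_seq.
exact: ler_sum.
Qed.

Lemma avg_ge0 rs f : (forall x, x \in rs -> 0 <= f x) -> 0 <= avg rs f.
Proof. by move=> f0; rewrite /avg mulr_ge0 ?invr_ge0// big_seq; exact: sumr_ge0. Qed.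

Lemma avg_functional rs : rs != [::] -> positive_functional (avg rs).
Proof.
move=> rs0; split.
- by move=> f g _ _; exact: avgD.
- by move=> c f _; exact: avgZ.
- by move=> f _ f0; exact: avg_ge0.
- rewrite /avg big_const_seq count_predT iter_addr_0 mulVf//.
  by rewrite pnatr_eq0 size_eq0.
Qed.

Lemma integral_zeros_ge0 (p : {poly int}) g : p != 0 ->
  measurable_fun [set: R[i]] g -> (forall z, 0 <= g z) ->
  (\int[zeros_measure R p]_z (g z)%:E = (avg (zeros R p) g)%:E)%E.
Proof.
move=> p0 mg g0; have mgE : measurable_fun [set: R[i]] (EFin \o g).
  exact/measurable_EFinP.
have g0E (z : R[i]) : [set: R[i]] z -> (0 <= (EFin \o g) z)%E by rewrite /= lee_fin.
rewrite /zeros_measure ge0_integral_mscale// ge0_integral_measure_sum//.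
under eq_bigr do rewrite integral_dirac// diracT mul1e.
rewrite sumEFin -EFinM /avg size_zeros//; congr (EFin (_ * _)).
by rewrite [RHS](big_nth 0) big_mkord size_zeros.
Qed.

Lemma integral_zeros (p : {poly int}) f : p != 0 -> bmeas f ->
  \int[zeros_measure R p]_z f z = avg (zeros R p) f.
Proof.
move=> p0 [mf _]; rewrite /Rintegral integralE.
have mp : measurable_fun [set: R[i]] (fun z => Num.max (f z) 0).
  exact: measurable_maxr.
have mn : measurable_fun [set: R[i]] (fun z => Num.max (- f z) 0).
  by apply: measurable_maxr => //; exact: measurableT_comp.
under eq_integral do rewrite funeposE -EFin_max.
under [X in (_ - X)%E]eq_integral do rewrite funenegE -EFinN -EFin_max.
rewrite !integral_zeros_ge0// => [|z|z]; last 2 first.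
- by rewrite le_max lexx orbT.
- by rewrite le_max lexx orbT.
rewrite /= /avg -mulrBr -sumrB; congr (_ * _); apply: eq_bigr => x _.
by rewrite /Num.max; do 2 case: ifPn; rewrite -?leNgt; lra.
Qed.

(** Off the diagonal [kernM] is below the full kernel, whose logarithmic part sums to the
    discriminant. On the diagonal, where the full kernel is infinite, the truncation contributes one
    finite harmonic sum per zero, which for fixed [M] is negligible against the square of the
    degree. *)
Lemma discrete_energy (p : {poly int}) M : p != 0 -> simple_zeros R p ->
  zeros R p != [::] ->
  energyM M (fun s => avg (zeros R p) (mon s)) (fun s => avg (zeros R p) (mon s)) <=
  (degree p)%:R^-1 * \sum_(j < M) (2 * j.+1%:R)^-1 +
  2 * avg (zeros R p) (@logh R) +
  2 * ((degree p)%:R^-1 * ln (`|lead_coef p|%:~R : R)).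
Proof.
move=> p0 sp rs0; have := discriminant_bound p0 sp; have urs := uniq_zeros p0 sp.
rewrite -(size_zeros R p0); move: urs rs0; set rs := zeros R p => urs rs0.
set d := (size rs)%:R; set L := ln _; set D := \sum_(x <- rs) _ => Dge.
have d0 : 0 < d by rewrite ltr0n lt0n size_eq0.
have pa := avg_functional rs0.
rewrite -(functional_energyM _ _ pa).
have -> : avg rs (fun z => energyM M (mon ^~ z) (fun s => avg rs (mon s))) =
    d^-1 * (d^-1 * \sum_(z <- rs) \sum_(w <- rs) kernM M z w).
  rewrite {1}/avg -/d; congr (_ * _); rewrite big_distrr/=; apply: eq_bigr => z _.
  rewrite energyMC -(functional_energyM _ _ pa) /avg -/d; congr (_ * _).
  by apply: eq_bigr => w _; rewrite kernM_energyM energyMC.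
set H := \sum_(j < M) _; set S := \sum_(x <- rs) logh x.
have key : \sum_(z <- rs) \sum_(w <- rs) kernM M z w <= d * H + 2 * d * S - D.
  have diag : d * H = \sum_(z <- rs) H by rewrite big_const_seq count_predT iter_addr_0 mulr_natl.
  have lS : 2 * d * S = \sum_(z <- rs) \sum_(w <- rs) (logh z + logh w).
    under eq_bigr do rewrite big_split/= big_const_seq count_predT iter_addr_0.
    rewrite big_split/= big_const_seq count_predT iter_addr_0 -/S sumrMnl.
    by rewrite -[_ *+ _]mulr_natl -/d -/S; ring.
  rewrite diag lS /D -big_split/= -sumrB big_seq [leRHS]big_seq.
  apply: ler_sum => z zrs; rewrite (perm_big _ (perm_to_rem zrs)) big_cons.
  rewrite [X in _ <= _ + X - _](perm_big _ (perm_to_rem zrs)) big_cons.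
  have -> : kernM M z z = H.
    by apply: eq_bigr => j _; rewrite chordxx expr1n mul1r.
  (* The sum of [logh] runs over the diagonal as well; its nonnegative share is dropped here. *)
  rewrite -addrA lerD2l -addrA -[leLHS]add0r lerD ?addr_ge0 ?logh_ge0//.
  rewrite -sumrB big_seq [leRHS]big_seq; apply: ler_sum => w.
  rewrite rem_filter// mem_filter/= => /andP[wz _].
  have zw : z != w by rewrite eq_sym.
  by have := kernM_le M z w; rewrite (kernE zw) lee_fin.
have -> : d^-1 * H + 2 * avg rs (@logh R) + 2 * (d^-1 * L) =
    d^-1 * (d^-1 * (d * H + 2 * d * S + 2 * d * L)).
  by rewrite /avg -/d -/S; field; rewrite gt_eqF.
rewrite ler_pM2l ?invr_gt0// ler_pM2l ?invr_gt0// (le_trans key)//.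
by rewrite lerD2l lerNl -subr_ge0 opprK addrC.
Qed.

End averages.

(** * Tightness of the zeros on an annulus *)

Section limit_measure.
Context (R : realType) (K : set R[i]).
Hypotheses (cK : compact K) (K0 : ~ K 0) (npK : nonpolar K).
Implicit Types (z w x : R[i]).

Let cK' : compact (recip K). Proof. exact: compact_recip. Qed.
Let npK' : nonpolar (recip K). Proof. exact: nonpolar_recip. Qed.

Definition green_sum z : R := green_zero K z + green_infty K z.

Lemma green_zero_ge0 z : 0 <= green_zero K z.
Proof. exact: green_ge0. Qed.

Lemma green_sum_ge0 z : 0 <= green_sum z.
Proof. by rewrite addr_ge0 ?green_zero_ge0 ?green_ge0. Qed.

(** One Green function grows logarithmically at infinity, the other at 0. A vanishing average of
    [green_sum] therefore lets neither mass nor the averages of [ln (modulus z)] and [logh] escape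
    from the annulus [T]. *)
Lemma green_tail : exists (T : set R[i]) (C : R), [/\ compact T, ~ T 0, 0 <= C &
  forall z, z != 0 -> ~ T z -> [/\ 1 <= C * green_sum z,
    `|ln (modulus z)| <= C * green_sum z & logh z <= C * green_sum z]].
Proof.
have [A1 [C1 H1]] := green_growth cK npK.
have [A2 [C2 H2]] := green_growth cK' npK'.
pose B := Num.max (Num.max A1 A2) 1.
have B1 : 1 <= B by rewrite le_max lexx orbT.
have B0 : 0 < B by rewrite (lt_le_trans _ B1).
have AB1 : A1 <= B by rewrite !le_max lexx.
have AB2 : A2 <= B by rewrite !le_max lexx orbT.
pose T : set R[i] := [set z | B^-1 <= modulus z] `&` [set z | modulus z <= B].
exists T, (1 + `|C1| + `|C2|); split.
- apply: (@bounded_closed_compactC _ _ B); last by move=> z [].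
  by apply: closedI; apply: closed_le_fun => //;
    [exact: cst_continuous|exact: continuous_modulus|exact: continuous_modulus|
     exact: cst_continuous].
- by move=> [+ _]; rewrite /= expr0n/= addr0 sqrtr0 leNgt invr_gt0 B0.
- by rewrite !addr_ge0.
move=> z z0 nT; have zp : 0 < modulus z by rewrite modulus_gt0.
have g1 := green_ge0 cK npK z; have g2 := green_zero_ge0 z.
have n1 := normr_ge0 C1; have n2 := normr_ge0 C2.
have p1 := mulr_ge0 n1 g2; have p2 := mulr_ge0 n2 g1.
have l1 := ler_wpM2r g1 (ler_norm C1); have l2 := ler_wpM2r g2 (ler_norm C2).
have p3 := mulr_ge0 n1 g1; have p4 := mulr_ge0 n2 g2.
rewrite /green_sum; have [Bz|zB] := ltP B (modulus z).
  have [h1 h2 h3 h4] := H1 z (le_lt_trans AB1 Bz).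
  have lz : 0 <= ln (modulus z) by rewrite ln_ge0// ltW.
  rewrite (ger0_norm lz).
  by move: h1 h2 h3 h4 g1 g2 p1 p2 p3 p4 l1 l2; clear; split; lra.
have {nT}zB' : modulus z < B^-1 by rewrite ltNge; apply/negP => H; exact: nT.
have Bz : A2 < modulus z^-1.
  by rewrite Normc.normcV (le_lt_trans AB2)// -[X in X < _]invrK ltf_pV2 ?posrE ?invr_gt0.
have [] := H2 _ Bz; rewrite logh_inv// Normc.normcV lnV ?posrE// -/(green_zero K z) => h1 h2 h3 h4.
have lz : ln (modulus z) <= 0.
  by rewrite ln_le0// (le_trans (ltW zB'))// invf_le1.
rewrite (ler0_norm lz).
by move: h1 h2 h3 h4 g1 g2 p1 p2 p3 p4 l1 l2 lz; clear; split; lra.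
Qed.

Variables (U : set_system nat) (rs_ : nat -> seq R[i]).
Hypotheses (UU : UltraFilter U) (rs_nonempty : \forall n \near U, rs_ n != [::]).
Hypothesis rs_neq0 : forall n x, x \in rs_ n -> x != 0.
Hypothesis green_cvg0 : avg (rs_ n) green_sum @[n --> U] --> (0 : R).

(** The convergence reaches beyond bounded functions to those dominated by [green_sum] off [T], as
    required for [logh] and [ln (modulus z)]. The constant [C] is returned so that bounded functions
    can be put in this form too. *)
Lemma limit_measure : exists (mu : probability R[i] R) (T : set R[i]) (C : R),
  [/\ compact T, ~ T 0, mu T = 1%E,
  forall z, z != 0 -> ~ T z -> [/\ 1 <= C * green_sum z,
    `|ln (modulus z)| <= C * green_sum z & logh z <= C * green_sum z] &
  forall (f : R[i] -> R) (D : R), {within T, continuous f} -> measurable_fun [set: R[i]] f ->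
    bmeas (fun z => f z * \1_T z) ->
    (forall z, z != 0 -> ~ T z -> `|f z| <= D * green_sum z) ->
    avg (rs_ n) f @[n --> U] --> \int[mu]_z f z].
Proof.
have [T [C [cT T0 C_ge0 TC]]] := green_tail.
have mT := compact_measurableC cT.
have pL : \forall n \near U, positive_functional (avg (rs_ n)).
  by apply: filterS rs_nonempty => n; exact: avg_functional.
have [pLam LamP] := ultralimit_functional UU pL.
set Lam := (fun f => _) in pLam LamP.
have tail (D : R) (g : R[i] -> R) : (forall z, z != 0 -> `|g z| <= D * green_sum z) ->
    avg (rs_ n) g @[n --> U] --> (0 : R).
  move=> gD; have DG : D * avg (rs_ n) green_sum @[n --> U] --> (0 : R).
    by rewrite -[X in _ --> X](mulr0 D); apply: cvgM => //; exact: cvg_cst.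
  have NDG : - (D * avg (rs_ n) green_sum) @[n --> U] --> (0 : R).
    by rewrite -[X in _ --> X]oppr0; apply: cvgN.
  apply: (squeeze_cvgr _ NDG DG); apply: nearW => n.
  rewrite -!avgZ -mulN1r -avgZ; apply/andP; split; apply: avg_le => x /rs_neq0/gD.
    by rewrite mulN1r ler_norml => /andP[].
  by rewrite ler_norml => /andP[].
have LT : Lam \1_(~` T) = 0.
  apply: (cvg_unique (@norm_hausdorff _ _) (LamP _ (bmeas_indic R (measurableC mT)))).
  apply: (tail C) => z z0; rewrite indicE; have [/set_mem nT|_] := boolP (z \in _).
    by rewrite normr1; have [] := TC z z0 nT.
  by rewrite normr0 mulr_ge0// green_sum_ge0.
have [mu [muT muP]] := riesz_compact cT pLam LT.
exists mu, T, C; split=> // f D cf mf bf fD.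
rewrite (_ : \int[mu]_z f z = \int[mu]_z (f z * \1_T z)); last first.
  apply: (prob_ae_Rintegral mT muT) => //; first by case: bf.
  by move=> z Tz; rewrite indicE mem_set// mulr1.
rewrite muP//; last first.
  apply/within_continuous_modulusP => z e Tz e0.
  have /within_continuous_modulusP/(_ z e Tz e0)[d d0 dP] := cf.
  by exists d => // w Tw zw; rewrite !indicE !mem_set// !mulr1; exact: dP.
have D_ge0 z : z != 0 -> `|f z - f z * \1_T z| <= `|D| * green_sum z.
  move=> z0; rewrite indicE; have [_|zT] := boolP (z \in T).
    by rewrite mulr1 subrr normr0 mulr_ge0// green_sum_ge0.
  rewrite mulr0 subr0 (le_trans (fD z z0 _))//.
    by move=> Tz; move/negP: zT; apply; rewrite inE.
  by rewrite ler_wpM2r ?green_sum_ge0 ?ler_norm.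
have -> : (fun n => avg (rs_ n) f) = (fun n =>
    avg (rs_ n) (fun z => f z - f z * \1_T z) + avg (rs_ n) (fun z => f z * \1_T z)).
  by apply/funext => n; rewrite -avgD; congr avg; apply/funext => z; rewrite subrK.
rewrite -[X in _ --> X]add0r.
by apply: cvgD; [exact: tail D_ge0|exact: LamP].
Qed.

End limit_measure.

(** * The three contributions to the height *)

Section height.
Context (R : realType) (K : set R[i]) (p : {poly int}).
Hypotheses (p0 : p != 0) (p_at0 : p.[0] != 0).
Local Notation rs := (zeros R p).
Local Notation d := ((degree p)%:R : R).

Let coef0_neq0 : p`_0 != 0. Proof. by rewrite -horner_coef0. Qed.

Lemma zeros_neq0 x : x \in rs -> x != 0.
Proof.
rewrite (zeros_root p0) => /rootP px; apply/eqP => x0; move: px.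
by rewrite x0 horner_coef0 coef_map/= => /eqP; rewrite intr_eq0 (negPf coef0_neq0).
Qed.

Let pos (n : int) : n != 0 -> 0 < (`|n|%:~R : R).
Proof. by move=> n0; rewrite ltr0z normr_gt0. Qed.

Lemma heightE : height K p = d^-1 * ln (`|p`_0|%:~R : R) +
  d^-1 * ln (`|lead_coef p|%:~R : R) + avg rs (green_sum K).
Proof.
rewrite /height normrM intrM lnM ?posrE ?pos ?lead_coef_eq0//.
by rewrite /avg size_zeros// !mulrDr.
Qed.

(** Vieta's formula for the product of the zeros. Both terms on the right also occur in [heightE],
    with a plus sign; when they tend to zero, the limit measure satisfies [lam mu = 0]. *)
Lemma avg_ln_modulus : avg rs (fun x => ln (modulus x)) =
  d^-1 * ln (`|p`_0|%:~R : R) - d^-1 * ln (`|lead_coef p|%:~R : R).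
Proof.
have mx x : x \in rs -> 0 < modulus x by move=> /zeros_neq0; rewrite modulus_gt0.
rewrite /avg size_zeros// sum_ln_prod// -mulrBr (prod_zeros R p).
rewrite lnM ?posrE ?pos ?lead_coef_eq0//; first by rewrite addrAC subrr add0r.
by rewrite big_seq; exact: prodr_gt0.
Qed.

End height.

(** * Convergence of the zero counting measures *)

Unset Implicit Arguments.

Theorem theorem1p1 (R : realType) (K : set R[i])
  (compactK : compact K) (K0 : ~ K 0)
  (nonpolarK : nonpolar K) (capK : cap_zero_infty K = 1)
  (s1 s2 : R) (s1_ge0 : 0 <= s1) (s2_ge0 : 0 <= s2) (s12 : s1 + s2 = 1)
  (eq_zero : s1 * robin_zero K + s2 * green_infty K 0 = 0)
  (eq_infty : s1 * green_zero_at_infty K + s2 * robin_infty K = 0)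
  (p : nat -> {poly int})
  (simple_p : forall n, simple_zeros R (p n))
  (p_at0 : forall n, (p n).[0] != 0)
  (height_p : height K (p n) @[n --> \oo] --> (0 : R))
  (degree_p : degree (p n) @[n --> \oo] --> \oo)
  (f : R[i] -> R) (cont_f : continuous f) (bounded_f : bounded_fun f) :
  \int[zeros_measure R (p n)]_x f x @[n --> \oo] -->
  \int[mixed_measure (NngNum s1_ge0) (NngNum s2_ge0) K]_x f x.
Proof.
have cst_neq0 n : (p n)`_0 != 0 by rewrite -horner_coef0.
have p_neq0 n : p n != 0 by apply: contra (cst_neq0 n) => /eqP ->; rewrite coef0.
pose rs n := zeros R (p n); pose d n : R := (degree (p n))%:R.
have rs_neq0 n x : x \in rs n -> x != 0 by exact: zeros_neq0.
pose a n : R := (d n)^-1 * ln (`|(p n)`_0|%:~R : R).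
pose b n : R := (d n)^-1 * ln (`|lead_coef (p n)|%:~R : R).
pose g n : R := avg (rs n) (green_sum K).
have a_ge0 n : 0 <= a n by rewrite mulr_ge0 ?invr_ge0// ln_int_ge0.
have b_ge0 n : 0 <= b n by rewrite mulr_ge0 ?invr_ge0// ln_int_ge0// lead_coef_eq0.
have g_ge0 n : 0 <= g n by apply: avg_ge0 => x _; exact: green_sum_ge0.
have hE n : height K (p n) = a n + b n + g n by exact: heightE.
(* The quantities [a], [b] and [g] add up to the height, so each is squeezed to 0. That [a] and [b]
   are nonnegative uses that the coefficients are nonzero integers. *)
have to0 (u : nat -> R) : (forall n, 0 <= u n <= height K (p n)) ->
    u n @[n --> \oo] --> (0 : R).
  by move=> uh; apply: (squeeze_cvgr _ (@cvg_cst _ 0 _ \oo _) height_p); exact: nearW.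
have a_cvg0 : a n @[n --> \oo] --> (0 : R).
  by apply: to0 => n; rewrite hE; have := b_ge0 n; have := g_ge0 n; have := a_ge0 n; lra.
have b_cvg0 : b n @[n --> \oo] --> (0 : R).
  by apply: to0 => n; rewrite hE; have := b_ge0 n; have := g_ge0 n; have := a_ge0 n; lra.
have g_cvg0 : g n @[n --> \oo] --> (0 : R).
  by apply: to0 => n; rewrite hE; have := b_ge0 n; have := g_ge0 n; have := a_ge0 n; lra.
have rs_nonempty : \forall n \near \oo, rs n != [::].
  have : \forall n \near \oo, (0 < degree (p n))%N.
    exact: (degree_p _ (nbhs_infty_gt 0)).
  apply: filterS => n.
  by rewrite -(size_zeros R (p_neq0 n)) lt0n size_eq0.
have d_cvg0 : (d n)^-1 @[n --> \oo] --> (0 : R).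
  have H : (k%:R^-1 : R) @[k --> \oo] --> (0 : R).
    by rewrite -cvg_shiftS; exact: cvg_harmonic.
  exact: cvg_comp degree_p H.
have bf : bmeas f.
  split; first exact: continuous_measurableC.
  by have [M [_ fM]] := bounded_f; exists (M + 1) => z; apply: fM => //; rewrite ltrDl.
rewrite (_ : (fun n => _) = (fun n => avg (rs n) f)); last first.
  by apply/funext => n; exact: integral_zeros.
apply: cvg_ultra => U UU oU.
have toU (u : nat -> R) (l : R) : u n @[n --> \oo] --> l -> u n @[n --> U] --> l.
  by move=> H A /H /oU.
have ne : \forall n \near U, rs n != [::] by exact: oU.
have [mu [T [C [cT T0 muT TC cvT]]]] := limit_measure compactK K0 nonpolarK UU ne
  rs_neq0 (toU _ _ g_cvg0).
have cvb (h : R[i] -> R) : {within T, continuous h} -> bmeas h ->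
    avg (rs n) h @[n --> U] --> \int[mu]_z h z.
  move=> ch bh; have [mh [M hM]] := bh.
  apply: (cvT _ (M * C)) => //.
    by apply: bmeasM => //; apply: bmeas_indic; exact: compact_measurableC.
  move=> z z0 nT; have [h1 _ _] := TC z z0 nT.
  have M0 : 0 <= M := le_trans (normr_ge0 _) (hM z).
  by rewrite -mulrA (le_trans (hM z))// ler_peMr.
have ell_cvg : avg (rs n) (@logh R) @[n --> U] --> ell mu.
  apply: (cvT _ C).
  - by apply: continuous_subspaceT; exact: logh_continuous.
  - exact: measurable_logh.
  - exact: (compact_bmeas cT (@logh_continuous R)).
  - by move=> z z0 nT; have [_ _] := TC z z0 nT; rewrite ger0_norm ?logh_ge0.
have lam0 : lam mu = 0.
  have lam_cvg : avg (rs n) (fun z => ln (modulus z)) @[n --> U] --> lam mu.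
    apply: (cvT _ C).
    - apply: continuous_in_subspaceT => z; rewrite inE => Tz.
      apply: (@continuous_comp _ _ _ (fun z : R[i] => modulus z) (@ln R)).
        exact: continuous_modulus.
      apply: continuous_ln; rewrite modulus_gt0.
      by apply/eqP => z0; apply: T0; rewrite -z0.
    - exact: measurable_lnmod.
    - exact: bmeas_ln_indic.
    - by move=> z z0 nT; have [] := TC z z0 nT.
  apply: (cvg_unique (@norm_hausdorff _ _) lam_cvg).
  rewrite (_ : (fun n => _) = (fun n => a n - b n)).
    have ab : a n - b n @[n --> U] --> (0 - 0 : R) by apply: cvgB; exact: toU.
    by rewrite subr0 in ab; exact: ab.
  by apply/funext => n; exact: avg_ln_modulus.
have mumu : (mutual mu mu <= (2 * ell mu)%:E)%E.
  (* The truncation [M] is fixed before [n] grows, so the diagonal term, a constant divided by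
     [d n], vanishes in the limit. *)
  apply: mutual_le => M.
  have mc s : avg (rs n) (mon s) @[n --> U] --> moment mu s.
    by apply: cvb; [apply: continuous_subspaceT; exact: mon_continuous|exact: bmeas_mon].
  have lhs := energyM_cvg (M := M) _ mc mc.
  have rhs : (d n)^-1 * (\sum_(j < M) (2 * j.+1%:R)^-1) + 2 * avg (rs n) (@logh R) +
      2 * b n @[n --> U] --> 2 * ell mu.
    rewrite -[X in _ --> X]addr0 -[X in _ --> _ + X](mulr0 2) -[X in _ --> X + _]add0r.
    rewrite -[X in _ --> X + _ + _](mul0r (\sum_(j < M) (2 * j.+1%:R)^-1)).
    apply: cvgD; first apply: cvgD.
    - by apply: cvgM; [exact: toU|exact: cvg_cst].
    - by apply: cvgM; [exact: cvg_cst|exact: ell_cvg].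
    - by apply: cvgM; [exact: cvg_cst|exact: toU].
  apply: (ler_cvg_to (lhs _) rhs).
  by apply: filterS ne => n ne; exact: discrete_energy.
(* The average of [h] is at most [g n], which tends to 0; applied to minorants of either Green
   function, this is how [mu] annihilates both. *)
have below_green (h : R[i] -> R) : {within T, continuous h} -> bmeas h ->
    (forall z, h z <= green_sum K z) -> \int[mu]_z h z <= 0.
  move=> ch bh hg; apply: (ler_cvg_to (cvb h ch bh) (toU _ _ g_cvg0)).
  by apply: nearW => n; apply: avg_le => x _; exact: hg.
have moments : forall s, moment mu s =
    s1 * moment (harmonic_zero K) s + s2 * moment (equilibrium_measure K) s.
  apply: (moments_equilibrium compactK K0 nonpolarK cT T0 muT mumu lam0) => //.
  - move=> h ch bh hg; apply: below_green => //; first exact: continuous_subspaceT.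
    move=> z; have /andP[_ h1] := hg z; apply: le_trans h1 _.
    by rewrite /green_sum lerDr green_zero_ge0.
  (* The test function becomes [h] composed with inversion, which is continuous on [T] but possibly
     not at 0; this is why [cvb] asks for continuity within [T]. *)
  - move=> h ch bh hg; rewrite (int_inv_prob cT T0 muT bh).
    apply: below_green.
    + apply: continuous_in_subspaceT => z; rewrite inE => Tz.
      apply: (@continuous_comp _ _ _ (@GRing.inv R[i]) h); last exact: ch.
      by apply: inv_continuous; apply/eqP => z0; apply: T0; rewrite -z0.
    + case: bh => mh [M hM]; split; last by exists M => z; exact: hM.
      by apply: measurableT_comp => //; exact: measurable_invC.
    + move=> z; have /andP[_ h1] := hg z^-1; apply: le_trans h1 _.
      by rewrite /green_sum lerDl green_ge0.
  - by rewrite -(robin_zeroE compactK K0 nonpolarK).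
  - by rewrite -(robin_inftyE compactK nonpolarK).
have mixed := moments_mixed (s1 := NngNum s1_ge0) (s2 := NngNum s2_ge0) moments.
rewrite (_ : Rintegral _ _ _ = \int[mu]_z f z).
  by apply: cvb => //; exact: continuous_subspaceT.
rewrite /Rintegral; congr fine; apply: eq_measure_integral => A mA _.
exact: esym (mixed A mA).
Qed.
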